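(* Let $n\ge2$, $m\ge1$, $I=[t_0,+\infty)$, $A\in\mathbb R^{n\times n}$, let a class $\mathcal K_3(A)$ be given, $f\in\mathcal K_3^{n\times1}(A)$, and let $\varphi_0(t,c_0)$ (parameter $c_0\in\mathbb R^{n_0}$, $0\le n_0\le n$) be some particular solution of class $\mathcal K_3^{n\times1}(A)\cap C^1(I)$ of $\frac{d\varphi}{dt}=A\varphi+f(t)$. Let $a>0$, $D:=\{(t,y):t\in I,\ y\in\mathbb R^{n\times1},\ \|y-\varphi_0(t,c_0)\|\le a\}$, and consider $$\frac{dy}{dt}=Ay+f(t)+\sum_{l=1}^m\varepsilon_l(t)f_l(t,y),\qquad(t,y)\in D.\qquad( * )$$ Let ranks $\varrho_1\le\dots\le\varrho_m$ ($\varrho_l\in\mathbb R^+$) of the $\varepsilon_l$ be given, let $k\in\mathbb N$, $p_{kl}:=\max\{0,[\rho_k-\varrho_l]+1\}$, $q_{kl}:=\left[\frac{\rho_k-\varrho_l}{\varrho_1}\right]$ ($l=1,\dots,m$), and suppose: 1. $\varepsilon_l:I\to\mathbb R$, $\varepsilon_l\in C^{p_{kl}}(I)$, $\frac{d^r\varepsilon_l(t)}{dt^r}=O\bigl((\varepsilon_1(t))^{(\varrho_l+r)/\varrho_1}\bigr)$, $\varepsilon_1(t)\ge0$, $\varepsilon_1(t)=o(1)$ ($l=1,\dots,m$, $r=0,\dots,p_{kl}$, $t\to+\infty$); 2. $f_l:D\to\mathbb R^{n\times1}$, $f_l\in C^{0,\max\{2,q_{kl}+1\}}_{t,y}(D)$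 ($l=1,\dots,m$); 3. $\sup_{(t,y)\in D}\|\partial_y^\wp f_l(t,y)\|<+\infty$ for $\wp\in\mathbb N_0^n$, $0\le|\wp|\le\max\{2,q_{kl}+1\}$, $l=1,\dots,m$; 4. $\partial_y^\wp f_l(t,\varphi_0(t,c_0))\in\mathcal K_3^{n\times1}(A)$ for $\wp\in\mathbb N_0^n$, $0\le|\wp|\le q_{kl}$ and all $l$ with $\rho_k\ge\varrho_l$; 5. there is a number $\varpi\in\mathbb R^+$ such that $\varepsilon_1\in\mathcal R_\varpi(I)$; 6. $\frac{d^r\varepsilon_l(t)}{dt^r}\in\mathcal R_1(I)$ for $r=1,\dots,[\rho_k-\varrho_l]$ and all $l$ with $\rho_k-\varrho_l\ge1$; 7. for all $l$ with $\varrho_l\le\varpi\varrho_1$, with $s_l:=\left[\varpi-\frac{\varrho_l}{\varrho_1}\right]$: $f_l\in C^{0,s_l+2}_{t,y}(D)$; $\sup_{(t,y)\in D}\|\partial_y^\wp f_l(t,y)\|<+\infty$ for $\wp\in\mathbb N_0^n$, $3\le|\wp|\le s_l+2$; and $\partial_y^\wp f_l(t,\varphi_0(t,c_0))\in\mathcal K_3^{n\times1}(A)$ for $\wp\in\mathbb N_0^n$, $1\le|\wp|\le s_l+1$; 8. $0\notin\Delta(A)$; 9. for every $l$ with $\varepsilon_l\notin\mathcal R_1(I)$, $\varepsilon_l$ is (at least non-strictly) monotone on $I$ and tends to $0$ as $t\to+\infty$, and $\frac{d\varepsilon_l}{dt}\in C(I)\cap\mathcal R_1(I)$; moreover $\varepsilon_1(t)>0$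 for $t\in I$; 10. every function of the form $$\gamma_1(\varepsilon_1(t))^{-1}\frac{d\varepsilon_1(t)}{dt}+\sum_{\substack{\wp\in\mathbb N_0^m,\ 1\le|\wp|<\varpi\\ \mu_\wp\notin\mathcal R_1(I)}}\gamma_\wp\mu_\wp(t),\qquad\gamma_1,\gamma_\wp\in\mathbb R,$$ keeps its sign, at least in the non-strict sense, for all sufficiently large $t\in I$; 11. $\rho_{k+1}>\varrho_1\varpi$ and $\rho_{k+1}\ge\varrho_1(2\varpi-1)$; 12. with $p_{jj}$ and $\varsigma_j$ as defined in the context, for each $j=1,\dots,n$ either $$p_{jj}(t)-\Re\varsigma_j(t)\ge0\quad(t\in I),$$ or $$\int_I\bigl(p_{jj}(t)-\Re\varsigma_j(t)\bigr)\,dt=-\infty.\qquad( ** )$$ Then for sufficiently large $t_0$ equation $( * )$ has on $I$ at least one particular solution of the form $y=s(t)+r$, where $$s(t)=\varphi_0(t,c_0)+\sum_{s=1}^k\sum_{p=1}^{\varkappa_s}\nu_{sp}(t)\varphi_{sp}(t,c_{sp}),$$ $\varphi_0(t,c_0),\varphi_{sp}(t,c_{sp})\in\mathcal K_3^{n\times1}(A)\cap C^1(I)$ ($s=1,\dots,k$, $p=1,\dots,\varkappa_s$), and the error satisfies $$r=o\bigl((\varepsilon_1(t))^{\frac{\rho_{k+1}}{\varrho_1}-\varpi}\bigr)\qquad(t\to+\infty).$$ Moreover, on an interval $[t_1,+\infty)$ the error $r$ depends on as many arbitrary scalar constants as there are indices $j\in\{1,\dots,n\}$ for which $( ** )$ holds;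 here $t_1\in\mathbb R$, $t_1\ge t_0$, is a sufficiently large number determined by these constants. (The family of solutions of the form $y=s(t)+r$ can contain no more than $n$ independent scalar parameters.)
   Context: Notation: $\mathbb N_0=\{0\}\cup\mathbb N$; $\mathbb R^+=(0,+\infty)$; $[x]$ is the integer part (floor); $\|\cdot\|$ is the maximum modulus of the entries; $S^{n\times1}$ denotes $n$-vectors with entries in the class $S$; $\lambda_1(A),\dots,\lambda_n(A)$ are the eigenvalues of $A$, $\Lambda(A)$ its spectrum, $\Delta(A)=\{\lambda_j(A)-\lambda_l(A):j,l=1,\dots,n,\ j\ne l\}$; for a multi-index $\wp$, $|\wp|=\sum_j\wp_j$, $\wp!=\prod_j\wp_j!$, $y^\wp=\prod_jy_j^{\wp_j}$, $\partial_y^\wp$ is the corresponding partial derivative. $C^{0,q}_{t,y}(D)$: partial $y$-derivatives up to order $q$ exist and are continuous on $D$. $\mathcal R(I)$ is the set of $g:I\to\mathbb C$ for which $\int_Ig\,dt$ exists (as a convergent integral) in $\mathbb C$; $\mathcal R_p(I)=\{g:I\to\mathbb C: |g|^p\in\mathcal R(I)\}$ for $p>0$. For $\wp\in\mathbb N_0^m$, $\mu_\wp(t)=\prod_{l=1}^m(\varepsilon_l(t))^{\wp_l}$. Empty sums are $0$, empty products $1$. A parameter in $\mathbb R^0$ means no parameter. ''For sufficiently large $t_0$'' means after replacing $t_0$ by a larger number and restricting everything to the new $I=[t_0,+\infty)$. Class $\mathcal K_3(A)$: some nonempty class of functions $f:I\to\mathbb R$ such that (1) every $f$ in it is continuous and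 bounded on $I$; (2) if $f_1,f_2\in\mathcal K_3(A)$, $\alpha\in\mathbb R$, then $\alpha f_1,\ f_1+f_2,\ f_1f_2\in\mathcal K_3(A)$; (3) for each $f\in\mathcal K_3(A)$ the mean value $\operatorname M(f)=\lim_{t\to+\infty}\frac1t\int_{t_0}^tf(\tau)\,d\tau$ exists (finite) and $\sup_{t\in I}\bigl|\int_{t_0}^t(f(\tau)-\operatorname M(f))\,d\tau\bigr|<+\infty$; (4) for every $\tilde f:I\to\mathbb C$ with $\Re\tilde f,\Im\tilde f\in\mathcal K_3(A)$ and every $\lambda\in\Lambda(A)\cup\Delta(A)$, the equation $\frac{dy}{dt}=\lambda y+\tilde f(t)$ ($y:I\to\mathbb C$) has at least one particular solution $y(t,\tilde c)$ on $I$ (parameter $\tilde c\in\mathbb C^{\tilde n}$, $0\le\tilde n\le1$) with $\Re y,\Im y\in\mathcal K_3(A)\cap C^1(I)$. Ranks: $\operatorname{Rank}(\varepsilon_l)=\varrho_l$. A product $\prod_{l=1}^m\prod_{r=0}^{k_l}\bigl(\frac{d^r\varepsilon_l(t)}{dt^r}\bigr)^{\beta_{lr}}$ with $k_l,\beta_{lr}\in\mathbb N_0$, not all $\beta_{lr}$ zero, has rank $\sum_l\sum_r(\varrho_l+r)\beta_{lr}$ (products are regarded as formal monomials in the $\varepsilon_l$ and their derivatives). The set of all ranks is discrete and is enumerated increasingly as $\rho_1<\rho_2<\dots$ (so $\rho_1=\varrho_1$). For each $s$, $\nu_{s1},\dots,\nu_{s\varkappa_s}$ enumerates the products of rank $\rho_s$,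 with $\nu_{1p}=\varepsilon_p$ for $p=1,\dots,\varkappa_1$. Coefficients: $\varphi_{sp}(t,c_{sp})$ (parameters $c_{sp}\in\mathbb R^{n_{sp}}$, $0\le n_{sp}\le n$) are, recursively in $s=1,\dots,k$, particular solutions of class $\mathcal K_3^{n\times1}(A)\cap C^1(I)$ of $\frac{d\varphi_{sp}}{dt}=A\varphi_{sp}+g_{sp}$, where, with $\tilde\delta=\sum_{s\ge1}\sum_p\nu_{sp}\varphi_{sp}$, $g_{sp}$ is the coefficient of $\nu_{sp}$ in the formal expansion of $$-\sum_{s',p'}\frac{d\nu_{s'p'}}{dt}\varphi_{s'p'}+\sum_{l=1}^m\varepsilon_l\sum_{\wp\in\mathbb N_0^n}\frac1{\wp!}\partial_y^\wp f_l(t,\varphi_0(t,c_0))\tilde\delta^\wp$$ ($d\nu_{s'p'}/dt$ being expanded by the product rule as a combination of products of rank $\rho_{s'}+1$). The function $g_{sp}$ involves only $\varphi_0$ and the $\varphi_{s'p'}$ with $s'<s$, and for $s\le k$ only the derivatives $\partial_y^\wp f_l(t,\varphi_0)$ with $\rho_k\ge\varrho_l$, $|\wp|\le q_{kl}$. Functions $p_{jj}$, $\varsigma_j$: let $\hat A(t)=A+\sum_{l=1}^m\varepsilon_l(t)\frac{\partial f_l(t,s(t))}{\partial y}$. A real Lyapunov matrix is $Q:I\to\mathbb R^{n\times n}$, $Q\in C^1(I)$, with $Q$ and $dQ/dt$ bounded and $|\det Q(t)|\ge\mathrm{const}>0$ on $I$. Under hypotheses 1–11, for $t_0$ large, there is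 (by an earlier theorem of the authors) a real Lyapunov matrix $Q$, with $\lim_{t\to+\infty}\det Q(t)$ existing and nonzero, such that $r=Q(t)x$ transforms $\frac{dr}{dt}=\hat A(t)r$ into $\frac{dx}{dt}=\Re D(t)\,x$, $D=\operatorname{diag}(d_1,\dots,d_n)$, $$d_j(t)=\lambda_j(A)+\sum_{\substack{\wp\in\mathbb N_0^m,\ 1\le|\wp|<\varpi\\ \mu_\wp\notin\mathcal R_1(I)}}\gamma_{j\wp}\mu_\wp(t)+\varsigma_j(t),\qquad\gamma_{j\wp}\in\mathbb C,\ \ \varsigma_j:I\to\mathbb C,\ \varsigma_j\in\mathcal R(I)\cap C(I).$$ Fix such $Q,\gamma_{j\wp},\varsigma_j$ and put $$p_{jj}(t)=\Re d_j(t)+\Bigl(\varpi-\frac{\rho_{k+1}}{\varrho_1}\Bigr)(\varepsilon_1(t))^{-1}\frac{d\varepsilon_1(t)}{dt},\qquad j=1,\dots,n.$$ Standing assumption: $g(t):=-\frac{ds(t)}{dt}+As(t)+f(t)+\sum_{l=1}^m\varepsilon_l(t)f_l(t,s(t))$ is not identically zero on $I$ (otherwise $y\equiv s(t)$ is an exact solution). *)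

(* Defs.v *)
From HB Require Import structures.
From mathcomp Require Import all_boot all_order all_algebra.
From mathcomp Require Import finmap multiset complex.
From mathcomp Require Import all_classical all_reals all_analysis.

Set Implicit Arguments.
Unset Strict Implicit.
Unset Printing Implicit Defensive.

Import Order.TTheory GRing.Theory Num.Theory.
Import numFieldNormedType.Exports.

Local Open Scope classical_set_scope.
Local Open Scope complex_scope.
Local Open Scope ring_scope.

(* A function on the half-line [t0, +oo) is a function on R used only there;
   derivatives and continuity are relative to the half-line, hence one-sided
   at t0. *)
Definition halfline (R : realType) (t0 : R) : set R := [set t | t0 <= t].

Canonical pinfty_filter_on (R : numFieldType) :=
  FilterType (pinfty_nbhs R) _.

Section calculus.
Context {R : realType}.

Section derivative.
Context {V : normedModType R}.
Implicit Types (t : R) (f : R -> V).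

Definition diffquot f t : R -> V := fun u => (u - t)^-1 *: (f u - f t).

Definition has_deriv (t0 : R) f t (v : V) : Prop :=
  diffquot f t u @[u --> within (halfline t0) t^'] --> v.

Definition deriv_on (t0 : R) f : R -> V :=
  fun t => lim (diffquot f t u @[u --> within (halfline t0) t^']).

Definition continuous_on (t0 : R) f : Prop := {within halfline t0, continuous f}.

Definition Cn_on (t0 : R) (p : nat) f : Prop :=
  (forall r, (r < p)%N -> forall t, t0 <= t ->
     exists v, has_deriv t0 (iter r (deriv_on t0) f) t v) /\
  (forall r, (r <= p)%N -> continuous_on t0 (iter r (deriv_on t0) f)).

Definition solves (t0 : R) (F : R -> V -> V) (y : R -> V) : Prop :=
  forall t, t0 <= t -> has_deriv t0 y t (F t (y t)).

End derivative.

Definition integral_to (t0 : R) (g : R -> R) (t : R) : R :=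
  \int[lebesgue_measure]_(x in `[t0, t]) g x.

(* The class calR(I): convergence at +oo of the integrals over [t0, t]. *)
Definition conv_int (t0 : R) (g : R -> R) : Prop :=
  (forall t, t0 <= t ->
     (@lebesgue_measure R).-integrable `[t0, t] (EFin \o g)) /\
  cvg (integral_to t0 g t @[t --> +oo]).

Definition conv_int_C (t0 : R) (g : R -> R[i]) : Prop :=
  conv_int t0 (@complex.Re R \o g) /\ conv_int t0 (@complex.Im R \o g).

(* The class calR_p(I), for real-valued functions. *)
Definition conv_int_p (t0 : R) (p : R) (g : R -> R) : Prop :=
  conv_int t0 (fun t => `|g t| `^ p).

Definition diverges_to_ninfty (t0 : R) (g : R -> R) : Prop :=
  integral_to t0 g t @[t --> +oo] --> -oo.

End calculus.

Section classK3.
Context {R : realType} {n : nat}.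

Definition eigenvalues_of (A : 'M[R]_n) (lam : 'I_n -> R[i]) : Prop :=
  char_poly (map_mx (real_complex R) A) = \prod_j ('X - (lam j)%:P).

Definition Lambda (lam : 'I_n -> R[i]) : set R[i] := range lam.

Definition Delta (lam : 'I_n -> R[i]) : set R[i] :=
  [set z | exists j l, j != l /\ z = lam j - lam l].

Definition solves_C (t0 : R) (lam : R[i]) (h y : R -> R[i]) : Prop :=
  forall t, t0 <= t ->
    has_deriv t0 (@complex.Re R \o y) t (complex.Re (lam * y t + h t)) /\
    has_deriv t0 (@complex.Im R \o y) t (complex.Im (lam * y t + h t)).

(* [K3_ext] says that membership depends only on the values on [t0, +oo), so
   that K is a class of functions on the half-line. *)
Record is_K3 (t0 : R) (lam : 'I_n -> R[i]) (K : set (R -> R)) : Prop := IsK3 {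
  K3_ext : forall f g, (forall t, t0 <= t -> f t = g t) -> K f -> K g;
  K3_nonempty : K !=set0;
  K3_cont : forall f, K f -> continuous_on t0 f;
  K3_bounded : forall f, K f -> exists C, forall t, t0 <= t -> `|f t| <= C;
  K3_scale : forall (a : R) f, K f -> K (fun t => a * f t);
  K3_add : forall f g, K f -> K g -> K (fun t => f t + g t);
  K3_mul : forall f g, K f -> K g -> K (fun t => f t * g t);
  K3_mean : forall f, K f -> exists M : R,
    (t^-1 * integral_to t0 f t @[t --> +oo] --> M) /\
    (exists C, forall t, t0 <= t ->
       `|integral_to t0 (fun x => f x - M) t| <= C);
  K3_solution : forall h : R -> R[i],
    K (@complex.Re R \o h) -> K (@complex.Im R \o h) ->
    forall z, (Lambda lam `|` Delta lam) z ->
    exists y : R -> R[i],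
      [/\ solves_C t0 z h y,
          K (@complex.Re R \o y) /\ K (@complex.Im R \o y),
          Cn_on t0 1 (@complex.Re R \o y) & Cn_on t0 1 (@complex.Im R \o y)]
}.

Definition K3v (K : set (R -> R)) (f : R -> 'cV[R]_n) : Prop :=
  forall i, K (fun t => f t i 0).

End classK3.

Section multi_index.
Context {n : nat}.

Definition mindex := {ffun 'I_n -> nat}.
Definition mabs (w : mindex) : nat := (\sum_j w j)%N.
Definition mfact (w : mindex) : nat := (\prod_j (w j)`!)%N.

End multi_index.
Arguments mindex : clear implicits.

Section partial_derivatives.
Context {R : realType} {n : nat}.
Notation vec := ('cV[R]_n).
Implicit Types (D : set (R * vec)) (F : R * vec -> vec).

Definition tube (t0 a : R) (phi0 : R -> vec) : set (R * vec) :=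
  [set z | t0 <= z.1 /\ `|z.2 - phi0 z.1| <= a].

(* The increments h are those for which the shifted point stays in D, so the
   derivative is one-sided at the faces y_j - phi0_j(t) = a or -a. *)
Definition pquot j F (z : R * vec) : R -> vec :=
  fun h => h^-1 *: (F (z.1, z.2 + h *: delta_mx j 0) - F z).

Definition pincr D j (z : R * vec) : set R :=
  [set h | D (z.1, z.2 + h *: delta_mx j 0)].

Definition has_partial D j F z (v : vec) : Prop :=
  pquot j F z h @[h --> within (pincr D j z) 0^'] --> v.

Definition partial D j F : R * vec -> vec :=
  fun z => lim (pquot j F z h @[h --> within (pincr D j z) 0^']).

Definition partials D (js : seq 'I_n) F : R * vec -> vec :=
  foldr (partial D) F js.

Definition mpartial D (w : mindex n) F : R * vec -> vec :=
  partials D (flatten [seq nseq (w j) j | j <- enum 'I_n]) F.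

(* C^{0,q}_{t,y}(D): all iterated partial derivatives, in any order. *)
Definition C0q D (q : nat) F : Prop :=
  (forall js, (size js < q)%N -> forall j z, D z ->
     exists v, has_partial D j (partials D js F) z v) /\
  (forall js, (size js <= q)%N -> {within D, continuous (partials D js F)}).

Definition bounded_on D F : Prop := exists C, forall z, D z -> `|F z| <= C.

Definition jacobian D F z : 'M[R]_n := \matrix_(i, j) partial D j F z i 0.

End partial_derivatives.

(* The index l = 1, ..., m of the text is [l : 'I_m.+1] (so that there is at
   least one epsilon), epsilon_1 being [eps ord0].  A formal monomial in the
   epsilon_l and their derivatives is the multiset of its factors, the letter
   (l, r) standing for the r-th derivative of epsilon_l. *)
Notation monomial m := {mset ('I_m.+1 * nat)%type}%mset.

Section monomials.
Context {R : realType} {m : nat}.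

Definition rank (vr : 'I_m.+1 -> R) (nu : monomial m) : R :=
  \sum_(x <- nu) (vr x.1 + x.2%:R).

Definition products (vr : 'I_m.+1 -> R) (r : R) : set (monomial m) :=
  [set nu | nu != mset0 /\ rank vr nu = r].

(* rho 1 < rho 2 < ... lists all ranks; rho 0 is irrelevant. *)
Definition rank_enum (vr : 'I_m.+1 -> R) (rho : nat -> R) : Prop :=
  (forall s, (1 <= s)%N -> rho s < rho s.+1) /\
  [set rho s | s in [set s | (1 <= s)%N]] =
  [set rank vr nu | nu in [set nu : monomial m | nu != mset0]].

Definition mval (t0 : R) (eps : 'I_m.+1 -> R -> R) (nu : monomial m) (t : R) : R :=
  \prod_(x <- nu) iter x.2 (deriv_on t0) (eps x.1) t.

(* Coefficient of nu in the expansion of d nu'/dt by the product rule. *)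
Definition deriv_coef (nu' nu : monomial m) : nat :=
  count (fun x => nu == ((nu' `\ x) `+` [mset (x.1, x.2.+1)])%mset) nu'.

(* Formal power series in the letters (at a fixed time t), given by their
   coefficients. *)
Definition fseries := monomial m -> R.

Definition fone : fseries := fun nu => (nu == mset0)%:R.

Definition fletter (x : 'I_m.+1 * nat) : fseries :=
  fun nu => (nu == [mset x]%mset)%:R.

Definition fmul (F G : fseries) : fseries := fun nu =>
  \sum_(ab \in [set ab : monomial m * monomial m | (ab.1 `+` ab.2)%mset = nu])
     F ab.1 * G ab.2.

Definition fexp (F : fseries) (p : nat) : fseries := iter p (fmul F) fone.

End monomials.

Definition mu_eps {R : realType} {m : nat} (eps : 'I_m.+1 -> R -> R)
    (w : mindex m.+1) (t : R) : R := \prod_l eps l t ^+ w l.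

Definition mu_indices {R : realType} {m : nat} (t0 varpi : R)
    (eps : 'I_m.+1 -> R -> R) : set (mindex m.+1) :=
  [set w | [/\ (1 <= mabs w)%N, (mabs w)%:R < varpi &
               ~ conv_int_p t0 1 (mu_eps eps w)]].

Section system.
Context {R : realType} {n m : nat}.
Notation vec := ('cV[R]_n).
Variables (t0 : R) (A : 'M[R]_n) (f phi0 : R -> vec) (a : R).
Variables (eps : 'I_m.+1 -> R -> R) (fl : 'I_m.+1 -> R * vec -> vec).
Notation D := (tube t0 a phi0).

Definition rhs (t : R) (y : vec) : vec :=
  A *m y + f t + \sum_l eps l t *: fl l (t, y).

Definition solves_in_tube (t1 : R) (y : R -> vec) : Prop :=
  (forall t, t1 <= t -> D (t, y t)) /\ solves t1 rhs y.

(* The coefficients phi_{sp} are indexed by the product nu_{sp} itself. *)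
Section coefficients.
Variables (vr : 'I_m.+1 -> R) (rho : nat -> R) (k : nat).
Variable phi : monomial m -> R -> vec.

(* j-th component of the formal series delta~ = sum nu_{sp} phi_{sp}(t). *)
Definition fdelta (t : R) (j : 'I_n) : fseries :=
  fun nu => if nu == mset0 then 0 else phi nu t j 0.

Definition fdelta_pow (t : R) (w : mindex n) : fseries :=
  \big[fmul/fone]_j fexp (fdelta t j) (w j).

Definition g_coef (nu : monomial m) (t : R) : vec :=
  - (\sum_(nu' \in [set nu' : monomial m | nu' != mset0])
       (deriv_coef nu' nu)%:R *: phi nu' t)
  + \sum_l \sum_(w \in [set: mindex n])
      ((mfact w)%:R^-1 * fmul (fletter (l, 0%N)) (fdelta_pow t w) nu)
        *: mpartial D w (fl l) (t, phi0 t).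

Definition is_coefficients (K : set (R -> R)) : Prop :=
  forall s, (1 <= s <= k)%N -> forall nu, products vr (rho s) nu ->
    [/\ K3v K (phi nu), Cn_on t0 1 (phi nu) &
        solves t0 (fun t x => A *m x + g_coef nu t) (phi nu)].

Definition asym_sum (t : R) : vec :=
  phi0 t + \sum_(1 <= s < k.+1)
             \sum_(nu \in products vr (rho s)) mval t0 eps nu t *: phi nu t.

Definition residual (t : R) : vec :=
  - deriv_on t0 asym_sum t + rhs t (asym_sum t).

Definition Ahat (t : R) : 'M[R]_n :=
  A + \sum_l eps l t *: jacobian D (fl l) (t, asym_sum t).

(* y is, on [t1, +oo), a solution of the perturbed equation of the form
   s(t) + r with r = o(eps_1 ^ sigma). *)
Definition approx_solution (sigma t1 : R) (y : R -> vec) : Prop :=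
  solves_in_tube t1 y /\
  (fun t => y t - asym_sum t) =o_ (pinfty_nbhs R) (fun t => eps ord0 t `^ sigma).

End coefficients.
End system.

Section reduction.
Context {R : realType} {n : nat}.
Notation vec := ('cV[R]_n).

Definition lyapunov_matrix (t0 : R) (Q : R -> 'M[R]_n) : Prop :=
  [/\ Cn_on t0 1 Q,
      exists C, forall t, t0 <= t -> `|Q t| <= C,
      exists C, forall t, t0 <= t -> `|deriv_on t0 Q t| <= C &
      exists c, 0 < c /\ forall t, t0 <= t -> c <= `|\det (Q t)| ].

(* r = Q(t) x transforms dr/dt = B(t) r into dx/dt = C(t) x. *)
Definition transforms (t0 : R) (Q B C : R -> 'M[R]_n) : Prop :=
  forall x : R -> vec,
    solves t0 (fun t x => C t *m x) x <->
    solves t0 (fun t r => B t *m r) (fun t => Q t *m x t).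

Definition dfun {m : nat} (t0 varpi : R) (eps : 'I_m.+1 -> R -> R)
    (lam : 'I_n -> R[i]) (gamma : 'I_n -> mindex m.+1 -> R[i])
    (vsig : 'I_n -> R -> R[i]) (j : 'I_n) (t : R) : R[i] :=
  lam j + \sum_(w \in mu_indices t0 varpi eps) gamma j w * (mu_eps eps w t)%:C
  + vsig j t.

Definition pjj {m : nat} (t0 varpi kappa : R) (eps : 'I_m.+1 -> R -> R)
    (lam : 'I_n -> R[i]) (gamma : 'I_n -> mindex m.+1 -> R[i])
    (vsig : 'I_n -> R -> R[i]) (j : 'I_n) (t : R) : R :=
  complex.Re (dfun t0 varpi eps lam gamma vsig j t)
  + (varpi - kappa) * (eps ord0 t)^-1 * deriv_on t0 (eps ord0) t.

Definition ReD (d : 'I_n -> R -> R[i]) (t : R) : 'M[R]_n :=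
  diag_mx (\row_j complex.Re (d j t)).

(* The integers p_{kl} (nonnegative, as a nat) and q_{kl} (possibly negative)
   and the nat max{2, q_{kl} + 1}. *)
Definition p_ord {m : nat} (vr : 'I_m.+1 -> R) (rho : nat -> R) (k : nat)
    (l : 'I_m.+1) : nat :=
  absz (Num.max 0 (Num.floor (rho k - vr l) + 1)).

Definition q_ord {m : nat} (vr : 'I_m.+1 -> R) (rho : nat -> R) (k : nat)
    (l : 'I_m.+1) : int :=
  Num.floor ((rho k - vr l) / vr ord0).

Definition y_ord {m : nat} (vr : 'I_m.+1 -> R) (rho : nat -> R) (k : nat)
    (l : 'I_m.+1) : nat :=
  absz (Num.max 2 (q_ord vr rho k l + 1)).

(* A family of functions y c, the parameters being N scalar constants, each
   on a half-line [tc c, +oo).  Since R^N and R are equipotent, "N arbitrary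
   constants" means that distinct constants give distinct functions and that y
   depends continuously on them. *)
Definition param_family (N : nat) (tc : 'rV[R]_N -> R)
    (y : 'rV[R]_N -> R -> vec) : Prop :=
  (forall c c', c != c' ->
     exists t, [/\ tc c <= t, tc c' <= t & y c t != y c' t]) /\
  (forall c0, exists T, (\forall c \near c0, tc c <= T) /\
     forall t, T <= t -> y c t @[c --> c0] --> y c0 t).

End reduction.

(* Main.v *)
Require Import Defs.
From HB Require Import structures.
From mathcomp Require Import all_boot all_order all_algebra.
From mathcomp Require Import finmap multiset complex.
From mathcomp Require Import all_classical all_reals all_analysis.
From mathcomp Require Import perm zify.
From mathcomp Require Import ring lra.

Set Implicit Arguments.
Unset Strict Implicit.
Unset Printing Implicit Defensive.

Import Order.TTheory GRing.Theory Num.Theory.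
Import numFieldNormedType.Exports.

Local Open Scope classical_set_scope.
Local Open Scope complex_scope.
Local Open Scope ring_scope.

(** The coefficients are found by recursion on the rank: since 0 is not in
    [Delta lam], A is diagonalizable over C and each linear equation splits into
    scalar ones, which are solvable inside K.  Evaluating formal series truncated
    at the rank rho_k is multiplicative up to O(eps_1^kappa), where
    kappa = rho_{k+1} / vr_1; together with Taylor's formula this makes the
    residual of the asymptotic sum s an O(eps_1^kappa).

    The substitution y = s + eps_1^sigma Q z turns the equation into
    z' = diag(p_jj) z + F(t, z), where F(t, 0) and the Lipschitz constant of F are
    O(eps_1^varpi), hence integrable.  Up to a bounded factor, the kernel
    exp(int p_jj) is nondecreasing or, when the integral of p_jj - Re vsig_j
    diverges to -oo, nonincreasing with limit 0 (here the sign hypothesis is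
    used).  Integrating the j-th equation backwards from +oo in the first case
    and forwards from T in the second gives a contraction whose fixed points tend
    to 0 and are parametrized by the values z_j(T) of the second kind. *)

(** The exponent sigma = kappa - varpi is forced. In the variable z the residual becomes
    O(eps_1^(kappa - sigma)) = O(eps_1^varpi). The quadratic remainder carries a factor eps_1 and
    two factors of size eps_1^sigma; after division by eps_1^sigma its Lipschitz constant is
    O(eps_1^(1 + sigma)). Hypothesis 11 says that sigma > 0 and 1 + sigma >= varpi. The term (varpi
    - kappa) eps_1'/eps_1 of p_jj is what the derivative of eps_1^sigma leaves behind. The integral
    of Re vsig_j may converge only conditionally, so Re vsig_j cannot join the perturbation F; it
    stays in the kernel, where it costs a bounded factor. Two further obstacles: bounds are given
    only for derivatives of f_l taken in one fixed order of the coordinates, so every estimate for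
    f_l moves one coordinate at a time; and the contraction allows only initial values in a small
    ball, while the constants must run over all of R^N, which is therefore mapped injectively into
    that ball. *)

Section calculus.
Context {R : realType}.
Implicit Types (t T : R).

(** * Derivatives, continuity and integrals on a half-line *)

Lemma halfline_filter T t : T <= t -> ProperFilter (within (halfline T) t^').
Proof.
move=> Tt; apply: Build_ProperFilter_ex => B.
rewrite /within /dnbhs/=.
move=> /nbhs_ballP[e/= e0 H].
have te : t + e / 2 != t by lra.
exists (t + e / 2); apply: H => //=; rewrite /ball /=.
- rewrite opprD addNKr normrN gtr0_norm; lra.
- by rewrite /halfline /=; lra.
Qed.

Lemma has_deriv_unique {V : normedModType R} T (f : R -> V) t v :
  T <= t -> has_deriv T f t v -> deriv_on T f t = v.
Proof.
move=> Tt h; have PF := halfline_filter Tt.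
by apply: (@cvg_lim V (@norm_hausdorff _ _)).
Qed.

(** Both notions of derivative are brought to the same epsilon-delta form, so that at interior
    points of the half-line [has_deriv] can be exchanged for [is_derive], which has the usual rules
    and the mean value theorem. *)
Lemma has_derivP {V : normedModType R} T (f : R -> V) t v :
  has_deriv T f t v <->
  forall e, 0 < e -> exists2 d, 0 < d & forall u, T <= u -> u != t ->
    `|t - u| < d -> `|v - diffquot f t u| < e.
Proof.
rewrite /has_deriv; split.
  move=> /cvgrPdist_lt h e e0; have := h e e0.
  rewrite /prop_near1 /= /within /dnbhs /= /within /= => /nbhs_ballP[d /= d0 H].
  by exists d => // u Tu ut tu; apply: H.
move=> h; apply/cvgrPdist_lt => e e0; have [d d0 H] := h e e0.
rewrite /prop_near1 /= /within /dnbhs /= /within /=.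
by apply/nbhs_ballP; exists d => //= u tu ut Tu; exact: H.
Qed.

Lemma is_deriveP {V : normedModType R} (f : R -> V) t v :
  is_derive t (1:R) f v <->
  forall e, 0 < e -> exists2 d, 0 < d & forall u, u != t ->
    `|t - u| < d -> `|v - diffquot f t u| < e.
Proof.
have E (h : R) : h^-1 *: (f (h *: 1 + t) - f t) = diffquot f t (t + h).
  by rewrite /diffquot [t + h]addrC addrK scaler1.
split.
  move=> [dv]; rewrite /derive => dE e e0.
  have := dv; rewrite /derivable => /cvgP/cvgrPdist_lt; rewrite dE => /(_ e e0).
  rewrite /prop_near1 /= /dnbhs /= /within /= => /nbhs_ballP[d /= d0 H].
  exists d => // u ut tu; have := H (u - t); rewrite E subrKC; apply.
    by rewrite /ball /= sub0r opprB.
  by rewrite subr_eq0.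
move=> h.
have C : h0^-1 *: (f (h0 *: 1 + t) - f t) @[h0 --> 0^'] --> v.
  apply/cvgrPdist_lt => e e0; have [d d0 H] := h e e0.
  rewrite /prop_near1 /= /dnbhs /= /within /=.
  apply/nbhs_ballP; exists d => //= u; rewrite /ball /= sub0r normrN => tu u0.
  rewrite E; apply: H; first by rewrite -subr_eq0 addrAC subrr add0r.
  by rewrite opprD addNKr normrN.
split; first by apply/cvg_ex; exists v.
by apply: (@cvg_lim V (@norm_hausdorff _ _)).
Qed.

Lemma has_deriv_is_derive {V : normedModType R} T (f : R -> V) t v :
  T < t -> has_deriv T f t v -> is_derive t (1:R) f v.
Proof.
move=> Tt /has_derivP h; apply/is_deriveP => e e0; have [d d0 H] := h e e0.
exists (Num.min d (t - T)); first by rewrite lt_min d0 subr_gt0.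
move=> u ut; rewrite lt_min => /andP[tu tT]; apply: H => //.
by move: tT; rewrite ltr_norml => /andP[]; lra.
Qed.

Lemma is_derive_has_deriv {V : normedModType R} T (f : R -> V) t v :
  is_derive t (1:R) f v -> has_deriv T f t v.
Proof.
move=> /is_deriveP h; apply/has_derivP => e e0; have [d d0 H] := h e e0.
by exists d => // u _; exact: H.
Qed.

Lemma diffquot_coord p q (f : R -> 'M[R]_(p, q)) t u i j :
  diffquot f t u i j = diffquot (fun u => f u i j) t u.
Proof. by rewrite /diffquot !mxE. Qed.


Lemma mx_norm_leP p q (M : 'M[R]_(p, q)) e : 0 <= e ->
  (`|M| <= e) <-> forall i j, `|M i j| <= e.
Proof.
move=> e0; rewrite [X in X <= _]/Num.norm /= mx_normrE; split.
  by move=> /bigmax_leP[_ H] i j; have := H (i, j) isT.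
by move=> H; apply/bigmax_leP; split => // -[i j] _; exact: H.
Qed.

Lemma mx_norm_coord p q (M : 'M[R]_(p, q)) i j : `|M i j| <= `|M|.
Proof. by apply: (iffLR (mx_norm_leP M (normr_ge0 M))). Qed.

Lemma has_deriv_coord p q T (f : R -> 'M[R]_(p, q)) t v :
  has_deriv T f t v <->
  forall i j, has_deriv T (fun u => f u i j) t (v i j).
Proof.
split.
  move=> /has_derivP h i j; apply/has_derivP => e e0; have [d d0 H] := h e e0.
  exists d => // u Tu ut tu; apply: le_lt_trans (H u Tu ut tu).
  rewrite -diffquot_coord.
  by have := mx_norm_coord (v - diffquot f t u) i j; rewrite !mxE.
move=> h; apply/has_derivP => e e0.
(* [mx_norm_leP] gives only a non-strict inequality, so each entry is kept below e / 2. *)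
have e20 : 0 < e / 2 by rewrite divr_gt0.
have /choice[d dP] (ij : 'I_p * 'I_q) : exists d, 0 < d /\ forall u, T <= u -> u != t ->
    `|t - u| < d -> `|v ij.1 ij.2 - diffquot (fun u => f u ij.1 ij.2) t u| < e / 2.
  by have [d d0 H] := (iffLR (has_derivP _ _ _ _) (h ij.1 ij.2)) _ e20; exists d.
exists (\big[Order.min/1]_ij d ij).
  by apply/bigmin_gtP; split => // ij _; have [] := dP ij.
move=> u Tu ut /bigmin_gtP[_ tu].
apply: (@le_lt_trans _ _ (e / 2)); last by lra.
apply/mx_norm_leP => [|i j]; first exact: ltW.
have [_ H] := dP (i, j).
by have := H u Tu ut (tu (i, j) isT); rewrite -diffquot_coord => /ltW; rewrite !mxE.
Qed.

Lemma within_cont_eps {V W : normedModType R} (A : set V) (f : V -> W) :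
  {within A, continuous f} <->
  forall x, A x -> forall e : R, 0 < e -> exists2 d : R, 0 < d &
    forall u, A u -> `|x - u| < d -> `|f x - f u| < e.
Proof.
split.
  move=> /subspace_continuousP h x Ax e e0.
  have /cvgrPdist_lt/(_ e e0) := h x Ax.
  rewrite /prop_near1 /within /= => /nbhs_ballP[d /= d0 H].
  by exists d => // u Au xu; apply: H => //; rewrite -ball_normE.
move=> h; apply/subspace_continuousP => x Ax; apply/cvgrPdist_lt => e e0.
have [d d0 H] := h x Ax e e0.
rewrite /prop_near1 /within /=; apply/nbhs_ballP; exists d => //= u.
by rewrite -ball_normE /= => xu Au; exact: H.
Qed.

Lemma continuous_on_sub {V : normedModType R} T T' (f : R -> V) :
  T <= T' -> continuous_on T f -> continuous_on T' f.
Proof.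
move=> TT'; apply: continuous_subspaceW => x; rewrite /halfline /=.
exact: le_trans.
Qed.

(** Freezing f to the left of T at its value at T extends it to the whole line; this is what makes
    two-sided derivatives at the end point T possible in [antiderivative_exists]. *)
Lemma continuous_on_clamp {V : normedModType R} T (f : R -> V) :
  continuous_on T f -> continuous (fun t => f (Num.max T t)).
Proof.
move=> /within_cont_eps h t; apply/cvgrPdist_lt => e e0.
have Tm : halfline T (Num.max T t) by rewrite /halfline /= le_max lexx.
have [d d0 H] := h _ Tm e e0.
apply/nbhs_ballP; exists d => //= u; rewrite /ball /= => tu.
apply: H; first by rewrite /halfline /= le_max lexx.
apply: le_lt_trans tu; rewrite /Num.max.
case: (ltP T t) => Tt; case: (ltP T u) => Tu //.
- by rewrite ger0_norm ?subr_ge0 ?(le_trans _ (ltW Tt)) // ler_normr; apply/orP; left; lra.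
- rewrite ler0_norm; last by lra.
  by rewrite ler_normr; apply/orP; right; lra.
- by rewrite subrr normr0.
Qed.

Lemma continuous_continuous_on {V : normedModType R} T (f : R -> V) :
  continuous f -> continuous_on T f.
Proof. by move=> cf; apply: continuous_subspaceT. Qed.

Lemma continuous_on_continuous_at {V : normedModType R} T (f : R -> V) t :
  continuous_on T f -> T < t -> {for t, continuous f}.
Proof.
move=> /within_cont_eps h Tt; apply/cvgrPdist_lt => e e0.
have [d d0 H] := h t (ltW Tt) e e0.
apply/nbhs_ballP; exists (Num.min d (t - T)); rewrite /= ?lt_min ?d0 ?subr_gt0 //.
move=> u; rewrite /ball /= lt_min => /andP[tu tT]; apply: H => //.
by rewrite /halfline /=; move: tT; rewrite ltr_norml => /andP[]; lra.
Qed.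

Lemma is_derive_continuous {V : normedModType R} (f : R -> V) t v :
  is_derive t (1:R) f v -> {for t, continuous f}.
Proof.
by move=> [/derivable1_diffP /differentiable_continuous].
Qed.

Lemma has_deriv_continuous_on {V : normedModType R} T (f : R -> V) (v : R -> V) :
  (forall t, T <= t -> has_deriv T f t (v t)) -> continuous_on T f.
Proof.
move=> h; apply/within_cont_eps => t Tt e e0.
have [d d0 H] := iffLR (has_derivP _ _ _ _) (h t Tt) 1 ltr01.
have C0 : 0 < `|v t| + 1 by rewrite ltr_wpDl.
exists (Num.min d (e / (`|v t| + 1))); first by rewrite lt_min d0 divr_gt0.
move=> u Tu; rewrite lt_min => /andP[tu tue].
have [->|ut] := eqVneq u t; first by rewrite subrr normr0.
have := H u Tu ut tu => /ltW H1.
have ut0 : u - t != 0 by rewrite subr_eq0.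
have -> : f t - f u = (t - u) *: diffquot f t u.
  by rewrite /diffquot scalerA -[t - u]opprB mulNr mulfV // scaleN1r opprB.
rewrite normrZ; apply: le_lt_trans (_ : `|t - u| * (`|v t| + 1) < e).
  apply: ler_wpM2l => //.
  have -> : diffquot f t u = v t - (v t - diffquot f t u) by rewrite opprB addrC subrK.
  by apply: le_trans (ler_normB _ _) _; rewrite lerD2l.
by rewrite -ltr_pdivlMr.
Qed.

Lemma dD (f g : R -> R) t a b : is_derive t (1:R) f a ->
  is_derive t (1:R) g b -> is_derive t (1:R) (fun x => f x + g x) (a + b).
Proof. by move=> df dg; exact: is_deriveD. Qed.

Lemma dN (f : R -> R) t a : is_derive t (1:R) f a ->
  is_derive t (1:R) (fun x => - f x) (- a).
Proof. by move=> df; exact: is_deriveN. Qed.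

Lemma dB (f g : R -> R) t a b : is_derive t (1:R) f a ->
  is_derive t (1:R) g b -> is_derive t (1:R) (fun x => f x - g x) (a - b).
Proof. by move=> df dg; exact: is_deriveB. Qed.

Lemma dM (f g : R -> R) t a b : is_derive t (1:R) f a ->
  is_derive t (1:R) g b ->
  is_derive t (1:R) (fun x => f x * g x) (a * g t + f t * b).
Proof.
move=> df dg; have := is_deriveM df dg; rewrite /GRing.scale /=.
by rewrite addrC [g t * a]mulrC.
Qed.

Lemma dZ (f : R -> R) (k : R) t a : is_derive t (1:R) f a ->
  is_derive t (1:R) (fun x => k * f x) (k * a).
Proof. by move=> df; have := @is_deriveZ R R R f k t 1 a df. Qed.

Lemma dX (f : R -> R) k t a : is_derive t (1:R) f a ->
  is_derive t (1:R) (fun x => f x ^+ k) (k%:R * f t ^+ k.-1 * a).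
Proof. by move=> df; have := is_deriveX k df; rewrite exprfctE. Qed.

Lemma dexp (f : R -> R) t a : is_derive t (1:R) f a ->
  is_derive t (1:R) (fun x => expR (f x)) (expR (f t) * a).
Proof. by move=> df; apply: (@is_derive1_comp R expR f). Qed.

Lemma dsum (I : Type) (r : seq I) (P : pred I) (f : I -> R -> R) t (a : I -> R) :
  (forall i, P i -> is_derive t (1:R) (f i) (a i)) ->
  is_derive t (1:R) (fun x => \sum_(i <- r | P i) f i x) (\sum_(i <- r | P i) a i).
Proof.
move=> h; elim: r => [|i r IH].
  rewrite big_nil; have -> : (fun x => \sum_(i <- [::] | P i) f i x) = cst 0.
    by apply/funext => x; rewrite big_nil.
  exact: is_derive_cst.
rewrite big_cons.
have -> : (fun x => \sum_(j <- i :: r | P j) f j x) =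
   (fun x => (if P i then f i x else 0) + \sum_(j <- r | P j) f j x).
  by apply/funext => x; rewrite big_cons; case: ifP; rewrite ?add0r.
case: ifP => Pi; first by apply: dD => //; exact: h.
rewrite -[X in is_derive _ _ _ X]add0r; apply: dD => //; exact: is_derive_cst.
Qed.

(** With g an antiderivative of a bound for the derivative of f, this takes the place of an estimate
    of an integral. *)
Lemma MVT_le (f g : R -> R) (df dg : R -> R) (a b : R) : a <= b ->
  (forall x, a < x < b -> is_derive x (1:R) f (df x)) ->
  (forall x, a < x < b -> is_derive x (1:R) g (dg x)) ->
  {within `[a, b], continuous f} -> {within `[a, b], continuous g} ->
  (forall x, a < x < b -> `|df x| <= dg x) ->
  `|f b - f a| <= g b - g a.
Proof.
move=> ab hf hg cf cg hfg.
move: ab; rewrite le_eqVlt => /predU1P[->|ab]; first by rewrite !subrr normr0.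
(* Both g - f and g + f have nonnegative derivative; the two signs s together bound the absolute
   value. *)
have key (s : R) : (s = 1 \/ s = -1) -> s * (f b - f a) <= g b - g a.
  move=> hs.
  have dh x : x \in `]a, b[%R -> is_derive x (1:R) (fun x => g x - s * f x) (dg x - s * df x).
    rewrite in_itv /= => xab.
    by apply: dB; [exact: hg|apply: dZ; exact: hf].
  have [|c cab E] := MVT ab dh.
    by move=> x; apply: cvgB; [exact: cg|apply: cvgMr; exact: cf].
  move: cab; rewrite in_itv /= => cab.
  rewrite -subr_ge0.
  have -> : g b - g a - s * (f b - f a) = g b - s * f b - (g a - s * f a) by ring.
  rewrite E mulr_ge0 ?subr_ge0 ?(ltW ab) //.
  have := hfg c cab; rewrite ler_norml => /andP[h1 h2].
  by case: hs => ->; lra.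
rewrite ler_norml; apply/andP; split.
  by have := key (-1) (or_intror erefl); lra.
by have := key 1 (or_introl erefl); lra.
Qed.

Lemma MVT_bound (f : R -> R) (df : R -> R) (a b C : R) : a <= b ->
  (forall x, a < x < b -> is_derive x (1:R) f (df x)) ->
  {within `[a, b], continuous f} ->
  (forall x, a < x < b -> `|df x| <= C) ->
  `|f b - f a| <= C * (b - a).
Proof.
move=> ab hf cf hC.
rewrite mulrBr.
apply: (@MVT_le f ( *%R C) df (fun=> C)) => //.
- by move=> x _; rewrite -[X in is_derive _ _ _ X]mulr1; apply: dZ; apply: is_derive_id.
- by apply: continuous_subspaceT => x; apply: mulrl_continuous.
Qed.

Lemma integral_to_derive T (g : R -> R) t : continuous_on T g -> T < t ->
  is_derive t (1:R) (integral_to T g) (g t).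
Proof.
move=> cg Tt.
have ig : (@lebesgue_measure R).-integrable `[T, t + 1] (EFin \o g).
  apply: continuous_compact_integrable; first exact: segment_compact.
  by apply: continuous_subspaceW cg => x /=; rewrite in_itv /= => /andP[].
have [|||d1 d2] := @continuous_FTC1_closed _ g T t (t + 1) _ ig => //.
- by rewrite ltrDl.
- exact: continuous_on_continuous_at cg Tt.
split; first exact: d1.
by rewrite -derive1E; exact: d2.
Qed.

Lemma antiderivative_exists T (g : R -> R) : continuous_on T g ->
  exists W : R -> R, forall t, T <= t -> is_derive t (1:R) W (g t).
Proof.
(* Integrating from T - 1 makes T an interior point, so W has a two-sided derivative there. *)
move=> cg; exists (integral_to (T - 1) (fun t => g (Num.max T t))) => t Tt.
rewrite -[X in g X](max_idPr Tt).
apply: (@integral_to_derive _ (fun t => g (Num.max T t))); last by lra.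
by apply: continuous_continuous_on; apply: continuous_on_clamp.
Qed.

Lemma continuous_on_coord p q T (f : R -> 'M[R]_(p, q)) i j :
  continuous_on T f -> continuous_on T (fun t => f t i j).
Proof.
move=> /within_cont_eps h; apply/within_cont_eps => t Tt e e0.
have [d d0 H] := h t Tt e e0; exists d => // u Tu tu.
apply: le_lt_trans (H u Tu tu).
by have := mx_norm_coord (f t - f u) i j; rewrite !mxE.
Qed.

Lemma continuous_on_mx p q T (f : R -> 'M[R]_(p, q)) :
  (forall i j, continuous_on T (fun t => f t i j)) -> continuous_on T f.
Proof.
move=> h; apply/within_cont_eps => t Tt e e0.
have e20 : 0 < e / 2 by rewrite divr_gt0.
have /choice[d dP] (ij : 'I_p * 'I_q) : exists d, 0 < d /\ forall u, T <= u ->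
    `|t - u| < d -> `|f t ij.1 ij.2 - f u ij.1 ij.2| < e / 2.
  by have [d d0 H] := (iffLR (within_cont_eps _ _) (h ij.1 ij.2)) t Tt _ e20; exists d.
exists (\big[Order.min/1]_ij d ij).
  by apply/bigmin_gtP; split => // ij _; have [] := dP ij.
move=> u Tu /bigmin_gtP[_ tu].
apply: (@le_lt_trans _ _ (e / 2)); last by lra.
apply/mx_norm_leP => [|i j]; first exact: ltW.
have [_ H] := dP (i, j).
by have := H u Tu (tu (i, j) isT) => /ltW; rewrite !mxE.
Qed.

Lemma continuous_onD T (f g : R -> R) : continuous_on T f -> continuous_on T g ->
  continuous_on T (fun t => f t + g t).
Proof. by move=> cf cg x; apply: cvgD; [exact: cf|exact: cg]. Qed.

Lemma continuous_onN T (f : R -> R) : continuous_on T f ->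
  continuous_on T (fun t => - f t).
Proof. by move=> cf x; apply: cvgN; exact: cf. Qed.

Lemma continuous_onM T (f g : R -> R) : continuous_on T f -> continuous_on T g ->
  continuous_on T (fun t => f t * g t).
Proof. by move=> cf cg x; apply: cvgM; [exact: cf|exact: cg]. Qed.

Lemma continuous_onV T (f : R -> R) : (forall t, T <= t -> f t != 0) ->
  continuous_on T f -> continuous_on T (fun t => (f t)^-1).
Proof.
move=> f0 /subspace_continuousP cf; apply/subspace_continuousP => x Tx.
by apply: cvgV; [exact: f0|exact: cf].
Qed.

Lemma continuous_on_cst T (c : R) : continuous_on T (fun=> c).
Proof. by move=> x; exact: cvg_cst. Qed.

Lemma continuous_on_sum (I : Type) (r : seq I) (P : pred I) T (f : I -> R -> R) :
  (forall i, P i -> continuous_on T (f i)) ->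
  continuous_on T (fun t => \sum_(i <- r | P i) f i t).
Proof.
move=> h; elim: r => [|i r IH].
  have -> : (fun t => \sum_(i <- [::] | P i) f i t) = fun=> 0.
    by apply/funext => t; rewrite big_nil.
  exact: continuous_on_cst.
have -> : (fun t => \sum_(j <- i :: r | P j) f j t) =
   (fun t => (if P i then f i t else 0) + \sum_(j <- r | P j) f j t).
  by apply/funext => t; rewrite big_cons; case: ifP; rewrite ?add0r.
apply: continuous_onD => //; case: (boolP (P i)) => Pi; first exact: h.
exact: continuous_on_cst.
Qed.

Lemma is_derive_continuous_on T (f df : R -> R) :
  (forall t, T <= t -> is_derive t (1:R) f (df t)) -> continuous_on T f.
Proof.
move=> h; apply: (@has_deriv_continuous_on _ _ _ df) => t Tt.
exact/is_derive_has_deriv/h.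
Qed.

Lemma derive_ge0_le T (g dg : R -> R) : continuous_on T g ->
  (forall x, T < x -> is_derive x (1:R) g (dg x)) -> (forall x, T < x -> 0 <= dg x) ->
  forall s t, T <= s -> s <= t -> g s <= g t.
Proof.
(* This is [MVT_le] with the zero function in the place of f. *)
move=> cg hg h0 s t Ts st; rewrite -subr_ge0; apply: le_trans (normr_ge0 (0 - 0)) _.
apply: (@MVT_le (cst 0) g (cst 0) dg) => //.
- by move=> x /andP[sx _]; apply: hg; exact: le_lt_trans sx.
- by apply: continuous_subspaceT => x; exact: cvg_cst.
- apply: continuous_subspaceW cg => x /=; rewrite in_itv /= => /andP[sx _].
  exact: le_trans sx.
- by move=> x /andP[sx _]; rewrite /= normr0 h0 //; exact: le_lt_trans sx.
Qed.

Lemma evP (P : R -> Prop) :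
  (\forall t \near +oo, P t) <-> exists T, forall t, T <= t -> P t.
Proof.
split.
  move=> [M [_ H]]; exists (M + 1) => t Mt; apply: H.
  by apply: lt_le_trans Mt; rewrite ltrDl.
by move=> [T H]; exists T; split; [exact: num_real|move=> t /ltW; exact: H].
Qed.

Lemma ev_pick T (P : R -> Prop) : (\forall t \near +oo, P t) -> exists2 t, T <= t & P t.
Proof.
move=> /evP[T' H]; exists (Num.max T T'); first by rewrite le_max lexx.
by apply: H; rewrite le_max lexx orbT.
Qed.

Lemma cvg_evP {V : normedModType R} (f : R -> V) l : f t @[t --> +oo] --> l <->
  forall e, 0 < e -> exists T, forall t, T <= t -> `|l - f t| < e.
Proof.
split=> [/cvgrPdist_lt H e e0|H]; first exact: (iffLR (evP _)) (H e e0).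
by apply/cvgrPdist_lt => e e0; apply/(iffRL (evP _)); exact: H.
Qed.

Lemma cvg_ev_le (f : R -> R) l c T : f t @[t --> +oo] --> l ->
  (forall t, T <= t -> f t <= c) -> l <= c.
Proof.
move=> /cvg_evP H hc; rewrite leNgt; apply/negP => cl.
have [T' H'] := H (l - c) (ltac:(by rewrite subr_gt0)).
have := H' (Num.max T T') (ltac:(by rewrite le_max lexx orbT)).
have := hc (Num.max T T') (ltac:(by rewrite le_max lexx)).
by move=> h1; rewrite ltr_norml => /andP[]; lra.
Qed.

End calculus.

(** * A perturbed diagonal system *)

Section perturbation.
Context {R : realType} {n : nat}.
Notation vec := ('cV[R]_n).
Variables (T0 M Vinf : R) (S : pred 'I_n) (E p : 'I_n -> R -> R) (b V : R -> R).
Variable F : R -> vec -> vec.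
Hypothesis M0 : 0 < M.
Hypothesis E_gt0 : forall j t, T0 <= t -> 0 < E j t.
Hypothesis dE : forall j t, T0 <= t -> is_derive t (1:R) (E j) (p j t * E j t).
Hypothesis E_dec : forall j, S j -> forall s t, T0 <= s -> s <= t -> E j t <= M * E j s.
Hypothesis E_inc : forall j, ~~ S j -> forall s t, T0 <= s -> s <= t -> E j s <= M * E j t.
Hypothesis E_to0 : forall j, S j -> E j t @[t --> +oo] --> (0 : R).
Hypothesis b_ge0 : forall t, T0 <= t -> 0 <= b t.
Hypothesis dV : forall t, T0 <= t -> is_derive t (1:R) V (b t).
Hypothesis V_cvg : V t @[t --> +oo] --> Vinf.
Hypothesis V_le : forall t, T0 <= t -> V t <= Vinf.
Hypothesis F0 : forall t, T0 <= t -> `|F t 0| <= b t.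
Hypothesis FL : forall t (z z' : vec), T0 <= t -> `|z| <= 1 -> `|z'| <= 1 ->
  `|F t z - F t z'| <= b t * `|z - z'|.
Hypothesis Fc : forall T (z : R -> vec), T0 <= T -> continuous_on T z ->
  (forall t, T <= t -> `|z t| <= 1) -> continuous_on T (fun t => F t (z t)).

Lemma is_derive_within (f df : R -> R) (a c : R) :
  (forall t, a <= t -> is_derive t (1:R) f (df t)) ->
  {within `[a, c], continuous f}.
Proof.
move=> h; apply: derivable_within_continuous => x.
by rewrite in_itv /= => /andP[ax _]; have [] := h x ax.
Qed.

Lemma V_mono (s t : R) : T0 <= s -> s <= t -> V s <= V t.
Proof.
apply: (@derive_ge0_le R T0 V b) => [|x /ltW|x /ltW]; [|exact: dV|exact: b_ge0].
exact: is_derive_continuous_on dV.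
Qed.

Section kernel.
Variables (T c : R) (j : 'I_n) (U u : R -> R).
Hypothesis T0T : T0 <= T.
Hypothesis dU : forall t, T <= t -> is_derive t (1:R) U (u t).
Hypothesis ub : forall t, T <= t -> `|u t| <= c * (b t / E j t).
Hypothesis c0 : 0 <= c.

(** On [s, t] the number x is at most M E_j, so x |u| is at most M c b, the derivative of M c V, and
    the mean value inequality applies. The two kinds of kernel differ only in the choice of x: the
    value of E_j at the right end of the interval, or at a point not after its left end. *)
Lemma kernel_gen (x s t : R) : T <= s -> s <= t -> 0 <= x ->
  (forall r, s <= r -> r <= t -> x <= M * E j r) ->
  x * `|U t - U s| <= M * c * (V t - V s).
Proof.
move=> Ts st x0 hx.
have -> : x * `|U t - U s| = `|x * U t - x * U s|.
  by rewrite -mulrBr normrM (ger0_norm x0).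
rewrite [leRHS]mulrBr.
apply: (@MVT_le R (fun r => x * U r) (fun r => M * c * V r)
  (fun r => x * u r) (fun r => M * c * b r)) => //.
- by move=> r /andP[sr _]; apply: dZ; apply: dU; rewrite (le_trans Ts (ltW sr)).
- move=> r /andP[sr _]; apply: dZ; apply: dV.
  by rewrite (le_trans T0T) // (le_trans Ts (ltW sr)).
- apply: (@is_derive_within _ (fun r => x * u r)) => r sr; apply: dZ; apply: dU.
  exact: le_trans sr.
- apply: (@is_derive_within _ (fun r => M * c * b r)) => r sr; apply: dZ; apply: dV.
  by rewrite (le_trans T0T) // (le_trans Ts).
- move=> r /andP[sr rt]; rewrite normrM (ger0_norm x0).
  have Tr : T <= r by rewrite (le_trans Ts (ltW sr)).
  have T0r : T0 <= r by rewrite (le_trans T0T).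
  apply: le_trans (ler_wpM2l x0 (ub Tr)) _.
  have Er := E_gt0 j T0r.
  have -> : x * (c * (b r / E j r)) = (x / E j r) * (c * b r) by field; rewrite gt_eqF.
  rewrite -(mulrA M); apply: ler_wpM2r; first by rewrite mulr_ge0 // b_ge0.
  by rewrite ler_pdivrMr // hx // ltW.
Qed.

Lemma kernel_dec (s t : R) : S j -> T <= s -> s <= t ->
  E j t * `|U t - U s| <= M * c * (V t - V s).
Proof.
move=> Sj Ts st; apply: kernel_gen => //.
  by apply/ltW/E_gt0; rewrite (le_trans T0T) // (le_trans Ts).
by move=> r sr rt; apply: E_dec => //; rewrite (le_trans T0T) // (le_trans Ts).
Qed.

Lemma kernel_inc (x s t : R) : ~~ S j -> T <= x -> x <= s -> s <= t ->
  E j x * `|U t - U s| <= M * c * (V t - V s).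
Proof.
move=> Sj Tx xs st; apply: kernel_gen => //; first exact: le_trans xs.
  by apply/ltW/E_gt0; rewrite (le_trans T0T).
move=> r sr rt; apply: E_inc => //; first by rewrite (le_trans T0T).
exact: le_trans sr.
Qed.

Lemma V_tail (e : R) : 0 < e -> exists2 s, T <= s & Vinf - V s < e.
Proof.
move=> e0; have /cvgrPdist_lt/(_ e e0)/(ev_pick T)[s Ts Hs] := V_cvg.
by exists s => //; apply: le_lt_trans Hs; exact: ler_norm.
Qed.

(** A kernel of the growing kind has 1 / E_j bounded on [T, +oo), so the increments of U are
    controlled by those of V, which converges. *)
Lemma kernel_cvg : ~~ S j -> cvg (U t @[t --> +oo]).
Proof.
move=> Sj; apply: cauchy_cvg; apply: cauchy_exP => e e0.
have ET : 0 < E j T by exact: E_gt0.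
(* The summand 1 keeps k positive when c = 0. *)
pose k := M * c / E j T + 1.
have k0 : 0 < k by rewrite ltr_wpDl // divr_ge0 ?mulr_ge0 // ltW.
have [s Ts Hs] := V_tail (divr_gt0 e0 k0).
exists (U s); apply/(iffRL (evP (fun t => ball (U s) e (U t)))); exists s => t st.
rewrite /ball /= distrC.
have := kernel_inc Sj (lexx T) Ts st.
rewrite mulrC -ler_pdivlMr // => H; apply: le_lt_trans H _.
have T0s : T0 <= s by rewrite (le_trans T0T).
have h1 : 0 <= V t - V s by rewrite subr_ge0 V_mono.
have h2 : V t - V s <= Vinf - V s by rewrite lerD2r V_le // (le_trans T0s).
move: Hs; rewrite ltr_pdivlMr // => Hs.
apply: le_lt_trans Hs.
rewrite mulrAC [leRHS]mulrC; apply: ler_pM => //.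
  by rewrite divr_ge0 ?mulr_ge0 // ltW.
by rewrite lerDl.
Qed.

Lemma kernel_inc_lim (t : R) : ~~ S j -> T <= t ->
  E j t * `|U t - lim (U t @[t --> +oo])| <= M * c * (Vinf - V t).
Proof.
move=> Sj Tt; have Uc := kernel_cvg Sj.
have H : E j t * `|U t - U s| @[s --> +oo] --> E j t * `|U t - lim (U t @[t --> +oo])|.
  by apply: cvgMr; apply: cvg_norm; apply: cvgB => //; exact: cvg_cst.
apply: (cvg_ev_le H (T := t)) => s ts.
rewrite distrC; apply: le_trans (kernel_inc Sj Tt (lexx t) ts) _.
rewrite ler_wpM2l ?mulr_ge0 ?(ltW M0) // lerD2r V_le //.
by rewrite (le_trans T0T) // (le_trans Tt).
Qed.

End kernel.

(* [prim T g] is an antiderivative of g, or the zero function if there is none. *)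
Definition prim (T : R) (g : R -> R) : R -> R :=
  xget (cst 0) [set W | forall t, T <= t -> is_derive t (1:R) W (g t)].

Lemma primP T g : continuous_on T g ->
  forall t, T <= t -> is_derive t (1:R) (prim T g) (g t).
Proof.
move=> cg; rewrite /prim; case: xgetP => [W _ //|/= H].
by have [W HW] := antiderivative_exists cg; have := H W.
Qed.

(** The integrand of the variation of constants formula with kernel E_j. *)
Definition dens (z : R -> vec) j t := F t (z t) j 0 / E j t.

Definition good T (z : R -> vec) :=
  continuous_on T z /\ forall t, T <= t -> `|z t| <= 1.

(* The variation of constants formula for one coordinate: the integral starts at T
   if the kernel E_j decays (and then a is the value at T), at +oo otherwise. *)
Definition entry T (j : 'I_n) (a : R) (U : R -> R) (t : R) :=
  E j t * (if S j then a / E j T + (U t - U T) else U t - lim (U t @[t --> +oo])).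

Definition Phi T (theta : vec) (z : R -> vec) (t : R) : vec :=
  \col_j entry T j (theta j 0) (prim T (dens z j)) t.

(** U is left arbitrary so that the bound serves twice: for the image of one function under [Phi] (c
    = 2), and for the difference of two images, where c is the distance of the arguments. *)
Lemma entry_bound T c j a (U u : R -> R) : T0 <= T ->
  (forall t, T <= t -> is_derive t (1:R) U (u t)) ->
  (forall t, T <= t -> `|u t| <= c * (b t / E j t)) -> 0 <= c ->
  forall t, T <= t -> `|entry T j a U t| <= M * `|a| + M * c * (Vinf - V T).
Proof.
move=> T0T dU ub c0 t Tt.
have Et : 0 < E j t by apply: E_gt0; exact: le_trans Tt.
have ET : 0 < E j T by exact: E_gt0.
have Mc : 0 <= M * c by rewrite mulr_ge0 // ltW.
rewrite /entry normrM (gtr0_norm Et); case: ifPn => Sj.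
  apply: le_trans (ler_wpM2l (ltW Et) (ler_normD _ _)) _.
  rewrite mulrDr; apply: lerD.
    rewrite normrM normfV (gtr0_norm ET) mulrCA mulrC.
    by apply: ler_wpM2r => //; rewrite ler_pdivrMr //; exact: E_dec.
  apply: le_trans (kernel_dec T0T dU ub c0 Sj (lexx T) Tt) _.
  by apply: ler_wpM2l => //; rewrite lerD2r V_le // (le_trans T0T).
apply: (@le_trans _ _ (M * c * (Vinf - V T))); last first.
  by rewrite lerDr mulr_ge0 // ltW.
apply: le_trans (kernel_inc_lim T0T dU ub c0 Sj Tt) _.
by apply: ler_wpM2l => //; rewrite lerD2l lerN2 V_mono.
Qed.

Lemma dens_cont T z j : T0 <= T -> good T z -> continuous_on T (dens z j).
Proof.
move=> T0T [cz z1]; rewrite /dens; apply: continuous_onM.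
  by apply: (@continuous_on_coord _ _ _ _ (fun t => F t (z t))); exact: Fc.
apply: continuous_onV => [t Tt|]; first by rewrite gt_eqF // E_gt0 // (le_trans T0T).
apply: (@is_derive_continuous_on _ _ _ (fun t => p j t * E j t)) => t Tt.
by apply: dE; exact: le_trans Tt.
Qed.

(** The 2 comes from splitting F t z into F t z - F t 0 and F t 0: each part is at most b t because
    |z t| <= 1. *)
Lemma dens_bound T z j : T0 <= T -> good T z ->
  forall t, T <= t -> `|dens z j t| <= 2 * (b t / E j t).
Proof.
move=> T0T [cz z1] t Tt; have T0t := le_trans T0T Tt.
have Et : 0 < E j t by exact: E_gt0.
rewrite /dens normrM normfV (gtr0_norm Et) mulrA ler_wpM2r ?invr_ge0 ?(ltW Et) //.
apply: le_trans (mx_norm_coord _ _ _) _.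
have -> : F t (z t) = F t (z t) - F t 0 + F t 0 by rewrite subrK.
apply: le_trans (ler_normD _ _) _.
have -> : 2 * b t = b t + b t by ring.
apply: lerD; last exact: F0.
apply: le_trans (FL T0t (z1 t Tt) _) _; first by rewrite normr0.
by rewrite subr0 -[leRHS]mulr1; apply: ler_wpM2l; [exact: b_ge0|exact: z1].
Qed.

Lemma dens_diff T z z' d j : T0 <= T -> good T z -> good T z' ->
  (forall t, T <= t -> `|z t - z' t| <= d) ->
  forall t, T <= t -> `|dens z j t - dens z' j t| <= d * (b t / E j t).
Proof.
move=> T0T [cz z1] [cz' z1'] zz t Tt; have T0t := le_trans T0T Tt.
have Et : 0 < E j t by exact: E_gt0.
rewrite /dens -mulrBl normrM normfV (gtr0_norm Et) mulrA.
rewrite ler_wpM2r ?invr_ge0 ?(ltW Et) //.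
have := mx_norm_coord (F t (z t) - F t (z' t)) j 0; rewrite !mxE => h.
apply: le_trans h _; apply: le_trans (FL T0t (z1 t Tt) (z1' t Tt)) _.
by rewrite mulrC; apply: ler_wpM2r; [exact: b_ge0|exact: zz].
Qed.

Lemma Phi_bound T theta z : T0 <= T -> good T z ->
  forall t, T <= t -> `|Phi T theta z t| <= M * `|theta| + 2 * M * (Vinf - V T).
Proof.
move=> T0T gz t Tt.
have VT : 0 <= Vinf - V T by rewrite subr_ge0 V_le.
apply/mx_norm_leP => [|j i]; first by rewrite addr_ge0 // ?mulr_ge0 // ltW.
rewrite !mxE [2 * M]mulrC.
have H := @entry_bound T _ j (theta j 0) _ _ T0T (primP (dens_cont (j:=j) T0T gz)) (dens_bound j T0T gz) (ler0n _ 2) t Tt.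
apply: le_trans H _ => //.
rewrite lerD2r; apply: ler_wpM2l; [exact: ltW|exact: mx_norm_coord].
Qed.

Lemma Phi_diff T theta theta' z z' d : T0 <= T -> good T z -> good T z' -> 0 <= d ->
  (forall t, T <= t -> `|z t - z' t| <= d) ->
  forall t, T <= t -> `|Phi T theta z t - Phi T theta' z' t| <=
     M * `|theta - theta'| + M * d * (Vinf - V T).
Proof.
move=> T0T gz gz' d0 zz t Tt.
have VT : 0 <= Vinf - V T by rewrite subr_ge0 V_le.
apply/mx_norm_leP => [|j i].
  by rewrite addr_ge0 // ?mulr_ge0 // ?mulr_ge0 // ltW.
pose U := prim T (dens z j); pose U' := prim T (dens z' j).
have dU := primP (dens_cont (j:=j) T0T gz); have dU' := primP (dens_cont (j:=j) T0T gz').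
have dUU t' (Tt' : T <= t') : is_derive t' (1:R) (fun t => U t - U' t) (dens z j t' - dens z' j t').
  by apply: dB; [exact: dU|exact: dU'].
(* [entry] is linear in the pair (a, U); for the growing kind this needs both limits at +oo to
   exist, which is [kernel_cvg]. *)
have -> : (Phi T theta z t - Phi T theta' z' t) j i =
   entry T j (theta j 0 - theta' j 0) (fun t => U t - U' t) t.
  rewrite !mxE /entry -mulrBr; congr (_ * _); case: ifPn => Sj.
    by rewrite -/U -/U' mulrBl; ring.
  rewrite -/U -/U'.
  have c1 := kernel_cvg T0T dU (dens_bound j T0T gz) (ler0n _ 2) Sj.
  have c2 := kernel_cvg T0T dU' (dens_bound j T0T gz') (ler0n _ 2) Sj.
  have -> : lim (U t - U' t @[t --> +oo]) = lim (U t @[t --> +oo]) - lim (U' t @[t --> +oo]).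
    by apply: limB.
  by ring.
apply: le_trans (@entry_bound T _ j (theta j 0 - theta' j 0) _ _ T0T dUU (dens_diff j T0T gz gz' zz) d0 t Tt) _.
rewrite lerD2r; apply: ler_wpM2l; first exact: ltW.
by have := mx_norm_coord (theta - theta') j 0; rewrite !mxE.
Qed.

Lemma Phi_derive T theta z j : T0 <= T -> good T z -> forall t, T <= t ->
  is_derive t (1:R) (fun u => Phi T theta z u j 0)
    (p j t * Phi T theta z t j 0 + F t (z t) j 0).
Proof.
move=> T0T gz t Tt; have T0t := le_trans T0T Tt.
have Et : 0 < E j t by exact: E_gt0.
pose U := prim T (dens z j).
have dU := primP (dens_cont (j:=j) T0T gz) Tt.
(* In both cases [entry] is E_j (U + C); the kind of the kernel only decides the constant of
   integration. *)
pose C := if S j then theta j 0 / E j T - U T else - lim (U t @[t --> +oo]).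
have EP u : Phi T theta z u j 0 = E j u * (U u + C).
  by rewrite mxE /entry /C -/U; congr (_ * _); case: ifP => _; ring.
have -> : (fun u => Phi T theta z u j 0) = (fun u => E j u * (U u + C)).
  by apply/funext.
rewrite EP.
have := dM (dE j T0t) (dD dU (is_derive_cst C t (1:R))).
by rewrite /= addr0 /dens mulrCA divff ?gt_eqF // mulr1 mulrA.
Qed.

(** The thresholds are tuned to [Phi_bound]: 1 / 2 + 2 / 4 = 1, so the unit ball is mapped into
    itself. The same 1 / 4 is the contraction factor in [Phi_diff]. *)
Lemma Phi_good T theta z : T0 <= T -> good T z -> M * `|theta| <= 1 / 2 ->
  M * (Vinf - V T) <= 1 / 4 -> good T (Phi T theta z).
Proof.
move=> T0T gz th VT; split.
  apply: continuous_on_mx => j i; rewrite ord1.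
  by apply: is_derive_continuous_on; exact: Phi_derive.
move=> t Tt; apply: le_trans (Phi_bound theta T0T gz Tt) _.
by rewrite -mulrA; lra.
Qed.

Lemma Phi_to0 T theta z : T0 <= T -> good T z ->
  Phi T theta z t @[t --> +oo] --> (0 : vec).
Proof.
move=> T0T gz; apply/cvg_evP => e e0.
have e20 : 0 < e / 2 by rewrite divr_gt0.
suff /choice[Tj TjP] (j : 'I_n) : exists T1, forall t, T1 <= t -> `|Phi T theta z t j 0| <= e / 2.
  exists (\big[Order.max/T]_j Tj j) => t /bigmax_leP[Tt H].
  rewrite sub0r normrN; apply: (@le_lt_trans _ _ (e / 2)); last by lra.
  apply/mx_norm_leP => [|j i]; first exact: ltW.
  by rewrite ord1; apply: TjP; exact: H.
pose U := prim T (dens z j).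
have dU := primP (dens_cont (j:=j) T0T gz).
have ub := dens_bound j T0T gz.
have M20 : 0 < M * 2 by rewrite mulr_gt0.
have tail (s : R) : Vinf - V s < e / 4 / (M * 2) -> M * 2 * (Vinf - V s) <= e / 4.
  by move=> /ltW; rewrite ler_pdivlMr // mulrC.
have [s Ts Hs] := V_tail T (divr_gt0 (divr_gt0 e0 (ltr0n _ 4)) M20).
have {}Hs := tail s Hs.
have T0s := le_trans T0T Ts.
case: (boolP (S j)) => Sj; last first.
  exists s => t st; rewrite mxE /entry (negbTE Sj).
  have Tt := le_trans Ts st.
  have Et : 0 < E j t by apply: E_gt0; exact: le_trans Tt.
  rewrite normrM (gtr0_norm Et).
  apply: le_trans (kernel_inc_lim T0T dU ub (ler0n _ 2) Sj Tt) _.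
  apply: le_trans (_ : M * 2 * (Vinf - V s) <= _).
    by apply: ler_wpM2l; [exact: ltW|rewrite lerD2l lerN2 V_mono].
  by apply: le_trans Hs _; lra.
(* What has accumulated up to time s is the fixed number C, which the decaying kernel sends to 0;
   what comes after s is small by the choice of s. *)
pose C := theta j 0 / E j T + (U s - U T).
have C0 : 0 < `|C| + 1 by rewrite ltr_wpDl.
have /cvg_evP/(_ _ (divr_gt0 (divr_gt0 e0 (ltr0n _ 4)) C0))[T1 H1] := E_to0 Sj.
exists (Num.max s T1) => t; rewrite ge_max => /andP[st T1t].
have Tt := le_trans Ts st.
have Et : 0 < E j t by apply: E_gt0; exact: le_trans Tt.
rewrite mxE /entry Sj -/U.
have -> : theta j 0 / E j T + (U t - U T) = C + (U t - U s) by rewrite /C; ring.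
rewrite normrM (gtr0_norm Et).
apply: le_trans (ler_wpM2l (ltW Et) (ler_normD _ _)) _.
rewrite mulrDr; have -> : e / 2 = e / 4 + e / 4 by field.
apply: lerD.
  have := H1 t T1t; rewrite sub0r normrN (gtr0_norm Et) ltr_pdivlMr // => /ltW h.
  by apply: le_trans h; apply: ler_wpM2l; [exact: ltW|rewrite lerDl].
apply: le_trans (kernel_dec T0T dU ub (ler0n _ 2) Sj Ts st) _.
apply: le_trans Hs; apply: ler_wpM2l; first exact: ltW.
by rewrite lerD2r V_le // (le_trans T0s).
Qed.


Section iteration.
Variable T : R.
Hypothesis T0T : T0 <= T.
Hypothesis VT : M * (Vinf - V T) <= 1 / 4.
Let admissible (theta : vec) := M * `|theta| <= 1 / 2.

Definition picard theta k : R -> vec := iter k (Phi T theta) (fun=> 0).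

Let q : R := 1 / 4.

Lemma picard_good theta k : admissible theta -> good T (picard theta k).
Proof.
move=> ad; elim: k => [|k IH]; last exact: Phi_good.
by split=> [x|t _]; [exact: cvg_cst|rewrite normr0].
Qed.

Lemma picard_step theta k : admissible theta ->
  forall t, T <= t -> `|picard theta k.+1 t - picard theta k t| <= q ^+ k.
Proof.
move=> ad; elim: k => [|k IH] t Tt.
  by rewrite /= subr0 expr0; have [_] := picard_good 1 ad; apply.
apply: le_trans (Phi_diff theta theta T0T (picard_good k.+1 ad) (picard_good k ad) _ IH Tt) _.
  by rewrite exprn_ge0 // /q; lra.
rewrite subrr normr0 mulr0 add0r exprS mulrAC.
by apply: ler_wpM2r => //; rewrite exprn_ge0 // /q; lra.
Qed.

(** The bound is a difference so that the induction on i closes by telescoping: q ^+ j <= 2 * q ^+ j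
    - 2 * q ^+ j.+1, since q = 1 / 4. *)
Lemma picard_dist theta k i : admissible theta ->
  forall t, T <= t -> `|picard theta (k + i)%N t - picard theta k t| <= 2 * q ^+ k - 2 * q ^+ (k + i).
Proof.
move=> ad t Tt; elim: i => [|i IH]; first by rewrite addn0 !subrr normr0.
rewrite addnS.
have -> : picard theta (k + i).+1 t - picard theta k t =
  (picard theta (k + i).+1 t - picard theta (k + i) t) + (picard theta (k + i)%N t - picard theta k t).
  by rewrite addrA subrK.
apply: le_trans (ler_normD _ _) _.
apply: le_trans (lerD (picard_step (k + i) ad Tt) IH) _.
have : 0 <= q ^+ (k + i) by rewrite exprn_ge0 // /q; lra.
by rewrite exprS /q; set x := _ ^+ (k + i) => x0; lra.
Qed.

Lemma q_to0 : q ^+ k @[k --> \oo] --> (0 : R).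
Proof. by apply: cvg_expr; rewrite ger0_norm /q; lra. Qed.

Lemma q_small (e : R) : 0 < e -> exists k, 2 * q ^+ k < e.
Proof.
move=> e0; have e20 : 0 < e / 2 by rewrite divr_gt0.
have /cvgrPdist_lt/(_ _ e20)[N _ H] := q_to0.
exists N; have := H N (leqnn N); rewrite /= sub0r normrN ger0_norm; first by lra.
by rewrite exprn_ge0 // /q; lra.
Qed.

Definition picard_lim theta (t : R) : vec :=
  \col_j lim (picard theta k t j 0 @[k --> \oo]).

Lemma picard_cvg theta t j : admissible theta -> T <= t ->
  picard theta k t j 0 @[k --> \oo] --> picard_lim theta t j 0.
Proof.
move=> ad Tt; rewrite mxE.
suff : cvg (picard theta k t j 0 @[k --> \oo]) by [].
apply: cauchy_cvg; apply: cauchy_exP => e e0.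
have [N HN] := q_small e0.
exists (picard theta N t j 0); exists N => // k /= Nk; rewrite /ball /= distrC.
apply: le_lt_trans HN.
have := mx_norm_coord (picard theta k t - picard theta N t) j 0; rewrite !mxE => h.
apply: le_trans h _; rewrite -(subnKC Nk).
apply: le_trans (picard_dist N _ ad Tt) _.
by rewrite gerBl mulr_ge0 // exprn_ge0 // /q; lra.
Qed.

Lemma picard_lim_dist theta k t : admissible theta -> T <= t ->
  `|picard_lim theta t - picard theta k t| <= 2 * q ^+ k.
Proof.
move=> ad Tt.
have q0 i : 0 <= 2 * q ^+ i by rewrite mulr_ge0 // exprn_ge0 // /q; lra.
apply/mx_norm_leP => // j i; rewrite ord1 !mxE.
have C := picard_cvg (j:=j) ad Tt; rewrite mxE in C.
have H : `|picard theta i t j 0 - picard theta k t j 0| @[i --> \oo] -->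
   `|lim (picard theta k t j 0 @[k --> \oo]) - picard theta k t j 0|.
  by apply: cvg_norm; apply: cvgB => //; exact: cvg_cst.
rewrite -(cvg_lim (@Rhausdorff R) H); apply: limr_le; first by apply/cvg_ex; eexists; exact: H.
exists k => // m /= km.
have := mx_norm_coord (picard theta m t - picard theta k t) j 0; rewrite !mxE => h.
apply: le_trans h _; rewrite -(subnKC km).
apply: le_trans (picard_dist k _ ad Tt) _.
by rewrite gerBl.
Qed.

Lemma le_q_small (x y : R) : (forall k, x <= y + 2 * q ^+ k) -> x <= y.
Proof.
move=> H; apply/ler_addgt0Pr => e e0; have [k Hk] := q_small e0.
by apply: le_trans (H k) _; rewrite lerD2l ltW.
Qed.

Lemma picard_lim_good theta : admissible theta -> good T (picard_lim theta).
Proof.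
move=> ad; split; last first.
  move=> t Tt; apply: le_q_small => k.
  have -> : picard_lim theta t = picard theta k t + (picard_lim theta t - picard theta k t).
    by rewrite addrC subrK.
  apply: le_trans (ler_normD _ _) _; apply: lerD; last exact: picard_lim_dist.
  by have [_] := picard_good k ad; apply.
apply/within_cont_eps => t Tt e e0.
have e30 : 0 < e / 3 by rewrite divr_gt0.
have [k Hk] := q_small e30.
have [/within_cont_eps/(_ t Tt _ e30)[d d0 H] _] := picard_good k ad.
exists d => // u Tu tu.
have -> : picard_lim theta t - picard_lim theta u =
  (picard_lim theta t - picard theta k t) + ((picard theta k t - picard theta k u)
   - (picard_lim theta u - picard theta k u)).
  apply/matrixP => a b'; rewrite !mxE; ring.
apply: le_lt_trans (ler_normD _ _) _.
apply: le_lt_trans (lerD (lexx _) (ler_normB _ _)) _.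
have h1 := picard_lim_dist k ad Tt; have h2 := picard_lim_dist k ad Tu.
by have h3 := H u Tu tu; lra.
Qed.

Lemma picard_lim_fix theta : admissible theta -> forall t, T <= t ->
  Phi T theta (picard_lim theta) t = picard_lim theta t.
Proof.
move=> ad t Tt; apply/eqP; rewrite -subr_eq0 -normr_le0.
apply: le_q_small => k; rewrite add0r.
have q0 i : 0 <= q ^+ i by rewrite exprn_ge0 // /q; lra.
have D u : T <= u -> `|picard_lim theta u - picard theta k u| <= 2 * q ^+ k.
  by move=> Tu; exact: picard_lim_dist.
have q20 : 0 <= 2 * q ^+ k by rewrite mulr_ge0.
have := Phi_diff theta theta T0T (picard_lim_good ad) (picard_good k ad) q20 D Tt.
rewrite subrr normr0 mulr0 add0r mulrAC => h1.
have {}h1 : `|Phi T theta (picard_lim theta) t - picard theta k.+1 t| <= 1 / 4 * (2 * q ^+ k).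
  by apply: le_trans h1 _; apply: ler_wpM2r.
have h2 := picard_lim_dist k.+1 ad Tt; rewrite exprS in h2.
have -> : Phi T theta (picard_lim theta) t - picard_lim theta t =
  (Phi T theta (picard_lim theta) t - picard theta k.+1 t) - (picard_lim theta t - picard theta k.+1 t).
  by apply/matrixP => a b'; rewrite !mxE; ring.
apply: le_trans (ler_normB _ _) _.
have := q0 k; move: h1 h2; rewrite {2}/q; set x := q ^+ k; lra.
Qed.

(** The constant 2 M reproduces itself along the iteration because M + 2 M / 4 <= 2 M. *)
Lemma picard_lip theta theta' k : admissible theta -> admissible theta' ->
  forall t, T <= t -> `|picard theta k t - picard theta' k t| <= 2 * M * `|theta - theta'|.
Proof.
move=> ad ad'.
have D0 : 0 <= 2 * M * `|theta - theta'| by rewrite mulr_ge0 // mulr_ge0 // ltW.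
elim: k => [|k IH] t Tt; first by rewrite /= subrr normr0.
apply: le_trans (Phi_diff theta theta' T0T (picard_good k ad) (picard_good k ad') D0 IH Tt) _.
rewrite mulrAC.
apply: le_trans (lerD (lexx _) (ler_wpM2r D0 VT)) _.
by rewrite -mulrA; set x := M * _; have : 0 <= x; [rewrite mulr_ge0 // ltW|lra].
Qed.

Lemma picard_lim_lip theta theta' : admissible theta -> admissible theta' ->
  forall t, T <= t -> `|picard_lim theta t - picard_lim theta' t| <= 2 * M * `|theta - theta'|.
Proof.
move=> ad ad' t Tt; apply: le_q_small => k.
have h1 := picard_lim_dist k.+1 ad Tt; have h2 := picard_lim_dist k.+1 ad' Tt.
have h3 := picard_lip k.+1 ad ad' Tt.
have -> : picard_lim theta t - picard_lim theta' t =
  ((picard_lim theta t - picard theta k.+1 t) + (picard theta k.+1 t - picard theta' k.+1 t))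
   - (picard_lim theta' t - picard theta' k.+1 t).
  by apply/matrixP => a b'; rewrite !mxE; ring.
apply: le_trans (ler_normB _ _) _.
apply: le_trans (lerD (ler_normD _ _) (lexx _)) _.
move: h1 h2; rewrite exprS {1 3}/q.
have : 0 <= q ^+ k by rewrite exprn_ge0 // /q; lra.
by set x := q ^+ k => *; lra.
Qed.

End iteration.

Lemma perturbation_family : exists T1, forall T, T1 <= T ->
  exists eta, 0 < eta /\ exists z : vec -> R -> vec,
    forall theta, `|theta| <= eta ->
    [/\ forall t, T <= t -> `|z theta t| <= 1,
        forall t j, T <= t -> is_derive t (1:R) (fun u => z theta u j 0)
          (p j t * z theta t j 0 + F t (z theta t) j 0),
        z theta t @[t --> +oo] --> (0 : vec),
        forall j, S j -> z theta T j 0 = theta j 0 &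
        forall theta', `|theta'| <= eta -> forall t, T <= t ->
          `|z theta t - z theta' t| <= 2 * M * `|theta - theta'|].
Proof.
have e0 : 0 < 1 / 4 / M by rewrite divr_gt0.
have /cvg_evP/(_ _ e0)[T1 HT1] := V_cvg.
exists (Num.max T0 T1) => T; rewrite ge_max => /andP[T0T T1T].
have VT : M * (Vinf - V T) <= 1 / 4.
  rewrite mulrC -ler_pdivlMr // ltW //; apply: le_lt_trans (HT1 T T1T).
  exact: ler_norm.
exists (1 / 2 / M); split; first by rewrite divr_gt0.
(* The fixed point is written as its own image: [picard_lim] equals it only on [T, +oo), whereas the
   image also has a two-sided derivative at T. *)
exists (fun theta => Phi T theta (picard_lim T theta)) => theta.
rewrite ler_pdivlMr // mulrC => ad.
have gz := picard_lim_good T0T VT ad.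
have fixz := picard_lim_fix T0T VT ad.
split.
- by move=> t Tt; rewrite fixz //; have [_] := gz; apply.
- by move=> t j Tt; rewrite [in F t _]fixz //; exact: Phi_derive.
- exact: Phi_to0.
- move=> j Sj; rewrite mxE /entry Sj subrr addr0 mulrCA divff ?mulr1 //.
  by rewrite gt_eqF // E_gt0.
- move=> theta'; rewrite ler_pdivlMr // mulrC => ad' t Tt.
  by rewrite fixz // (picard_lim_fix T0T VT ad') //; exact: picard_lim_lip.
Qed.

End perturbation.

(** * Taylor's formula in the tube *)

Section tube_calculus.
Context {R : realType} {n : nat}.
Notation vec := ('cV[R]_n).
Variables (t0 a : R) (phi0 : R -> vec).
Hypothesis a_gt0 : 0 < a.
Notation D := (tube t0 a phi0).
Implicit Types (t h u v k x C : R) (y : vec) (j : 'I_n).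

Local Notation e_ j := (delta_mx j 0 : vec).

Lemma tubeP t y : D (t, y) <-> t0 <= t /\ forall i, `|y i 0 - phi0 t i 0| <= a.
Proof.
rewrite /tube /=; split=> -[Tt H]; split => //.
  by move=> i; have := iffLR (mx_norm_leP _ (ltW a_gt0)) H i 0; rewrite !mxE.
by apply/mx_norm_leP => [|i j]; [exact: ltW|rewrite ord1 !mxE].
Qed.

Lemma shiftE y h j i : (y + h *: e_ j) i 0 = y i 0 + (if i == j then h else 0).
Proof. by rewrite !mxE eqxx andbT; case: eqP; rewrite ?mulr1 ?mulr0. Qed.

Lemma shift_itv t y j u v h : u <= h -> h <= v ->
  D (t, y + u *: e_ j) -> D (t, y + v *: e_ j) -> D (t, y + h *: e_ j).
Proof.
move=> uh hv /tubeP[Tt Hu] /tubeP[_ Hv]; apply/tubeP; split => // i.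
move: (Hu i) (Hv i); rewrite !shiftE; case: eqP => _ //.
by rewrite !ler_norml => /andP[h1 h2] /andP[h3 h4]; apply/andP; split; lra.
Qed.

(** Moving the j-th coordinate towards the axis of the tube by at most a does not leave the tube.
    Hence nonzero increments of arbitrarily small size are admissible even at a face, and the
    partial derivatives are unique. *)
Lemma pincr_filter t y j : D (t, y) -> ProperFilter (within (pincr D j (t, y)) 0^').
Proof.
move=> /tubeP[Tt H]; apply: Build_ProperFilter_ex => B.
rewrite /within /dnbhs /= /within /= => /nbhs_ballP[e /= e0 HB].
pose m := Num.min (e / 2) a.
have m0 : 0 < m by rewrite lt_min a_gt0 divr_gt0.
have me : m < e by rewrite /m gt_min; apply/orP; left; lra.
have ma : m <= a by rewrite /m ge_min lexx orbT.
have key h : `|h| = m -> D (t, y + h *: e_ j) -> exists x, B x.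
  move=> hm Dh; exists h; apply: HB => //=.
    by rewrite /ball /= sub0r normrN hm.
  by rewrite -normr_eq0 hm gt_eqF.
have [hj|hj] := leP (y j 0) (phi0 t j 0).
  apply: (key m); first by rewrite gtr0_norm.
  apply/tubeP; split => // i; rewrite shiftE; move: (H i); case: eqP => [->|_].
    by rewrite !ler_norml => /andP[h1 h2]; apply/andP; split; lra.
  by rewrite addr0.
apply: (key (- m)); first by rewrite normrN gtr0_norm.
apply/tubeP; split => // i; rewrite shiftE; move: (H i); case: eqP => [->|_].
  by rewrite !ler_norml => /andP[h1 h2]; apply/andP; split; lra.
by rewrite addr0.
Qed.

Lemma has_partial_partial j (F : R * vec -> vec) t y (v : vec) : D (t, y) ->
  has_partial D j F (t, y) v -> partial D j F (t, y) = v.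
Proof.
move=> Dy h; have PF := pincr_filter j Dy.
by apply: (@cvg_lim vec (@norm_hausdorff _ _)).
Qed.

Lemma has_partialP j (F : R * vec -> vec) t y (v : vec) : has_partial D j F (t, y) v ->
  forall e, 0 < e -> exists2 d, 0 < d & forall h, D (t, y + h *: e_ j) -> h != 0 ->
    `|h| < d -> `|v - pquot j F (t, y) h| < e.
Proof.
move=> /cvgrPdist_lt H e e0; have := H e e0.
rewrite /prop_near1 /within /dnbhs /= /within /= => /nbhs_ballP[d /= d0 Hd].
exists d => // h Dh h0 hd; apply: Hd => //=.
by rewrite /ball /= sub0r normrN.
Qed.

Section one_function.
Variables (F : R * vec -> vec) (q : nat).
Hypothesis FC : C0q D q F.
Notation P js := (partials D js F).

Lemma path_derive js t y j i u v h : (size js < q)%N -> u < h -> h < v ->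
  D (t, y + u *: e_ j) -> D (t, y + v *: e_ j) ->
  is_derive h (1:R) (fun x => P js (t, y + x *: e_ j) i 0)
    (P (j :: js) (t, y + h *: e_ j) i 0).
Proof.
move=> sq uh hv Du Dv.
have Dh : D (t, y + h *: e_ j) by exact: shift_itv (ltW uh) (ltW hv) Du Dv.
have [w hw] := FC.1 js sq j _ Dh.
rewrite /= (has_partial_partial Dh hw).
apply/is_deriveP => e e0; have [d d0 H] := has_partialP hw e0.
exists (Num.min d (Num.min (h - u) (v - h))); first by rewrite !lt_min d0 !subr_gt0 uh hv.
move=> x xh; rewrite !lt_min => /andP[xd /andP[xu xv]].
have E : y + h *: e_ j + (x - h) *: e_ j = y + x *: e_ j.
  by rewrite -addrA -scalerDl addrC subrKC addrC.
have Dx : D (t, y + x *: e_ j).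
  apply: shift_itv Du Dv.
    by move: xu; rewrite ltr_norml => /andP[]; lra.
  by move: xv; rewrite ltr_norml => /andP[]; lra.
have := H (x - h); rewrite E subr_eq0 => /(_ Dx xh); rewrite distrC => /(_ xd) h1.
apply: le_lt_trans h1; rewrite /diffquot.
by have := mx_norm_coord (w - pquot j (P js) (t, y + h *: e_ j) (x - h)) i 0; rewrite /pquot !mxE /= E.
Qed.

Lemma path_cont js t y j i u v : (size js <= q)%N ->
  D (t, y + u *: e_ j) -> D (t, y + v *: e_ j) ->
  {within `[u, v], continuous (fun x => P js (t, y + x *: e_ j) i 0)}.
Proof.
move=> sq Du Dv; apply/within_cont_eps => x; rewrite /= in_itv /= => /andP[ux xv] e e0.
have Dx := shift_itv ux xv Du Dv.
have [d d0 H] := (iffLR (within_cont_eps _ _) (FC.2 js sq)) _ Dx e e0.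
exists d => // x'; rewrite /= in_itv /= => /andP[ux' xv'] xx'.
have Dx' := shift_itv ux' xv' Du Dv.
apply: le_lt_trans (H _ Dx' _).
  by have := mx_norm_coord (P js (t, y + x *: e_ j) - P js (t, y + x' *: e_ j)) i 0; rewrite !mxE.
apply: le_lt_trans xx'.
rewrite prod_normE /= subrr normr0 ge_max normr_ge0 /=.
apply/mx_norm_leP => // k l; rewrite ord1 !mxE eqxx andbT.
have -> : y k 0 + x * (k == j)%:R - (y k 0 + x' * (k == j)%:R) = (x - x') * (k == j)%:R by ring.
by rewrite normrM; case: eqP => _; rewrite ?normr1 ?normr0 ?mulr1 ?mulr0.
Qed.

(** The comparison function g is free because it takes four shapes: constant for Lipschitz bounds,
    linear for the quadratic remainder, polynomial for Taylor's formula, and a parallel path for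
    mixed second differences. Continuity is asked on both [0, h] and [h, 0] since h may have either
    sign. *)
Lemma path_mvt js t y j i h (g : R -> R) (dg : R -> R) C : (size js < q)%N ->
  D (t, y) -> D (t, y + h *: e_ j) ->
  (forall x, (0 < x < h) || (h < x < 0) -> is_derive x (1:R) g (dg x)) ->
  {within `[0, h], continuous g} -> {within `[h, 0], continuous g} ->
  (forall x, (0 < x < h) || (h < x < 0) ->
     `|P (j :: js) (t, y + x *: e_ j) i 0 - dg x| <= C) ->
  `|(P js (t, y + h *: e_ j) i 0 - g h) - (P js (t, y) i 0 - g 0)| <= C * `|h|.
Proof.
move=> sq D0 Dh hg cg cg' hC.
have E0 : y = y + 0 *: e_ j by rewrite scale0r addr0.
have D0' : D (t, y + 0 *: e_ j) by rewrite -E0.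
have pc := path_cont (i:=i) (ltnW sq) D0' Dh; have pc' := path_cont (i:=i) (ltnW sq) Dh D0'.
rewrite [X in _ - (P js (t, X) i 0 - _)]E0.
have [h0|h0] := leP 0 h.
  rewrite (ger0_norm h0) -[X in C * X]subr0.
  apply: (@MVT_bound R (fun x => P js (t, y + x *: e_ j) i 0 - g x)
    (fun x => P (j :: js) (t, y + x *: e_ j) i 0 - dg x)) => //.
  - move=> x /andP[x0 xh]; apply: dB; first exact: path_derive x0 xh D0' Dh.
    by apply: hg; rewrite x0 xh.
  - by move=> x; apply: cvgB; [exact: pc|exact: cg].
  - by move=> x xh; apply: hC; rewrite xh.
rewrite (ltr0_norm h0) distrC -[X in C * X]add0r.
apply: (@MVT_bound R (fun x => P js (t, y + x *: e_ j) i 0 - g x)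
    (fun x => P (j :: js) (t, y + x *: e_ j) i 0 - dg x)) => //.
- exact: ltW.
- move=> x /andP[x0 xh]; apply: dB; first exact: path_derive x0 xh Dh D0'.
  by apply: hg; rewrite x0 xh orbT.
- by move=> x; apply: cvgB; [exact: pc'|exact: cg'].
- by move=> x xh; apply: hC; rewrite xh orbT.
Qed.

Lemma shift_between t y j h x : (0 < x < h) || (h < x < 0) ->
  D (t, y) -> D (t, y + h *: e_ j) -> D (t, y + x *: e_ j).
Proof.
move=> xh D0 Dh.
have D0' : D (t, y + 0 *: e_ j) by rewrite scale0r addr0.
case/orP: xh => /andP[/ltW x0 /ltW xh].
  exact: shift_itv D0' Dh.
exact: shift_itv Dh D0'.
Qed.

Lemma partials_lip1 js t y j h C : (size js < q)%N ->
  (forall z, D z -> `|P (j :: js) z| <= C) ->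
  D (t, y) -> D (t, y + h *: e_ j) ->
  `|P js (t, y + h *: e_ j) - P js (t, y)| <= C * `|h|.
Proof.
move=> sq hC D0 Dh.
have C0 : 0 <= C by apply: le_trans (hC _ D0).
apply/mx_norm_leP => [|i k]; first by rewrite mulr_ge0.
rewrite ord1 !mxE -[X in `|X - _|]subr0 -[X in `|_ - X|]subr0.
apply: (@path_mvt js t y j i h (cst 0) (cst 0) C) => //.
- by move=> x; exact: cvg_cst.
- by move=> x; exact: cvg_cst.
- move=> x xh; rewrite subr0; apply: le_trans (mx_norm_coord _ _ _) _.
  by apply: hC; exact: shift_between xh D0 Dh.
Qed.

(** In the maximum norm the tube is a box at each time, so with three corners of a coordinate
    rectangle it contains the fourth. *)
Lemma shiftC t y i j h k : i != j -> D (t, y + k *: e_ j) -> D (t, y + h *: e_ i) ->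
  D (t, y) -> D (t, y + h *: e_ i + k *: e_ j).
Proof.
move=> ij /tubeP[Tt H1] /tubeP[_ H2] /tubeP[_ H3]; apply/tubeP; split => // l.
move: (H1 l) (H2 l) (H3 l); rewrite !shiftE.
case: (eqVneq l i) => [->|_]; last by rewrite addr0 => h1 _ _.
by rewrite (negbTE ij) !addr0 => _ h2 _.
Qed.

(* A bound for the derivatives taken in the order j, then i gives the Lipschitz
   bound for the i-th partial in direction j, hence no symmetry of second
   derivatives is needed. *)
Lemma partials_lip2 js t y i j k C : ((size js).+1 < q)%N -> i != j ->
  (forall z, D z -> `|P (i :: j :: js) z| <= C) ->
  D (t, y) -> D (t, y + k *: e_ j) ->
  `|P (i :: js) (t, y + k *: e_ j) - P (i :: js) (t, y)| <= C * `|k|.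
Proof.
move=> sq ij hC D0 Dk.
have C0 : 0 <= C by apply: le_trans (hC _ D0).
have sq' : (size js < q)%N by apply: ltn_trans sq.
(* A mixed second difference, estimated by the mean value inequality along j and then along i. The
   bound, divided by |h|, does not depend on h and therefore survives the limit that defines the
   i-th partial derivative. *)
have second h : D (t, y + h *: e_ i) ->
  `|pquot i (P js) (t, y + k *: e_ j) h - pquot i (P js) (t, y) h| <= C * `|k|.
  move=> Dh.
  have Dhk := shiftC ij Dk Dh D0.
  have [->|h0] := eqVneq h 0.
    by rewrite /pquot /= invr0 !scale0r subrr normr0 mulr_ge0.
  rewrite /pquot /= -scalerBr normrZ normfV ler_pdivrMl ?normr_gt0 //.
  apply/mx_norm_leP => [|l m]; first by rewrite !mulr_ge0.
  rewrite ord1 !mxE.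
  have Ey : y + k *: e_ j + h *: e_ i = y + h *: e_ i + k *: e_ j by rewrite addrAC.
  rewrite Ey.
  pose g x := P js (t, y + x *: e_ j) l 0.
  have g0 : g 0 = P js (t, y) l 0 by rewrite /g scale0r addr0.
  have -> : P js (t, y + h *: e_ i + k *: e_ j) l 0 - P js (t, y + k *: e_ j) l 0
     - (P js (t, y + h *: e_ i) l 0 - P js (t, y) l 0) =
     (P js (t, y + h *: e_ i + k *: e_ j) l 0 - g k) - (P js (t, y + h *: e_ i) l 0 - g 0).
    by rewrite g0.
  have -> : `|h| * (C * `|k|) = (C * `|h|) * `|k| by ring.
  have D00 : D (t, y + 0 *: e_ j) by rewrite scale0r addr0.
  apply: (@path_mvt js t (y + h *: e_ i) j l k g (fun x => P (j :: js) (t, y + x *: e_ j) l 0)) => //.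
  - move=> x /orP[/andP[x0 xk]|/andP[x0 xk]].
      exact: path_derive x0 xk D00 Dk.
    exact: path_derive x0 xk Dk D00.
  - exact: path_cont (ltnW sq') D00 Dk.
  - exact: path_cont (ltnW sq') Dk D00.
  - move=> x xk.
    have Dx := shift_between xk D0 Dk.
    have Dhx : D (t, y + h *: e_ i + x *: e_ j) by exact: shift_between xk Dh Dhk.
    have E : y + x *: e_ j + h *: e_ i = y + h *: e_ i + x *: e_ j by rewrite addrAC.
    have := @partials_lip1 (j :: js) t (y + x *: e_ j) i h C sq hC Dx.
    rewrite E => /(_ Dhx); apply: le_trans.
    have := mx_norm_coord (P (j :: js) (t, y + h *: e_ i + x *: e_ j) - P (j :: js) (t, y + x *: e_ j)) l 0.
    by rewrite !mxE.
have [v hv] := FC.1 js sq' i _ D0.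
have [w hw] := FC.1 js sq' i _ Dk.
rewrite /= (has_partial_partial D0 hv) (has_partial_partial Dk hw).
apply/ler_addgt0Pr => e e0.
have e20 : 0 < e / 2 by rewrite divr_gt0.
have [d d0 Hd] := has_partialP hv e20.
have [d' d0' Hd'] := has_partialP hw e20.
have [h [Dh h0 hd hd']] : exists h, [/\ D (t, y + h *: e_ i), h != 0, `|h| < d & `|h| < d'].
  have PF := pincr_filter i D0.
  have [] := @filter_ex _ _ PF (fun h => D (t, y + h *: e_ i) /\ h != 0 /\ `|h| < Num.min d d').
    rewrite /within /dnbhs /= /within /=; apply/nbhs_ballP.
    exists (Num.min d d') => /=; first by rewrite lt_min d0.
    by move=> h; rewrite /ball /= sub0r normrN.
  by move=> h [Dh [h0]]; rewrite lt_min => /andP[hd hd']; exists h.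
have h1 := Hd h Dh h0 hd.
have Dhk : D (t, y + k *: e_ j + h *: e_ i) by rewrite addrAC; exact: shiftC.
have h2 := Hd' h Dhk h0 hd'.
have h3 := second h Dh.
have -> : w - v = (w - pquot i (P js) (t, y + k *: e_ j) h) +
  ((pquot i (P js) (t, y + k *: e_ j) h - pquot i (P js) (t, y) h)
   - (v - pquot i (P js) (t, y) h)).
  by apply/matrixP => b c; rewrite !mxE; ring.
apply: le_trans (ler_normD _ _) _.
apply: le_trans (lerD (ltW h2) (ler_normB _ _)) _.
by lra.
Qed.

End one_function.
End tube_calculus.

Section tube_taylor.
Context {R : realType} {n : nat}.
Notation vec := ('cV[R]_n).
Variables (t0 a : R) (phi0 : R -> vec).
Hypothesis a_gt0 : 0 < a.
Notation D := (tube t0 a phi0).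
Implicit Types (t h u v C m : R) (x y d : vec) (j : 'I_n).

Local Notation e_ j := (delta_mx j 0 : vec).

(* Replacing the coordinates of y by those of y' one at a time stays in the tube. *)
Definition mix (r : nat) (y y' : vec) : vec :=
  \col_i (if (i < r)%N then y' i 0 else y i 0).

Lemma mix0 y y' : mix 0 y y' = y.
Proof. by apply/colP => i; rewrite mxE. Qed.

Lemma mixn y y' : mix n y y' = y'.
Proof. by apply/colP => i; rewrite mxE ltn_ord. Qed.

Lemma mixS j y y' : mix j.+1 y y' = mix j y y' + (y' j 0 - y j 0) *: e_ j.
Proof.
apply/colP => i; rewrite !mxE eqxx andbT ltnS.
case: (eqVneq i j) => [->|ij]; first by rewrite leqnn ltnn mulr1 addrC subrK.
by rewrite mulr0 addr0 ltn_neqAle (inj_eq val_inj) ij.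
Qed.

Lemma mix_norm (r : nat) y y' x m : `|y - x| <= m -> `|y' - x| <= m ->
  `|mix r y y' - x| <= m.
Proof.
move=> h1 h2; have m0 : 0 <= m by apply: le_trans h1.
apply/mx_norm_leP => // i k; rewrite ord1 !mxE; case: ifP => _.
  by have := mx_norm_coord (y' - x) i 0; rewrite !mxE => h; exact: le_trans h _.
by have := mx_norm_coord (y - x) i 0; rewrite !mxE => h; exact: le_trans h _.
Qed.

Lemma mix_tube (r : nat) t y y' : D (t, y) -> D (t, y') -> D (t, mix r y y').
Proof. by move=> [/= Tt h1] [_ h2]; split => //=; exact: mix_norm. Qed.

Section one_function.
Variables (F : R * vec -> vec) (q : nat).
Hypothesis FC : C0q D q F.
Notation P js := (partials D js F).

Lemma partials_lip js t y y' C : (size js < q)%N ->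
  (forall j z, D z -> `|P (j :: js) z| <= C) -> D (t, y) -> D (t, y') ->
  `|P js (t, y') - P js (t, y)| <= n%:R * C * `|y' - y|.
Proof.
move=> sq hC Dy Dy'.
rewrite -[X in P js (t, X) - _](mixn y y') -[X in _ - P js (t, X)](mix0 y y').
rewrite -(telescope_sumr (fun r => P js (t, mix r y y'))) // big_mkord.
apply: le_trans (ler_norm_sum _ _ _) _.
rewrite -mulrA -[X in X%:R * _]card_ord mulr_natl -sumr_const.
apply: ler_sum => j _; rewrite mixS.
have D1 := mix_tube j Dy Dy'.
have D2 := mix_tube j.+1 Dy Dy'; rewrite mixS in D2.
apply: le_trans (partials_lip1 a_gt0 FC sq (hC j) D1 D2) _.
apply: ler_wpM2l; first by apply: le_trans (hC j _ Dy).
by have := mx_norm_coord (y' - y) j 0; rewrite !mxE.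
Qed.

Definition ord_leq (i j : 'I_n) := (i <= j)%N.

Section second_order.
Variable C : R.
Hypothesis q2 : (2 <= q)%N.
Hypothesis BC : forall js, sorted ord_leq js -> (size js <= 2)%N ->
  forall z, D z -> `|P js z| <= C.

Lemma partial_lip i t y y' : D (t, y) -> D (t, y') ->
  `|partial D i F (t, y') - partial D i F (t, y)| <= n%:R * C * `|y' - y|.
Proof.
move=> Dy Dy'.
rewrite -[X in partial D i F (t, X) - _](mixn y y') -[X in _ - partial D i F (t, X)](mix0 y y').
rewrite -(telescope_sumr (fun r => partial D i F (t, mix r y y'))) // big_mkord.
apply: le_trans (ler_norm_sum _ _ _) _.
rewrite -mulrA -[X in X%:R * _]card_ord mulr_natl -sumr_const.
apply: ler_sum => j _; rewrite mixS.
have D1 := mix_tube j Dy Dy'.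
have D2 := mix_tube j.+1 Dy Dy'; rewrite mixS in D2.
have C0 : 0 <= C by apply: le_trans (BC (js := [::]) isT isT Dy).
apply: (@le_trans _ _ (C * `|y' j 0 - y j 0|)); last first.
  apply: ler_wpM2l => //.
  by have := mx_norm_coord (y' - y) j 0; rewrite !mxE.
(* Only the sorted one of the two second derivatives has a bound. It is the derivative in direction
   j of the i-th partial when j <= i; otherwise [partials_lip2] exchanges the roles. *)
have [ji|ij] := leqP j i.
  apply: (partials_lip1 (js := [:: i]) a_gt0 FC q2 _ D1 D2).
  by apply: BC => //=; rewrite /ord_leq ji.
apply: (partials_lip2 (js := [::]) a_gt0 FC q2 _ _ D1 D2).
  by rewrite neq_ltn ij.
by apply: BC => //=; rewrite /ord_leq ltnW.
Qed.

(** Along each segment of the path from y to y' the derivative of F differs from the partial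
    derivative at x by at most n C m. The linearization point x is kept apart from y and y', so that
    the result is a Lipschitz bound for the nonlinear part, with a constant that shrinks with m. *)
Lemma quadratic_remainder t x y y' m : D (t, x) -> D (t, y) -> D (t, y') ->
  `|y - x| <= m -> `|y' - x| <= m ->
  `|F (t, y') - F (t, y) - Defs.jacobian D F (t, x) *m (y' - y)| <=
     n%:R * (n%:R * C * m) * `|y' - y|.
Proof.
move=> Dx Dy Dy' hy hy'.
have m0 : 0 <= m by apply: le_trans hy.
have C0 : 0 <= C by apply: le_trans (BC (js := [::]) isT isT Dy).
apply/mx_norm_leP => [|l k]; first by rewrite !mulr_ge0.
rewrite ord1 !mxE.
rewrite -[X in F (t, X) l 0 - _](mixn y y') -[X in _ - F (t, X) l 0 - _](mix0 y y').
rewrite -(telescope_sumr (fun r => F (t, mix r y y') l 0)) // big_mkord -sumrB.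
apply: le_trans (ler_norm_sum _ _ _) _.
rewrite -mulrA -[X in X%:R * _]card_ord mulr_natl -sumr_const.
apply: ler_sum => j _; rewrite mixS !mxE.
have D1 := mix_tube j Dy Dy'.
have D2 := mix_tube j.+1 Dy Dy'; rewrite mixS in D2.
set h := y' j 0 - y j 0.
apply: (@le_trans _ _ (n%:R * C * m * `|h|)); last first.
  apply: ler_wpM2l; first by rewrite !mulr_ge0.
  by have := mx_norm_coord (y' - y) j 0; rewrite !mxE.
set c := partial D j F (t, x) l 0.
have -> : F (t, mix j y y' + h *: e_ j) l 0 - F (t, mix j y y') l 0 - c * h =
  (F (t, mix j y y' + h *: e_ j) l 0 - h * c) - (F (t, mix j y y') l 0 - 0 * c) by ring.
have cg (u v : R) : {within `[u, v], continuous (fun s : R => s * c)}.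
  by apply: continuous_subspaceT => s; apply: mulrr_continuous.
apply: (@path_mvt R n t0 a phi0 a_gt0 F q FC [::] t (mix j y y') j l h
  (fun s => s * c) (fun=> c)) => //.
- exact: ltn_trans q2.
- move=> s _; have -> : (fun r : R => r * c) = (fun r => c * r).
    by apply/funext => r; rewrite mulrC.
  by rewrite -[X in is_derive _ _ _ X]mulr1; exact: (dZ c (is_derive_id s 1)).
- move=> s hs; rewrite /c.
  have Ds := shift_between a_gt0 hs D1 D2.
  have := mx_norm_coord (partial D j F (t, mix j y y' + s *: e_ j) - partial D j F (t, x)) l 0.
  rewrite !mxE => h1; apply: le_trans h1 _.
  apply: le_trans (partial_lip j Dx Ds) _.
  apply: ler_wpM2l; first by rewrite mulr_ge0.
  (* A point of the segment lies, coordinate by coordinate, between two mixtures of y and y', both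
     within m of x. *)
  apply/mx_norm_leP => // i k'; rewrite ord1 !mxE eqxx andbT.
  have hm := mx_norm_coord (mix j y y' - x) i 0.
  have hm' := mx_norm_coord (mix j.+1 y y' - x) i 0.
  have {}hm := le_trans hm (mix_norm j hy hy').
  have {}hm' := le_trans hm' (mix_norm j.+1 hy hy').
  move: hm hm'; rewrite !mxE.
  case: (eqVneq i j) => [->|ij]; last by rewrite mulr0 addr0.
  rewrite ltnn ltnSn mulr1 !ler_norml => /andP[h3 h4] /andP[h5 h6].
  by case/orP: hs => /andP[s0 sh]; apply/andP; split; rewrite /h in sh s0 *; lra.
Qed.

End second_order.

(** The derivative of the remainder along the segment is the remainder, one order lower, of the j-th
    partial derivative. Each step uses the mean value inequality instead of an integration, hence no
    factorial in the bound. *)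
Lemma taylor_coord N js t y j h l C : (size js + N <= q)%N ->
  (forall z, D z -> `|P (nseq N j ++ js) z| <= C) ->
  D (t, y) -> D (t, y + h *: e_ j) ->
  `|P js (t, y + h *: e_ j) l 0 -
    \sum_(i < N) h ^+ i / i`!%:R * P (nseq i j ++ js) (t, y) l 0| <= C * `|h| ^+ N.
Proof.
elim: N js h => [|N IH] js h sq hC D0 Dh.
  rewrite big_ord0 subr0 expr0 mulr1.
  by apply: le_trans (mx_norm_coord _ _ _) _; exact: hC.
have C0 : 0 <= C by apply: le_trans (hC _ D0).
pose c i := P (nseq i j ++ js) (t, y) l 0.
pose g (s : R) := \sum_(i < N.+1) s ^+ i / i`!%:R * c i.
pose dg (s : R) := \sum_(i < N) s ^+ i / i`!%:R * c i.+1.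
have dg_ s : is_derive s (1:R) g (dg s).
  have -> : g = (fun s : R => c 0%N + \sum_(i < N) s ^+ i.+1 / (i.+1)`!%:R * c i.+1).
    by apply/funext => r; rewrite /g big_ord_recl expr0 fact0 divr1 mul1r.
  rewrite -[X in is_derive _ _ _ X]add0r.
  apply: (dD (f := fun=> c 0%N)).
  rewrite /dg; apply: dsum => i _.
  have -> : (fun r : R => r ^+ i.+1 / (i.+1)`!%:R * c i.+1) =
     (fun r : R => c i.+1 / (i.+1)`!%:R * r ^+ i.+1) by apply/funext => r; ring.
  have -> : s ^+ i / i`!%:R * c i.+1 = c i.+1 / (i.+1)`!%:R * (s ^+ i *+ i.+1).
    rewrite factS natrM -[_ *+ i.+1]mulr_natr; field.
    by rewrite addrC natr1 !pnatr_eq0 -!lt0n fact_gt0.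
  apply: dZ; rewrite -mulr_natl -[X in is_derive _ _ _ X]mulr1.
  exact: (dX i.+1 (is_derive_id s 1)).
have cg u v : {within `[u, v], continuous g}.
  apply: derivable_within_continuous => s _; have [] := dg_ s; done.
have g0 : g 0 = P js (t, y) l 0.
  rewrite /g big_ord_recl big1 => [|i _]; first by rewrite expr0 fact0 divr1 mul1r addr0.
  by rewrite expr0n /= !mul0r.
have -> : P js (t, y + h *: e_ j) l 0 - g h =
   (P js (t, y + h *: e_ j) l 0 - g h) - (P js (t, y) l 0 - g 0) by rewrite g0 subrr subr0.
rewrite exprSr mulrA.
apply: (@path_mvt R n t0 a phi0 a_gt0 F q FC js t y j l h g dg) => //.
  by apply: leq_trans sq; rewrite addnS ltnS leq_addr.
move=> s hs.
have Ds := shift_between a_gt0 hs D0 Dh.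
have E i : nseq i j ++ j :: js = nseq i.+1 j ++ js.
  by elim: i => //= i ->.
have -> : dg s = \sum_(i < N) s ^+ i / i`!%:R * P (nseq i j ++ j :: js) (t, y) l 0.
  by apply: eq_bigr => i _; rewrite E.
apply: le_trans (IH (j :: js) s _ _ D0 Ds) _.
- by rewrite /= addSnnS.
- by rewrite E.
- apply: ler_wpM2l => //; apply: lerXn2r; rewrite ?nnegrE //.
  case/orP: hs => /andP[s0 sh].
    by rewrite !ger0_norm ?ltW // (lt_trans s0).
  by rewrite !ltr0_norm ?lerN2 ?ltW // (lt_trans s0).
Qed.

Lemma taylor_coord_norm N js t y j h C : (size js + N <= q)%N ->
  (forall z, D z -> `|P (nseq N j ++ js) z| <= C) ->
  D (t, y) -> D (t, y + h *: e_ j) ->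
  `|P js (t, y + h *: e_ j) -
    \sum_(i < N) (h ^+ i / i`!%:R) *: P (nseq i j ++ js) (t, y)| <= C * `|h| ^+ N.
Proof.
move=> sq hC D0 Dh.
have C0 : 0 <= C by apply: le_trans (hC _ D0).
apply/mx_norm_leP => [|l k]; first by rewrite mulr_ge0 // exprn_ge0.
rewrite ord1 !mxE summxE.
under eq_bigr do rewrite mxE.
exact: taylor_coord.
Qed.

End one_function.

End tube_taylor.

(** * Multi-indices as sorted lists of directions *)

Section canonical_order.
Context {n : nat}.
Implicit Types (w : mindex n) (j : 'I_n).

(* The order in which [mpartial] differentiates; Taylor's formula is expanded from
   the last coordinate to the first, so that only derivatives in this order occur
   and their symmetry is not needed. *)
Definition canon w : seq 'I_n := flatten [seq nseq (w j) j | j <- enum 'I_n].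

Lemma count_canon w j : count_mem j (canon w) = w j.
Proof.
rewrite /canon count_flatten -map_comp sumnE big_map big_enum /=.
rewrite (bigD1 j) //= count_nseq /= eqxx mul1n big1 ?addn0 // => i ij.
by rewrite count_nseq /= (negbTE ij).
Qed.

Lemma size_canon w : size (canon w) = mabs w.
Proof.
rewrite /canon size_flatten /shape -map_comp sumnE big_map big_enum /=.
by apply: eq_bigr => i _; rewrite size_nseq.
Qed.

Lemma sorted_canon w : sorted ord_leq (canon w).
Proof.
apply: pairwise_sorted; rewrite /canon.
have : pairwise (@ord_leq n) (enum 'I_n).
  rewrite -(pairwise_map val leq) val_enum_ord.
  by rewrite -sorted_pairwise ?iota_sorted //; exact: leq_trans.
elim: (enum 'I_n) => //= j s IH /andP[js ps].
rewrite pairwise_cat IH // andbT; apply/andP; split.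
  apply/allrelP => x y; rewrite mem_nseq => /andP[_ /eqP ->].
  move=> /flattenP[_ /mapP[i si ->]]; rewrite mem_nseq => /andP[_ /eqP ->].
  exact: (allP js).
elim: (w j) => //= k ->; rewrite andbT; apply/allP => x.
by rewrite mem_nseq => /andP[_ /eqP ->]; rewrite /ord_leq.
Qed.

(** A sorted list is determined by its multiplicities; this carries the bounds given for [mpartial]
    over to all sorted lists of derivatives. *)
Lemma sorted_canonE (js : seq 'I_n) : sorted ord_leq js ->
  js = canon [ffun j => count_mem j js].
Proof.
move=> sjs; apply: (@sorted_eq _ (@ord_leq n)) => //.
- by move=> x y z; exact: leq_trans.
- by move=> x y; rewrite /ord_leq => /anti_leq /val_inj.
- exact: sorted_canon.
- by apply/allP => x _ /=; rewrite count_canon ffunE.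
Qed.

End canonical_order.

(** * Taylor's formula in several variables *)

Section multi_taylor.
Context {R : realType} {n : nat}.
Notation vec := ('cV[R]_n).
Variables (t0 a : R) (phi0 : R -> vec).
Hypothesis a_gt0 : 0 < a.
Notation D := (tube t0 a phi0).
Variables (F : R * vec -> vec) (q : nat).
Hypothesis FC : C0q D q F.
Notation P js := (partials D js F).

Lemma mpartialE (w : mindex n) : mpartial D w F = P (canon w).
Proof. by []. Qed.

Section ffun_index.
Variable N : nat.
Implicit Types (u : {ffun 'I_n -> 'I_N.+1}).

Definition wv u : mindex n := [ffun i => val (u i)].

Lemma wv_inj : injective wv.
Proof.
move=> u v /ffunP H; apply/ffunP => i; apply/val_inj.
by have := H i; rewrite !ffunE.
Qed.

(** The entries of a multi-index are bounded by its total degree, so listing finite functions into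
    'I_N.+1 misses none of degree below N. *)
Definition mlist : seq (mindex n) :=
  [seq w <- [seq wv u | u <- enum {ffun 'I_n -> 'I_N.+1}] | (mabs w < N)%N].

Lemma mlist_uniq : uniq mlist.
Proof. by rewrite filter_uniq // map_inj_uniq ?enum_uniq //; exact: wv_inj. Qed.

Lemma mem_mlist w : (w \in mlist) = (mabs w < N)%N.
Proof.
rewrite mem_filter; case: (ltnP (mabs w) N) => //= wN.
apply/mapP; exists [ffun i => inord (w i)]; first by rewrite mem_enum.
apply/ffunP => i; rewrite !ffunE /= inordK // ltnS.
apply: leq_trans (ltnW wN); rewrite /mabs (bigD1 i) //=; exact: leq_addr.
Qed.

Lemma big_mlist (V : nmodType) (G : mindex n -> V) :
  \sum_(w <- mlist) G w = \sum_(u | (mabs (wv u) < N)%N) G (wv u).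
Proof. by rewrite big_filter big_map big_enum_cond. Qed.

End ffun_index.

Lemma bounded_sorted (N : nat) :
  (forall w : mindex n, (mabs w <= N)%N -> bounded_on D (mpartial D w F)) ->
  exists2 C : R, 0 <= C & forall js, sorted ord_leq js -> (size js <= N)%N ->
    forall z, D z -> `|P js z| <= C.
Proof.
move=> hb.
have /choice[c cP] (w : mindex n) : exists C : R, 0 <= C /\ ((mabs w <= N)%N ->
    forall z, D z -> `|mpartial D w F z| <= C).
  have [wN|wN] := leqP (mabs w) N; last by exists 0; split.
  have [C hC] := hb w wN; exists `|C|; split => // _ z Dz.
  by apply: le_trans (hC z Dz) _; exact: ler_norm.
exists (\sum_(w <- mlist N.+1) c w).
  by apply: sumr_ge0 => w _; have [] := cP w.
move=> js sjs sN z Dz.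
have E := sorted_canonE sjs; set w := finfun _ in E.
have wN : (mabs w <= N)%N by rewrite -size_canon -E.
have [_ h] := cP w; rewrite E; apply: le_trans (h wN z Dz) _.
rewrite (bigD1_seq w) ?mlist_uniq ?mem_mlist ?ltnS //= lerDl.
by apply: sumr_ge0 => w' _; have [] := cP w'.
Qed.

Section expansion.
Variables (N : nat) (C t : R) (x d : vec).
Hypothesis Nq : (N <= q)%N.
Hypothesis BC : forall js, sorted ord_leq js -> (size js <= N)%N ->
    forall z, D z -> `|P js z| <= C.
Hypothesis C_ge0 : 0 <= C.
Hypothesis Dx : D (t, x).
Hypothesis Dxd : D (t, x + d).
Let ind := {ffun 'I_n -> 'I_N.+1}.
Implicit Types (u v : ind).

Definition mcoef (w : mindex n) : R :=
  (mfact w)%:R^-1 * \prod_j d j 0 ^+ w j.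

Let low (r : nat) u := [forall i : 'I_n, (i < r)%N ==> (u i == ord0)].
Let cond (r : nat) u := low r u && (mabs (wv u) < N)%N.

(** Interpolates between the Taylor polynomial at x, for r = 0, and the value F (t, x + d), for r =
    n and N > 0: the coordinates below r have already been moved to x + d, the others are still
    expanded. *)
Let tay (r : nat) := \sum_(u | cond r u)
  mcoef (wv u) *: mpartial D (wv u) F (t, mix r x (x + d)).

Let set_at u (r : 'I_n) i : ind := [ffun j => if j == r then i else u j].

Let set_atr u r i : set_at u r i r = i.
Proof. by rewrite ffunE eqxx. Qed.

Let low0 (r : 'I_n) v : low r.+1 v -> v r = ord0.
Proof. by move=> /forallP/(_ r); rewrite ltnS leqnn => /eqP. Qed.

Let lowS (r : 'I_n) v : low r.+1 v = low r v && (v r == ord0).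
Proof.
apply/forallP/andP => [H|[/forallP H /eqP h] i].
  split; last by have := H r; rewrite ltnS leqnn.
  by apply/forallP => i; apply/implyP => ir; have := H i; rewrite ltnS (ltnW ir).
apply/implyP; rewrite ltnS leq_eqVlt => /orP[/eqP/val_inj ->|ir]; first by rewrite h.
by have := H i; rewrite ir.
Qed.

Let low_set (r : 'I_n) v i : low r (set_at v r i) = low r v.
Proof.
apply: eq_forallb => j; rewrite ffunE; case: (eqVneq j r) => // ->.
by rewrite ltnn.
Qed.

Let mabs_set (r : 'I_n) v i : v r = ord0 ->
  mabs (wv (set_at v r i)) = (mabs (wv v) + i)%N.
Proof.
move=> v0; rewrite /mabs (bigD1 r) //= [in RHS](bigD1 r) //= !ffunE eqxx v0 add0n addnC.
congr (_ + _)%N; apply: eq_bigr => j jr; rewrite !ffunE (negbTE jr) //.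
Qed.

Let coef_set (r : 'I_n) v (i : 'I_N.+1) : v r = ord0 ->
  mcoef (wv (set_at v r i)) = mcoef (wv v) * (d r 0 ^+ i / i`!%:R).
Proof.
move=> v0.
have f1 : mfact (wv (set_at v r i)) = (i`! * mfact (wv v))%N.
  rewrite /mfact (bigD1 r) //= [in RHS](bigD1 r) //= !ffunE eqxx v0 fact0 mul1n.
  by congr (_ * _)%N; apply: eq_bigr => j jr; rewrite !ffunE (negbTE jr).
have f2 : \prod_j d j 0 ^+ wv (set_at v r i) j = d r 0 ^+ i * \prod_j d j 0 ^+ wv v j.
  rewrite (bigD1 r) //= [in RHS](bigD1 r) //= !ffunE eqxx v0 expr0 mul1r.
  by congr (_ * _); apply: eq_bigr => j jr; rewrite !ffunE (negbTE jr).
by rewrite /mcoef f1 f2 natrM invfM; ring.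
Qed.

Let canon_set (r : 'I_n) v (i : 'I_N.+1) : low r.+1 v ->
  nseq i r ++ canon (wv v) = canon (wv (set_at v r i)).
Proof.
move=> lv; have v0 := low0 lv.
apply: (@sorted_eq _ (@ord_leq n)).
- by move=> y z s; exact: leq_trans.
- by move=> y z; rewrite /ord_leq => /anti_leq /val_inj.
- have mem j : j \in canon (wv v) -> (r <= j)%N.
    rewrite -has_pred1 has_count count_canon ffunE [(r <= j)%N]leqNgt; apply: contraL => jr.
    by move/forallP: lv => /(_ j); rewrite ltnS (ltnW jr) => /eqP ->.
  have := sorted_canon (wv v); case: (canon _) mem => [|c s] mem sc.
    rewrite cats0; case: (val i) => //= k.
    by elim: k => //= k ->; rewrite /ord_leq leqnn.
  have {}sc : path (@ord_leq n) c s := sc.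
  elim: (val i) => //= k.
  case: k => [_|k H] /=; first by rewrite sc andbT; apply: mem; rewrite inE eqxx.
  by rewrite {1}/ord_leq leqnn.
- exact: sorted_canon.
apply/allP => j _ /=; rewrite count_cat !count_canon !ffunE count_nseq /=.
by case: (eqVneq j r) => [->|jr]; rewrite ?eqxx ?v0 ?mul1n ?addn0 // eq_sym (negbTE jr).
Qed.

(** A multi-index supported on the coordinates from r on is an exponent i of the coordinate r
    together with a multi-index v supported after r. Summing over i first gives a one-variable
    Taylor polynomial of order N - |v| for each v. *)
Let tayE (r : 'I_n) : tay r = \sum_(v | cond r.+1 v) mcoef (wv v) *:
  \sum_(i < (N - mabs (wv v))%N) (d r 0 ^+ i / i`!%:R) *:
     P (nseq i r ++ canon (wv v)) (t, mix r x (x + d)).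
Proof.
rewrite /tay (partition_big (fun u => u r) xpredT) //=.
pose G u := mcoef (wv u) *: mpartial D (wv u) F (t, mix r x (x + d)).
transitivity (\sum_(i : 'I_N.+1) \sum_(v | cond r.+1 v && (mabs (wv v) + i < N)%N) G (set_at v r i)).
  apply: eq_bigr => i _.
  rewrite (reindex_onto (fun v => set_at v r i) (fun u => set_at u r ord0)); last first.
    move=> u /andP[_ /eqP ur]; apply/ffunP => j; rewrite !ffunE.
    by case: (eqVneq j r) => // ->.
  apply: eq_bigl => v; rewrite set_atr eqxx andbT.
  have -> : (set_at (set_at v r i) r ord0 == v) = (v r == ord0).
    apply/eqP/eqP => [<-|v0]; first by rewrite set_atr.
    by apply/ffunP => j; rewrite !ffunE; case: (eqVneq j r) => // ->.
  rewrite /cond low_set lowS; case: (eqVneq (v r) ord0) => [v0|_]; last by rewrite !andbF.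
  rewrite mabs_set // !andbT; case: (low r v) => //=.
  case: (ltnP (mabs (wv v) + i) N) => h; rewrite ?andbF ?andbT //.
  by apply/esym; apply: leq_ltn_trans h; exact: leq_addr.
rewrite (exchange_big_dep (cond r.+1)) /=; last by move=> i v _ /andP[].
apply: eq_bigr => v cv; rewrite scaler_sumr.
have lv : low r.+1 v by case/andP: cv.
rewrite (big_ord_widen N.+1 (fun i => mcoef (wv v) *: ((d r 0 ^+ i / i`!%:R) *:
    P (nseq i r ++ canon (wv v)) (t, mix r x (x + d))))); last first.
  by rewrite (leq_trans (leq_subr _ _)).
apply: eq_big => [i|i _]; first by rewrite cv ltn_subRL.
by rewrite /G mpartialE coef_set ?low0 // canon_set // scalerA.
Qed.

Lemma mcoef_bound w : `|mcoef w| <= `|d| ^+ mabs w.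
Proof.
rewrite /mcoef normrM normfV normr_nat.
have h : `|\prod_j d j 0 ^+ w j| <= `|d| ^+ mabs w.
  rewrite normr_prod /mabs -prodrXr; apply: ler_prod => j _.
  rewrite normr_ge0 normrX; apply: lerXn2r; rewrite ?nnegrE //.
  exact: mx_norm_coord.
apply: le_trans h; rewrite -[leRHS]mul1r; apply: ler_wpM2r => //.
rewrite invf_le1 ?ler1n ?ltr0n ?prodn_gt0 // => j; exact: fact_gt0.
Qed.

Let K : R := #|{: ind}|%:R.

(** For each v the coefficient has size |d| ^+ |v| and the one-variable remainder has order N - |v|,
    so every term contributes at most C |d| ^+ N; K bounds the number of terms. *)
Let tay_step (r : 'I_n) : `|tay r.+1 - tay r| <= K * (C * `|d| ^+ N).
Proof.
rewrite tayE /tay -sumrB; apply: le_trans (ler_norm_sum _ _ _) _.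
apply: (@le_trans _ _ (\sum_(v : ind) C * `|d| ^+ N)); last first.
  by rewrite sumr_const mulr_natl cardT /=.
rewrite [leRHS](bigID (cond r.+1)) /= -[leLHS]addr0; apply: lerD; last first.
  by apply: sumr_ge0 => *; rewrite mulr_ge0 // exprn_ge0.
apply: ler_sum => v /andP[lv vN].
rewrite -scalerBr normrZ mpartialE mixS.
have D1 := mix_tube r Dx Dxd.
have D2 := mix_tube r.+1 Dx Dxd; rewrite mixS in D2.
have dE : (x + d) r 0 - x r 0 = d r 0 by rewrite !mxE addrC addKr.
rewrite dE in D2 *.
have aN : (mabs (wv v) + (N - mabs (wv v)) = N)%N by rewrite subnKC // ltnW.
have h := @taylor_coord_norm R n t0 a phi0 a_gt0 F q FC (N - mabs (wv v))%N (canon (wv v)) t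
  (mix r x (x + d)) r (d r 0) C.
apply: le_trans (ler_wpM2l (normr_ge0 _) (h _ _ D1 D2)) _.
- by rewrite size_canon aN.
- move=> z Dz.
  have iN : (N - mabs (wv v) < N.+1)%N by rewrite ltnS leq_subr.
  have -> : nseq (N - mabs (wv v)) r = nseq (Ordinal iN) r by [].
  rewrite canon_set //; apply: BC => //; first exact: sorted_canon.
  by rewrite size_canon mabs_set ?low0 //= aN.
have -> : `|d| ^+ N = `|d| ^+ mabs (wv v) * `|d| ^+ (N - mabs (wv v)) by rewrite -exprD aN.
rewrite mulrCA; apply: ler_wpM2l => //.
apply: ler_pM => //; first exact: mcoef_bound.
by apply: lerXn2r; rewrite ?nnegrE //; exact: mx_norm_coord.
Qed.

Lemma multi_taylor : `|F (t, x + d) - \sum_(w <- mlist N) mcoef w *: mpartial D w F (t, x)|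
  <= (n%:R * K + 1) * (C * `|d| ^+ N).
Proof.
have E0 : \sum_(w <- mlist N) mcoef w *: mpartial D w F (t, x) = tay 0.
  rewrite big_mlist /tay mix0; apply: eq_bigl => u.
  by rewrite /cond; have -> : low 0 u by apply/forallP.
(* [tay n] is F (t, x + d) itself unless N = 0, when it is an empty sum and the bound for F is used;
   hence the summand 1 in the constant. *)
have En : `|F (t, x + d) - tay n| <= C * `|d| ^+ N.
  rewrite /tay mixn; have [N0|N0] := posnP N.
    rewrite big_pred0 => [|u]; last first.
      by apply/negP => /andP[_ h]; move: (leq_ltn_trans (leq0n _) h); rewrite N0.
    by rewrite subr0 N0 expr0 mulr1; apply: (BC (js := [::])).
  rewrite (big_pred1 [ffun=> ord0]) => [|u] /=.
    have w0 : wv [ffun=> ord0] = [ffun=> 0%N] :> mindex n.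
      by move=> ?; apply/ffunP => j; rewrite !ffunE.
    rewrite w0 mpartialE; have -> : canon [ffun=> 0%N] = [::] :> seq 'I_n.
      by apply: size0nil; rewrite size_canon /mabs big1 // => j _; rewrite ffunE.
    have -> : mcoef [ffun=> 0%N] = 1.
      by rewrite /mcoef /mfact !big1 ?invr1 ?mul1r // => j _; rewrite ffunE.
    by rewrite scale1r subrr normr0 mulr_ge0 // exprn_ge0.
  apply/andP/eqP => [[/forallP H _]|->].
    by apply/ffunP => j; rewrite ffunE; have := H j; rewrite ltn_ord => /eqP.
  split; first by apply/forallP => j; rewrite ffunE eqxx implybT.
  by rewrite /mabs big1 // => j _; rewrite !ffunE.
rewrite E0.
have -> : F (t, x + d) - tay 0 = (F (t, x + d) - tay n) + (tay n - tay 0).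
  by rewrite addrA subrK.
apply: le_trans (ler_normD _ _) _.
rewrite mulrDl mul1r [leRHS]addrC; apply: lerD => //.
rewrite -(telescope_sumr tay) // big_mkord.
apply: le_trans (ler_norm_sum _ _ _) _.
rewrite -mulrA -[X in X%:R * _]card_ord mulr_natl -sumr_const.
by apply: ler_sum => r _; exact: tay_step.
Qed.

End expansion.
End multi_taylor.

(** * Monomials and truncated formal series *)

Section monomials.
Context {R : realType} {m : nat}.
Variables (vr : 'I_m.+1 -> R).
Hypothesis vr_gt0 : forall l, 0 < vr l.
Hypothesis vr_mono : forall l l' : 'I_m.+1, (l <= l')%N -> vr l <= vr l'.
Notation letter := ('I_m.+1 * nat)%type.
Implicit Types (nu a b : monomial m) (x : letter) (B : R).

Lemma enum_msetD_perm (K : choiceType) (A B : ({mset K})%mset) :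
  perm_eq (A `+` B)%mset (enum_mset A ++ enum_mset B).
Proof.
by apply/allP => y _ /=; rewrite count_cat !count_mem_mset msetE2.
Qed.

Definition lrank x : R := vr x.1 + x.2%:R.

Lemma lrank_ge x : vr ord0 <= lrank x.
Proof. by rewrite /lrank -[vr ord0]addr0 lerD // vr_mono. Qed.

Lemma rankE nu : rank vr nu = \sum_(x <- nu) lrank x.
Proof. by []. Qed.

Lemma rankD a b : rank vr (a `+` b)%mset = rank vr a + rank vr b.
Proof. by rewrite !rankE (perm_big _ (enum_msetD_perm a b)) big_cat. Qed.

Lemma rank0 : rank vr (mset0 : monomial m) = 0.
Proof. by rewrite rankE big_mset0. Qed.

Lemma rank1 x : rank vr [mset x]%mset = lrank x.
Proof. by rewrite rankE enum_msetn /= big_cons big_nil addr0. Qed.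

Lemma rank_size nu : (size nu)%:R * vr ord0 <= rank vr nu.
Proof.
rewrite rankE; elim: (enum_mset nu) => [|x s IH]; first by rewrite mul0r big_nil.
by rewrite big_cons /= -natr1 mulrDl mul1r addrC lerD // lrank_ge.
Qed.

Lemma rank_ge0 nu : 0 <= rank vr nu.
Proof. by apply: le_trans (rank_size nu); rewrite mulr_ge0 // ltW. Qed.

Lemma mset_neq0_size nu : nu != mset0 -> (0 < size nu)%N.
Proof.
apply: contraNT; rewrite -leqNgt leqn0 size_eq0 => /eqP h.
by apply/eqP/msetP => x; rewrite -count_mem_mset h mset0E.
Qed.

Lemma rank_ge nu : nu != mset0 -> vr ord0 <= rank vr nu.
Proof.
move=> /mset_neq0_size s0; apply: le_trans (rank_size nu).
by rewrite -[leLHS]mul1r; apply: ler_wpM2r; [exact: ltW|rewrite ler1n].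
Qed.

Lemma rank_gt0 nu : nu != mset0 -> 0 < rank vr nu.
Proof. by move=> /rank_ge; apply: lt_le_trans. Qed.

Lemma lrank_le nu x : x \in nu -> lrank x <= rank vr nu.
Proof.
move=> xn; have := rankD [mset x]%mset (nu `\ x)%mset.
by rewrite msetB1K // rank1 => ->; rewrite lerDl rank_ge0.
Qed.

(** Each letter has rank at least [vr ord0] and at least its order of differentiation, so a bound on
    the rank bounds both the number of letters and their orders. *)
Lemma finite_rank_le B : finite_set [set nu : monomial m | rank vr nu <= B].
Proof.
pose M := (Num.truncn (B / vr ord0)).+1.
pose L := (Num.truncn B).+1.
pose f (s : M.-bseq ('I_m.+1 * 'I_L)) : monomial m :=
  seq_mset [seq (z.1, val z.2) | z <- s].
apply: (@sub_finite_set _ _ (f @` [set: M.-bseq ('I_m.+1 * 'I_L)])); last first.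
  by apply: finite_image; exact: finite_finset.
move=> nu /= nuB.
have B0 : 0 <= B by apply: le_trans nuB; exact: rank_ge0.
have sM : (size nu <= M)%N.
  apply: leqW; rewrite truncn_ge_nat ?divr_ge0 ?(ltW (vr_gt0 _)) //.
  by rewrite ler_pdivlMr //; exact: le_trans (rank_size nu) nuB.
have sz : (size [seq (z.1, inord z.2 : 'I_L) | z <- nu] <= M)%N by rewrite size_map.
exists (Bseq sz) => //; rewrite /f /= -map_comp.
rewrite (_ : [seq _ | z <- nu] = enum_mset nu) ?seq_mset_id //.
rewrite -[RHS]map_id; apply/eq_in_map => -[l r] xn /=; rewrite inordK //.
rewrite ltnS truncn_ge_nat //; apply: le_trans nuB; apply: le_trans (lrank_le xn).
by rewrite /lrank /= lerDr ltW.
Qed.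

Variables (t0 : R) (eps : 'I_m.+1 -> R -> R).
Notation mv := (mval t0 eps).

Definition lval x : R -> R := iter x.2 (deriv_on t0) (eps x.1).

Lemma mvalE nu t : mv nu t = \prod_(x <- nu) lval x t.
Proof. by []. Qed.

Lemma mvalD a b t : mv (a `+` b)%mset t = mv a t * mv b t.
Proof. by rewrite !mvalE (perm_big _ (enum_msetD_perm a b)) big_cat. Qed.

Lemma mval0 t : mv mset0 t = 1.
Proof. by rewrite mvalE big_mset0. Qed.

Lemma mval1 x t : mv [mset x]%mset t = lval x t.
Proof. by rewrite mvalE enum_msetn /= big_cons big_nil mulr1. Qed.

(** The monomial produced when the product rule differentiates the factor x. *)
Definition dmono nu x : monomial m := ((nu `\ x) `+` [mset (x.1, x.2.+1)])%mset.

Lemma dmono_neq0 nu x : dmono nu x != mset0.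
Proof.
apply/negP => /eqP/msetP/(_ (x.1, x.2.+1)).
by rewrite msetE2 mset0E msetnxx addn1.
Qed.

Lemma rank_dmono nu x : x \in nu -> rank vr (dmono nu x) = rank vr nu + 1.
Proof.
move=> xn; rewrite -[in RHS](msetB1K xn) !rankD !rank1 /lrank /= -natr1.
by ring.
Qed.

Lemma deriv_coefE (nu' nu : monomial m) :
  deriv_coef nu' nu = (\sum_(x <- nu') (nu == dmono nu' x))%N.
Proof.
by rewrite /deriv_coef -sum1_count big_mkcond /=; apply: eq_bigr => x _; case: eqP.
Qed.

Lemma deriv_coef_rank (nu' nu : monomial m) : deriv_coef nu' nu != 0%N ->
  rank vr nu = rank vr nu' + 1.
Proof.
rewrite -lt0n -has_count => /hasP[x xn /eqP ->].
by rewrite rank_dmono.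
Qed.

Lemma prod_derive (s : seq letter) (G : letter -> R -> R) (dG : letter -> R) t :
  (forall x, x \in s -> is_derive t (1:R) (G x) (dG x)) ->
  is_derive t (1:R) (fun u => \prod_(x <- s) G x u)
    (\sum_(x <- s) (\prod_(y <- rem x s) G y t) * dG x).
Proof.
elim: s => [|y s IH] h.
  rewrite big_nil; have -> : (fun u => \prod_(x <- [::]) G x u) = cst 1.
    by apply/funext => u; rewrite big_nil.
  exact: is_derive_cst.
have -> : (fun u => \prod_(x <- y :: s) G x u) = (fun u => G y u * \prod_(x <- s) G x u).
  by apply/funext => u; rewrite big_cons.
have hs x : x \in s -> is_derive t (1:R) (G x) (dG x).
  by move=> xs; apply: h; rewrite inE xs orbT.
have H := dM (h y (mem_head y s)) (IH hs).
apply: (eq_ind _ (is_derive t (1:R) _) H).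
rewrite big_cons /= eqxx [dG y * _]mulrC; congr (_ + _).
rewrite big_distrr /=; apply: eq_big_seq => x xs.
rewrite mulrA; congr (_ * _); case: eqP => [->|_]; last by rewrite big_cons.
by rewrite [RHS](perm_big _ (perm_to_rem xs)) big_cons.
Qed.

Lemma rem_perm nu x : x \in nu -> perm_eq (rem x (enum_mset nu)) (nu `\ x)%mset.
Proof.
move=> xn; apply/allP => y _ /=; rewrite count_rem !count_mem_mset msetB1E.
by rewrite [x \in _]xn andTb /pred1 /= [y == x]eq_sym.
Qed.

Lemma mval_derive nu (dG : letter -> R) t :
  (forall x, x \in nu -> is_derive t (1:R) (lval x) (lval (x.1, x.2.+1) t)) ->
  is_derive t (1:R) (mv nu) (\sum_(x <- nu) mv (dmono nu x) t).
Proof.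
move=> h; have := prod_derive h; rewrite /mval => H; apply: (eq_ind _ (is_derive t (1:R) _) H).
apply: eq_big_seq => x xn.
rewrite -/(mval t0 eps (dmono nu x) t) mvalD mval1 mvalE; congr (_ * _).
exact/perm_big/rem_perm.
Qed.

End monomials.

(** * Orders of magnitude in real powers of eps_1 *)

Section big_O.
Context {R : realType}.
Variables (t0 : R) (e : R -> R).
Hypothesis e_gt0 : forall t, t0 <= t -> 0 < e t.
Hypothesis e_to0 : e t @[t --> +oo] --> (0 : R).
Implicit Types (f g : R -> R) (c d : R).

Definition OE c f := exists C, \forall t \near +oo, `|f t| <= C * e t `^ c.

Lemma OEP c f : OE c f <-> exists C T, 0 <= C /\ t0 <= T /\
  forall t, T <= t -> `|f t| <= C * e t `^ c.
Proof.
split=> [[C /evP[T H]]|[C [T [_ [_ H]]]]]; last first.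
  by exists C; apply/(iffRL (evP _)); exists T.
exists `|C|, (Num.max t0 T); split => //; split; first by rewrite le_max lexx.
move=> t; rewrite ge_max => /andP[_ Tt]; apply: le_trans (H t Tt) _.
by apply: ler_wpM2r; [exact: powR_ge0|exact: ler_norm].
Qed.

Lemma e_le1 : exists2 T, t0 <= T & forall t, T <= t -> e t <= 1.
Proof.
have /cvg_evP/(_ _ ltr01)[T H] := e_to0.
exists (Num.max t0 T); first by rewrite le_max lexx.
move=> t; rewrite ge_max => /andP[_ Tt]; apply/ltW; apply: le_lt_trans (H t Tt).
by rewrite sub0r normrN ler_norm.
Qed.

Lemma OE_ev c f g : (\forall t \near +oo, `|f t| <= `|g t|) -> OE c g -> OE c f.
Proof.
move=> h [C H]; exists C; near=> t; apply: (@le_trans _ _ `|g t|); near: t => //.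
Unshelve. all: by end_near. Qed.

Lemma OE_eq c f g : f =1 g -> OE c g -> OE c f.
Proof. by move=> /funext ->. Qed.

Lemma OE_add c f g : OE c f -> OE c g -> OE c (fun t => f t + g t).
Proof.
move=> [C H] [C' H']; exists (C + C'); near=> t.
apply: le_trans (ler_normD _ _) _; rewrite mulrDl.
by apply: lerD; near: t.
Unshelve. all: by end_near. Qed.

Lemma OE_opp c f : OE c f -> OE c (fun t => - f t).
Proof.
by apply: OE_ev; apply: nearW => t; rewrite normrN.
Qed.

Lemma OE_sub c f g : OE c f -> OE c g -> OE c (fun t => f t - g t).
Proof. by move=> hf hg; apply: OE_add => //; exact: OE_opp. Qed.

Lemma OE0 c : OE c (fun=> 0).
Proof. by exists 0; apply: nearW => t; rewrite normr0 mul0r. Qed.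

Lemma OE_mul c d f g : OE c f -> OE d g -> OE (c + d) (fun t => f t * g t).
Proof.
move=> /OEP[C [T [C0 [t0T H]]]] /OEP[C' [T' [C0' [_ H']]]].
exists (C * C'); apply/(iffRL (evP _)); exists (Num.max T T') => t.
rewrite ge_max => /andP[Tt Tt'].
rewrite normrM powRD; last by apply/implyP => _; rewrite gt_eqF // e_gt0 // (le_trans t0T).
have -> : C * C' * (e t `^ c * e t `^ d) = (C * e t `^ c) * (C' * e t `^ d) by ring.
by apply: ler_pM => //; [exact: H|exact: H'].
Qed.

Lemma OE_weak c d f : c <= d -> OE d f -> OE c f.
Proof.
move=> cd /OEP[C [T [C0 [t0T H]]]]; have [T' _ H'] := e_le1.
exists C; apply/(iffRL (evP _)); exists (Num.max T T') => t.
rewrite ge_max => /andP[Tt Tt']; apply: le_trans (H t Tt) _.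
apply: ler_wpM2l => //; apply: ger_powR => //.
by rewrite H' // e_gt0 // (le_trans t0T).
Qed.

Lemma OE_bounded f C T : (forall t, T <= t -> `|f t| <= C) -> OE 0 f.
Proof.
move=> H; exists C; apply/(iffRL (evP _)); exists T => t Tt.
by rewrite powRr0 mulr1 H.
Qed.

Lemma OE_cst (x : R) : OE 0 (fun=> x).
Proof. exact: (@OE_bounded _ `|x| 0). Qed.

Lemma OE_sum (I : eqType) (s : seq I) (F : I -> R -> R) c :
  (forall i, i \in s -> OE c (F i)) -> OE c (fun t => \sum_(i <- s) F i t).
Proof.
elim: s => [|i s IH] h.
  apply: OE_eq (OE0 c); move=> t; exact: big_nil.
apply: (@OE_eq _ _ (fun t => F i t + \sum_(j <- s) F j t)).
  by move=> t; rewrite big_cons.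
apply: OE_add; first by apply: h; rewrite mem_head.
by apply: IH => j js; apply: h; rewrite inE js orbT.
Qed.

Lemma OE_sumT (I : finType) (F : I -> R -> R) c :
  (forall i, OE c (F i)) -> OE c (fun t => \sum_i F i t).
Proof. by move=> h; apply: OE_sum. Qed.

Lemma OE_scale c f (x : R) : OE c f -> OE c (fun t => x * f t).
Proof. by move=> h; rewrite -[c]add0r; apply: OE_mul => //; exact: OE_cst. Qed.

Lemma OE_mul0 c f g : OE c f -> OE 0 g -> OE c (fun t => f t * g t).
Proof. by move=> h h'; rewrite -[c]addr0; exact: OE_mul. Qed.

Lemma OE_to0 c f : 0 < c -> OE c f -> f t @[t --> +oo] --> (0 : R).
Proof.
move=> c0 /OEP[C [T [C0 [t0T H]]]]; apply/cvg_evP => x x0.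
have C1 : 0 < C + 1 by rewrite ltr_wpDl.
pose y := (x / (C + 1)) `^ (c^-1).
have y0 : 0 < y by rewrite powR_gt0 // divr_gt0.
have /cvg_evP/(_ _ y0)[T' H'] := e_to0.
exists (Num.max T T') => t; rewrite ge_max => /andP[Tt Tt'].
have et := e_gt0 (le_trans t0T Tt).
have := H' t Tt'; rewrite sub0r normrN gtr0_norm // => ey.
rewrite sub0r normrN; apply: le_lt_trans (H t Tt) _.
have h : e t `^ c < x / (C + 1).
  have -> : x / (C + 1) = y `^ c.
    by rewrite /y -powRrM mulVf ?gt_eqF // powRr1 // divr_ge0 // ltW.
  by apply: gt0_ltr_powR; rewrite ?nnegrE ?ltW.
apply: (@le_lt_trans _ _ ((C + 1) * e t `^ c)).
  by apply: ler_wpM2r; [exact: powR_ge0|rewrite lerDl].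
by rewrite mulrC -ltr_pdivlMr.
Qed.

Lemma OE_pow c f k : OE c f -> OE (k%:R * c) (fun t => f t ^+ k).
Proof.
move=> h; elim: k => [|k IH].
  by rewrite mul0r; apply: OE_eq (OE_cst 1); move=> t; rewrite expr0.
rewrite -natr1 mulrDl mul1r addrC.
by apply: OE_eq (OE_mul h IH); move=> t; rewrite exprS.
Qed.

Lemma eqO_OE f c : f =O_ (pinfty_nbhs R) (fun t => e t `^ c) -> OE c f.
Proof.
move=> /eqO_exP[C _ H]; exists C; apply: filterS H => t.
by rewrite (ger0_norm (powR_ge0 _ _)).
Qed.

End big_O.

(** * Evaluation of formal series truncated at the rank rho_k *)

Section truncated_evaluation.
Context {R : realType} {m : nat}.
Variables (t0 : R) (eps : 'I_m.+1 -> R -> R) (vr : 'I_m.+1 -> R) (rho : nat -> R) (k : nat).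
Hypothesis vr_gt0 : forall l, 0 < vr l.
Hypothesis vr_mono : forall l l' : 'I_m.+1, (l <= l')%N -> vr l <= vr l'.
Hypothesis rhoP : rank_enum vr rho.
Hypothesis k_ge1 : (1 <= k)%N.
Notation e := (eps ord0).
Hypothesis e_gt0 : forall t, t0 <= t -> 0 < e t.
Hypothesis e_to0 : e t @[t --> +oo] --> (0 : R).
Notation OE := (OE e).
Notation mv := (mval t0 eps).
Notation lv := (lval t0 eps).
Hypothesis lval_OE : forall l r, (r <= p_ord vr rho k l)%N ->
  OE ((vr l + r%:R) / vr ord0) (lv (l, r)).
Implicit Types (nu a b : monomial m).

Definition kappa := rho k.+1 / vr ord0.

Lemma rho_lt s s' : (1 <= s)%N -> (s < s')%N -> rho s < rho s'.
Proof.
move=> s1; elim: s' => // s' IH; rewrite ltnS leq_eqVlt => /predU1P[<-|ss'].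
  by have [H _] := rhoP; exact: H.
by apply: lt_trans (IH ss') _; have [H _] := rhoP; apply: H; exact: leq_trans (ltnW ss').
Qed.

Lemma rank_rho nu : nu != mset0 -> exists2 s, (1 <= s)%N & rank vr nu = rho s.
Proof.
move=> nu0; have [_ /seteqP[_ H]] := rhoP.
by have /= [|s s1 <-] := H (rank vr nu); [by exists nu|exists s].
Qed.

Lemma rho_rank s : (1 <= s)%N -> exists2 nu, nu != mset0 & rank vr nu = rho s.
Proof.
move=> s1; have [_ /seteqP[H _]] := rhoP.
by have /= [|nu nu0 <-] := H (rho s); [by exists s|exists nu].
Qed.

Lemma rho_gt0 s : (1 <= s)%N -> 0 < rho s.
Proof. by move=> /rho_rank[nu nu0 <-]; exact: rank_gt0. Qed.

Lemma rank_next nu : nu != mset0 -> rho k < rank vr nu -> rho k.+1 <= rank vr nu.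
Proof.
move=> /rank_rho[s s1 ->]; rewrite !leNgt => h; apply/negP => h'.
have [sk|ks] := leqP s k.
  move: sk; rewrite leq_eqVlt => /predU1P[E|sk]; first by move: h; rewrite E ltxx.
  by have := lt_trans h (rho_lt s1 sk); rewrite ltxx.
move: ks; rewrite leq_eqVlt => /predU1P[E|ks]; first by move: h'; rewrite -E ltxx.
by have := lt_trans h' (rho_lt (ltn0Sn k) ks); rewrite ltxx.
Qed.

Lemma rank_index nu : nu != mset0 -> rank vr nu <= rho k ->
  exists2 s, (1 <= s <= k)%N & rank vr nu = rho s.
Proof.
move=> /rank_rho[s s1 ->] h; exists s => //; rewrite s1 /= leqNgt; apply/negP => ks.
by have := lt_le_trans (rho_lt k_ge1 ks) h; rewrite ltxx.
Qed.

Lemma kappa_gt0 : 0 < kappa.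
Proof. by rewrite divr_gt0 // rho_gt0. Qed.

(* The monomials of rank at most rho_k, including the empty one. *)
Definition s0 : seq (monomial m) := fset_set [set nu : monomial m | rank vr nu <= rho k].

Lemma mem_s0 nu : (nu \in s0) = (rank vr nu <= rho k).
Proof.
by rewrite in_fset_set ?mem_setE //; apply: finite_rank_le.
Qed.

Lemma s0_uniq : uniq s0.
Proof. exact: fset_uniq. Qed.

Lemma s0_mset0 : mset0 \in s0.
Proof. by rewrite mem_s0 rank0 ltW // rho_gt0. Qed.

(** From vr l + r <= rho_k follows r <= floor(rho_k - vr l), which is p_kl - 1. The strict
    inequality leaves room for the one extra derivative that d nu / dt requires. *)
Lemma letter_lt nu x : nu \in s0 -> x \in nu -> (x.2 < p_ord vr rho k x.1)%N.
Proof.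
rewrite mem_s0 => h xn; have := le_trans (lrank_le vr_gt0 vr_mono xn) h.
rewrite /lrank /p_ord -lerBrDl pmulrn -floor_ge_int => h2.
move: h2; case: (Num.floor _) => // q; rewrite lez_nat => h2.
by rewrite max_r // -PoszD absz_nat addn1 ltnS.
Qed.

Lemma mval_OE nu : (forall x, x \in nu -> (x.2 <= p_ord vr rho k x.1)%N) ->
  OE (rank vr nu / vr ord0) (mv nu).
Proof.
rewrite rankE /mval => h.
have {h} : forall x, x \in enum_mset nu -> (x.2 <= p_ord vr rho k x.1)%N by [].
elim: (enum_mset nu) => [|x s IH] h.
  rewrite big_nil mul0r; apply: OE_eq (OE_cst e 1).
  by move=> t; rewrite big_nil.
rewrite big_cons mulrDl.
apply: (@OE_eq _ _ _ _ (fun t => lv x t * \prod_(y <- s) lv y t)).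
  by move=> t; rewrite big_cons.
apply: (OE_mul e_gt0); last by apply: IH => y ys; apply: h; rewrite inE ys orbT.
case: x h => l r h; apply: lval_OE; exact: (h _ (mem_head _ _)).
Qed.

Lemma mval_s0_OE nu : nu \in s0 -> OE (rank vr nu / vr ord0) (mv nu).
Proof. by move=> ns; apply: mval_OE => x xn; apply/ltnW/(letter_lt ns xn). Qed.

(** Ranks are discrete: a rank above rho_k is at least rho_{k+1}, and this is where the exponent
    kappa comes from. *)
Lemma mval_kappa nu : (forall x, x \in nu -> (x.2 <= p_ord vr rho k x.1)%N) ->
  nu \notin s0 -> OE kappa (mv nu).
Proof.
move=> h ns; apply: (OE_weak e_gt0 e_to0) (mval_OE h).
rewrite /kappa ler_pM2r ?invr_gt0 //; apply: rank_next.
  by apply: contraNN ns => /eqP ->; exact: s0_mset0.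
by move: ns; rewrite mem_s0 -ltNge.
Qed.

Lemma mval_add_kappa a b : a \in s0 -> b \in s0 -> (a `+` b)%mset \notin s0 ->
  OE kappa (mv (a `+` b)%mset).
Proof.
move=> sa sb; apply: mval_kappa => x; rewrite in_msetD => /orP[xa|xb].
  exact/ltnW/(letter_lt sa xa).
exact/ltnW/(letter_lt sb xb).
Qed.

Implicit Types (F G : R -> fseries (R := R) (m := m)).

Definition ev F (t : R) : R := \sum_(nu <- s0) mv nu t * F t nu.

(* The formal series F, truncated at the rank rho_k, represents x up to the order
   of the first neglected rank. *)
Definition approx F (x : R -> R) := [/\ forall nu, nu \in s0 -> OE 0 (fun t => F t nu),
  OE 0 x & OE kappa (fun t => ev F t - x t)].

(** Ranks are nonnegative and additive, so both factors of a monomial in [s0] are in [s0], and the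
    sum over all decompositions becomes a double sum over one finite list. *)
Lemma fmulE (F G : fseries (R := R) (m := m)) nu : nu \in s0 ->
  fmul F G nu = \sum_(a <- s0) \sum_(b <- s0) (if (a `+` b)%mset == nu then F a * G b else 0).
Proof.
move=> ns; rewrite /fmul (fsbigE [seq (a, b) | a <- s0, b <- [seq b <- s0 | (a `+` b)%mset == nu]]).
- rewrite big_mkcond big_allpairs_dep /=; apply: eq_bigr => a _.
  rewrite big_filter [LHS]big_mkcond; apply: eq_bigr => b _.
  by case: eqP => // h; rewrite mem_set.
- by apply: allpairs_uniq_dep => [|a _|[a b] [a' b'] _ _ [-> ->]] //;
    rewrite ?filter_uniq // s0_uniq.
- by move=> [a b] /= /allpairsPdep[a' [b' [_ + [-> ->]]]]; rewrite mem_filter => /andP[/eqP].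
- move=> [a b] /= E /negP[]; apply/allpairsPdep; exists a, b.
  have := rankD vr a b; rewrite E => Er.
  have := rank_ge0 vr_gt0 vr_mono a; have := rank_ge0 vr_gt0 vr_mono b.
  move: ns; rewrite mem_filter E eqxx !mem_s0 Er => h1 h2 h3.
  by split => //; lra.
Qed.

Lemma ev_OE0 F x : approx F x -> OE 0 (ev F).
Proof.
move=> [_ hx h]; apply: (@OE_eq _ _ _ _ (fun t => (ev F t - x t) + x t)).
  by move=> t; rewrite subrK.
by apply: OE_add => //; apply: (OE_weak e_gt0 e_to0) h; rewrite ltW // kappa_gt0.
Qed.

Lemma approx_mul F G x y : approx F x -> approx G y ->
  approx (fun t => fmul (F t) (G t)) (fun t => x t * y t).
Proof.
move=> aF aG; have [F0 x0 Fx] := aF; have [G0 y0 Gy] := aG; split.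
- move=> nu ns.
  apply: (@OE_eq _ _ _ _ (fun t => \sum_(a <- s0) \sum_(b <- s0)
    (if (a `+` b)%mset == nu then F t a * G t b else 0))).
    by move=> t; exact: fmulE.
  apply: OE_sum => a sa; apply: OE_sum => b sb.
  case: ((a `+` b)%mset == nu); last exact: OE0.
  by apply: (OE_mul0 e_gt0); [exact: F0|exact: G0].
- exact: (OE_mul0 e_gt0).
have E1 t : ev (fun t => fmul (F t) (G t)) t = \sum_(a <- s0) \sum_(b <- s0)
    (if (a `+` b)%mset \in s0 then mv (a `+` b)%mset t * (F t a * G t b) else 0).
  rewrite /ev.
  transitivity (\sum_(nu <- s0) \sum_(a <- s0) \sum_(b <- s0)
     (if (a `+` b)%mset == nu then mv nu t * (F t a * G t b) else 0)).
    apply: eq_big_seq => nu ns; rewrite fmulE // big_distrr /=.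
    apply: eq_bigr => a _; rewrite big_distrr /=; apply: eq_bigr => b _.
    by case: eqP => _; rewrite ?mulr0.
  rewrite exchange_big /=; apply: eq_bigr => a _.
  rewrite exchange_big /=; apply: eq_bigr => b _.
  case: ifP => h.
    rewrite (bigD1_seq (a `+` b)%mset) ?s0_uniq //= eqxx big1 ?addr0 // => nu.
    by rewrite eq_sym => /negbTE ->.
  rewrite big_seq big1 // => nu ns; case: eqP => // E; by rewrite E ns in h.
(* Truncating the product loses exactly the products of two retained monomials whose joint rank
   exceeds rho_k. *)
have E2 t : ev (fun t => fmul (F t) (G t)) t - ev F t * ev G t = \sum_(a <- s0) \sum_(b <- s0)
    (if (a `+` b)%mset \in s0 then 0 else - (mv (a `+` b)%mset t * (F t a * G t b))).
  rewrite E1 /ev big_distrlr /= -sumrB; apply: eq_bigr => a _.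
  rewrite -sumrB; apply: eq_bigr => b _; rewrite mvalD.
  by case: ((a `+` b)%mset \in s0); ring.
apply: (@OE_eq _ _ _ _ (fun t => (ev (fun t => fmul (F t) (G t)) t - ev F t * ev G t) +
   ((ev F t - x t) * ev G t + (ev G t - y t) * x t))).
  by move=> t; ring.
apply: OE_add; last first.
  by apply: OE_add; apply: (OE_mul0 e_gt0) => //; exact: ev_OE0 aG.
apply: OE_eq.
  by move=> t; exact: E2.
apply: OE_sum => a sa; apply: OE_sum => b sb.
case: (boolP ((a `+` b)%mset \in s0)) => h; first exact: OE0.
apply: OE_opp; apply: (OE_mul0 e_gt0); first exact: mval_add_kappa.
by apply: (OE_mul0 e_gt0); [exact: F0|exact: G0].
Qed.

Lemma approx_one : approx (fun=> @fone R m) (fun=> 1).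
Proof.
split; first by move=> nu _; exact: OE_cst.
  exact: OE_cst.
apply: OE_eq (OE0 _ _); move=> t.
rewrite /ev (bigD1_seq mset0) ?s0_mset0 ?s0_uniq //= /fone eqxx mulr1 mval0.
by rewrite big1 ?addr0 ?subrr // => nu /negbTE ->; rewrite mulr0.
Qed.

Lemma eps_OE l : OE (vr l / vr ord0) (eps l).
Proof.
have := lval_OE (leq0n (p_ord vr rho k l)).
by rewrite addr0.
Qed.

Lemma eps_OE0 l : OE 0 (eps l).
Proof. by apply: (OE_weak e_gt0 e_to0) (eps_OE l); rewrite divr_ge0 // ltW. Qed.

Lemma approx_letter l : approx (fun=> @fletter R m (l, 0%N)) (eps l).
Proof.
split; first by move=> nu _; exact: OE_cst.
  exact: eps_OE0.
have [ls|ls] := boolP ([mset (l, 0%N)]%mset \in s0).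
  apply: OE_eq (OE0 _ _); move=> t.
  rewrite /ev (bigD1_seq [mset (l, 0%N)]%mset) ?s0_uniq //= /fletter eqxx mulr1 mval1.
  by rewrite big1 ?addr0 ?subrr // => nu /negbTE ->; rewrite mulr0.
(* If the rank of eps_l exceeds rho_k, the truncated letter evaluates to 0 and eps_l itself is of
   the neglected order. *)
apply: (@OE_eq _ _ _ _ (fun t => - mv [mset (l, 0%N)]%mset t)).
  move=> t; rewrite /ev big_seq big1 => [|nu ns].
    by rewrite sub0r mval1.
  by rewrite /fletter; case: eqP => [E|]; rewrite ?mulr0 //; rewrite -E ns in ls.
apply: OE_opp; apply: mval_kappa => // x; rewrite in_mset1 => /eqP -> /=.
exact: leq0n.
Qed.

Lemma approx_prod (I : Type) (s : seq I) (F : I -> R -> fseries (R := R) (m := m)) (x : I -> R -> R) :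
  (forall i, approx (F i) (x i)) ->
  approx (fun t => \big[@fmul R m/@fone R m]_(i <- s) F i t)
    (fun t => \prod_(i <- s) x i t).
Proof.
move=> h; elim: s => [|i s IH].
  have -> : (fun t => \big[@fmul R m/@fone R m]_(i <- [::]) F i t) = fun=> @fone R m.
    by apply/funext => t; rewrite big_nil.
  have -> : (fun t => \prod_(i <- [::]) x i t) = fun=> 1 by apply/funext => t; rewrite big_nil.
  exact: approx_one.
have -> : (fun t => \big[@fmul R m/@fone R m]_(j <- i :: s) F j t) =
   fun t => fmul (F i t) (\big[@fmul R m/@fone R m]_(j <- s) F j t).
  by apply/funext => t; rewrite big_cons.
have -> : (fun t => \prod_(j <- i :: s) x j t) = fun t => x i t * \prod_(j <- s) x j t.
  by apply/funext => t; rewrite big_cons.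
exact: approx_mul.
Qed.

Lemma approx_exp F x d : approx F x -> approx (fun t => fexp (F t) d) (fun t => x t ^+ d).
Proof.
move=> h; elim: d => [|d IH]; first exact: approx_one.
have -> : (fun t => x t ^+ d.+1) = fun t => x t * x t ^+ d by apply/funext => t; rewrite exprS.
exact: approx_mul.
Qed.

(** A lower bound for the valuation of a formal series with respect to the rank. *)
Definition ordge c (F : fseries (R := R) (m := m)) := forall nu, F nu != 0 -> c <= rank vr nu.

Lemma ordge_mul c d (F G : fseries (R := R) (m := m)) :
  ordge c F -> ordge d G -> ordge (c + d) (fmul F G).
Proof.
move=> hF hG nu; rewrite /fmul => h.
have [[a b] /= <- ab] : exists2 ab : monomial m * monomial m, (ab.1 `+` ab.2)%mset = nu &
    F ab.1 * G ab.2 != 0.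
  apply/not_exists2P => H; move/eqP: h; apply; apply: fsbig1 => ab abn.
  by have [//|/negP/negPn/eqP] := H ab.
rewrite rankD; move: ab; rewrite mulf_eq0 negb_or => /andP[a0 b0].
by apply: lerD; [exact: hF|exact: hG].
Qed.

Lemma ordge_one : ordge 0 (@fone R m).
Proof. by move=> nu _; exact: rank_ge0. Qed.

Lemma ordge_letter l : ordge (vr l) (@fletter R m (l, 0%N)).
Proof.
move=> nu; rewrite /fletter; case: (eqVneq nu [mset (l, 0%N)]%mset) => [-> _|_]; last by rewrite eqxx.
by rewrite rank1 /lrank addr0.
Qed.

Lemma ordge_exp c (F : fseries (R := R) (m := m)) d : ordge c F -> ordge (d%:R * c) (fexp F d).
Proof.
move=> h; elim: d => [|d IH]; first by rewrite mul0r; exact: ordge_one.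
by rewrite -natr1 mulrDl mul1r addrC; exact: ordge_mul.
Qed.

Lemma ordge_prod (I : Type) (s : seq I) (F : I -> fseries (R := R) (m := m)) (c : I -> R) :
  (forall i, ordge (c i) (F i)) ->
  ordge (\sum_(i <- s) c i) (\big[@fmul R m/@fone R m]_(i <- s) F i).
Proof.
move=> h; elim: s => [|i s IH]; first by rewrite !big_nil; exact: ordge_one.
by rewrite !big_cons; exact: ordge_mul.
Qed.

End truncated_evaluation.

Section taylor_order.
Context {R : realType} {m : nat}.
Variables (vr : 'I_m.+1 -> R) (rho : nat -> R) (k : nat).

(* The number q_{kl} + 1 of orders of f_l that contribute up to the rank rho_k, or 0
   when q_{kl} is negative. *)
Definition nl (l : 'I_m.+1) : nat := absz (Num.max 0 (q_ord vr rho k l + 1)).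

Lemma nl_le_y l : (nl l <= y_ord vr rho k l)%N.
Proof.
rewrite /nl /y_ord; case: (q_ord vr rho k l) => q.
  by rewrite -PoszD; case: (leP 2 (Posz (q + 1))) => h; rewrite ?max_r //; lia.
have -> : Num.max 0 (Negz q + 1) = 0 by apply: max_l; lia.
by [].
Qed.

Lemma lt_nl l (j : nat) : (j < nl l)%N = (j%:Z <= q_ord vr rho k l).
Proof.
rewrite /nl; case: (q_ord vr rho k l) => q.
  by rewrite -PoszD max_r // absz_nat addn1 ltnS lez_nat.
have -> : Num.max 0 (Negz q + 1) = 0 by apply: max_l; lia.
by [].
Qed.

End taylor_order.

(** * The residual of the asymptotic sum *)

Section residual_estimate.
Context {R : realType} {n m : nat}.
Notation vec := ('cV[R]_n).
Variables (t0 : R) (A : 'M[R]_n) (f phi0 : R -> vec) (a : R).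
Variables (eps : 'I_m.+1 -> R -> R) (fl : 'I_m.+1 -> R * vec -> vec).
Variables (vr : 'I_m.+1 -> R) (rho : nat -> R) (k : nat).
Variable phi : monomial m -> R -> vec.
Notation D := (tube t0 a phi0).
Notation e := (eps ord0).
Notation OE := (OE e).
Notation mv := (mval t0 eps).
Notation lv := (lval t0 eps).
Notation s0 := (s0 vr rho k).
Notation kappa := (kappa vr rho k).
Notation nl := (nl vr rho k).
Notation ev := (ev t0 eps vr rho k).
Hypothesis a_gt0 : 0 < a.
Hypothesis vr_gt0 : forall l, 0 < vr l.
Hypothesis vr_mono : forall l l' : 'I_m.+1, (l <= l')%N -> vr l <= vr l'.
Hypothesis rhoP : rank_enum vr rho.
Hypothesis k_ge1 : (1 <= k)%N.
Hypothesis e_gt0 : forall t, t0 <= t -> 0 < e t.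
Hypothesis e_to0 : e t @[t --> +oo] --> (0 : R).
Hypothesis lval_OE : forall l r, (r <= p_ord vr rho k l)%N ->
  OE ((vr l + r%:R) / vr ord0) (lv (l, r)).
Hypothesis phi0_sol : solves t0 (fun t x => A *m x + f t) phi0.
Hypothesis H1_C : forall l, Cn_on t0 (p_ord vr rho k l) (eps l).
Hypothesis H2 : forall l, C0q D (y_ord vr rho k l) (fl l).
Hypothesis H3 : forall l (w : mindex n), (mabs w <= y_ord vr rho k l)%N ->
     bounded_on D (mpartial D w (fl l)).
Hypothesis phi_bound : forall nu : monomial m, nu != mset0 -> nu \in s0 ->
  exists C, forall t, t0 <= t -> `|phi nu t| <= C.
Hypothesis phi_sol : forall nu : monomial m, nu != mset0 -> nu \in s0 ->
  solves t0 (fun t x => A *m x + g_coef t0 phi0 a fl phi nu t) (phi nu).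

Implicit Types (nu : monomial m) (w : mindex n) (t : R).

Definition s1 : seq (monomial m) := [seq nu <- s0 | nu != mset0].

Lemma mem_s1 nu : (nu \in s1) = (nu != mset0) && (nu \in s0).
Proof. by rewrite mem_filter. Qed.

Lemma s1_uniq : uniq s1.
Proof. by rewrite filter_uniq // s0_uniq. Qed.

Definition delta (t : R) : vec := \sum_(nu <- s1) mv nu t *: phi nu t.

Lemma sum_products (V : nmodType) (G : monomial m -> V) s : (1 <= s <= k)%N ->
  \sum_(nu \in products vr (rho s)) G nu = \sum_(nu <- s1) if rank vr nu == rho s then G nu else 0.
Proof.
move=> /andP[sg1 sk]; rewrite (fsbigE [seq nu <- s1 | rank vr nu == rho s]).
- rewrite big_filter_cond big_mkcond /=; apply: eq_big_seq => nu.
  by rewrite mem_s1 => /andP[nu0 _]; case: eqP => //= E; rewrite mem_set.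
- by rewrite filter_uniq // s1_uniq.
- by move=> nu /=; rewrite mem_filter mem_s1 => /andP[/eqP h /andP[h' _]].
- move=> nu [h E]; rewrite mem_filter E eqxx mem_s1 h mem_s0 // E /=.
  move=> /negP[]; move: sk; rewrite leq_eqVlt => /predU1P[->//|sk].
  by apply/ltW; exact: (rho_lt rhoP sg1 sk).
Qed.

(** The rank of a monomial determines its index s, so the double sum meets every element of [s1]
    exactly once. *)
Lemma asym_sumE t : asym_sum t0 phi0 eps vr rho k phi t = phi0 t + delta t.
Proof.
rewrite /asym_sum; congr (_ + _).
transitivity (\sum_(1 <= s < k.+1) \sum_(nu <- s1)
   if rank vr nu == rho s then mv nu t *: phi nu t else 0).
  by apply: eq_big_nat => s; rewrite ltnS => sk; exact: sum_products.
rewrite exchange_big /=; apply: eq_big_seq => nu; rewrite mem_s1 => /andP[nu0 ns].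
rewrite mem_s0 // in ns; have [s /andP[sg1 sk] E] := rank_index rhoP k_ge1 nu0 ns.
rewrite (bigD1_seq s) ?iota_uniq //=; last by rewrite mem_index_iota sg1.
rewrite E eqxx big_seq_cond big1 ?addr0 // => s'.
rewrite mem_index_iota => /andP[/andP[s'1 _] ss']; case: eqP => // h.
move: ss'; case: (ltngtP s' s) => // h' _.
  by have := rho_lt rhoP s'1 h'; rewrite h ltxx.
by have := rho_lt rhoP sg1 h'; rewrite h ltxx.
Qed.

Lemma mval_is_derive nu t : nu \in s0 -> t0 < t ->
  is_derive t (1:R) (mv nu) (\sum_(x <- nu) mv (dmono nu x) t).
Proof.
move=> ns tt; apply: mval_derive => // -[l r] xn.
have rp := letter_lt vr_gt0 vr_mono ns xn.
have [v hv] := (H1_C l).1 r rp t (ltW tt).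
have := has_deriv_is_derive tt hv.
by rewrite /lval /= (has_deriv_unique (ltW tt) hv).
Qed.

(** The derivative of the asymptotic sum with the differential equations of phi0 and of the
    coefficients already substituted. *)
Definition dasym (t : R) : vec := A *m phi0 t + f t + \sum_(nu <- s1)
  ((\sum_(x <- nu) mv (dmono nu x) t) *: phi nu t +
   mv nu t *: (A *m phi nu t + g_coef t0 phi0 a fl phi nu t)).

Lemma asym_is_derive t i : t0 < t ->
  is_derive t (1:R) (fun u => asym_sum t0 phi0 eps vr rho k phi u i 0) (dasym t i 0).
Proof.
move=> tt.
have -> : (fun u => asym_sum t0 phi0 eps vr rho k phi u i 0) =
   (fun u => phi0 u i 0 + \sum_(nu <- s1) mv nu u * phi nu u i 0).
  apply/funext => u; rewrite asym_sumE mxE; congr (_ + _).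
  by rewrite /delta summxE; apply: eq_bigr => nu _; rewrite mxE.
rewrite /dasym mxE summxE; apply: dD.
  by apply: (has_deriv_is_derive tt); have /has_deriv_coord := phi0_sol (ltW tt); apply.
rewrite big_seq [X in is_derive _ _ X]( _ : _ = fun u => \sum_(nu <- s1 | nu \in s1) mv nu u * phi nu u i 0); last first.
  by apply/funext => u; rewrite big_seq.
apply: dsum => nu; rewrite mem_s1 => /andP[nu0 ns].
rewrite !mxE; apply: dM; first exact: mval_is_derive.
apply: (has_deriv_is_derive tt).
by have /has_deriv_coord/(_ i 0) := phi_sol nu0 ns (ltW tt); rewrite !mxE.
Qed.

Lemma asym_deriv_on t : t0 < t ->
  deriv_on t0 (asym_sum t0 phi0 eps vr rho k phi) t = dasym t.
Proof.
move=> tt; apply: has_deriv_unique (ltW tt) _.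
apply/has_deriv_coord => i j; rewrite ord1.
exact/is_derive_has_deriv/asym_is_derive.
Qed.

Lemma nl_small l (j : nat) : vr l + j%:R * vr ord0 <= rho k -> (j < nl l)%N.
Proof.
move=> h; rewrite lt_nl /q_ord floor_ge_int -pmulrn ler_pdivlMr //.
by rewrite lerBrDl.
Qed.

(** The monomial made of eps_l and [nl l] factors eps_1 has rank above rho_k, hence at least
    rho_{k+1}. *)
Lemma nl_kappa l : kappa <= vr l / vr ord0 + (nl l)%:R.
Proof.
rewrite /kappa -[(nl l)%:R](mulfK (lt0r_neq0 (vr_gt0 ord0))) -mulrDl.
rewrite ler_pM2r ?invr_gt0 //.
pose nu : monomial m := ([mset (l, 0%N)] `+` msetn (nl l) (ord0, 0%N))%mset.
have E : rank vr nu = vr l + (nl l)%:R * vr ord0.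
  rewrite rankD rank1 /lrank addr0; congr (_ + _).
  rewrite rankE enum_msetn big_nseq.
  by elim: (nl l) => [|q /= ->]; rewrite ?mul0r // -natr1 mulrDl mul1r addrC /lrank addr0.
rewrite -E; apply: rank_next => //.
  apply/eqP => /msetP/(_ (l, 0%N)).
  by rewrite msetE2 msetnxx mset0E.
rewrite ltNge E; apply/negP => /nl_small; by rewrite ltnn.
Qed.

(** delta~ has no terms of rank below vr_1, so each further factor raises the lowest rank by at
    least vr_1. *)
Lemma fdelta_pow_ordge t w : ordge vr ((mabs w)%:R * vr ord0) (fdelta_pow phi t w).
Proof.
rewrite /fdelta_pow /mabs natr_sum big_distrl /=; apply: ordge_prod => // j.
apply: ordge_exp => // nu; rewrite /fdelta; case: (eqVneq nu mset0) => [_|nu0 _].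
  by rewrite eqxx.
exact: rank_ge.
Qed.

Definition lpow l t w : fseries (R := R) (m := m) :=
  fmul (fletter (l, 0%N)) (fdelta_pow phi t w).

Lemma lpow_ordge l t w : ordge vr (vr l + (mabs w)%:R * vr ord0) (lpow l t w).
Proof. by apply: ordge_mul; [exact: ordge_letter|exact: fdelta_pow_ordge]. Qed.

Lemma lpow_mset0 l t w : lpow l t w mset0 = 0.
Proof.
apply/eqP; apply: contraT => /lpow_ordge; rewrite rank0 leNgt.
by rewrite ltr_wpDr // mulr_ge0 // ltW.
Qed.

Lemma lpow_large l t w nu : nu \in s0 -> (nl l <= mabs w)%N -> lpow l t w nu = 0.
Proof.
rewrite mem_s0 // => ns h; apply/eqP; apply: contraT => /lpow_ordge h'.
by have := nl_small (le_trans h' ns); rewrite ltnNge h.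
Qed.

(** Differentiation raises the rank by 1, so only monomials of smaller rank feed the first sum; in
    the second, a multi-index with |w| >= [nl l] pushes the rank above rho_k. Both sums are
    therefore finite. *)
Lemma g_coefE nu t : nu \in s1 -> g_coef t0 phi0 a fl phi nu t =
  - (\sum_(nu' <- s1) (deriv_coef nu' nu)%:R *: phi nu' t) +
  \sum_l \sum_(w <- mlist (nl l)) ((mfact w)%:R^-1 * lpow l t w nu) *:
     mpartial D w (fl l) (t, phi0 t).
Proof.
rewrite mem_s1 => /andP[nu0 ns]; rewrite /g_coef; congr (- _ + _).
  rewrite (fsbigE s1).
  - rewrite big_seq_cond [RHS]big_seq; apply: eq_bigl => nu'.
    case: (boolP (nu' \in s1)) => // h; rewrite andTb mem_set //=.
    by move: h; rewrite mem_s1 => /andP[].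
  - exact: s1_uniq.
  - by move=> nu' /=; rewrite mem_s1 => /andP[].
  - move=> nu' /= nu'0; rewrite mem_s1 nu'0 /= => h.
    have [->|/deriv_coef_rank E] := eqVneq (deriv_coef nu' nu) 0%N; first by rewrite scale0r.
    case/negP: h; move: ns; rewrite !mem_s0 // (E _ vr) => ns; apply: le_trans ns.
    by rewrite lerDl.
apply: eq_bigr => l _; rewrite (fsbigE (mlist (nl l))).
- rewrite big_seq_cond [RHS]big_seq; apply: eq_bigl => w.
  by rewrite mem_set // andbT.
- exact: mlist_uniq.
- by [].
- move=> w _; rewrite mem_mlist -leqNgt => h.
  by rewrite -/(lpow l t w) lpow_large // mulr0 scale0r.
Qed.

Lemma sum_g_coef t : \sum_(nu <- s1) mv nu t *: g_coef t0 phi0 a fl phi nu t =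
  - (\sum_(nu' <- s1) (\sum_(x <- nu') if dmono nu' x \in s0 then mv (dmono nu' x) t else 0) *: phi nu' t) +
  \sum_l \sum_(w <- mlist (nl l)) ((mfact w)%:R^-1 * ev (fun t => lpow l t w) t) *:
     mpartial D w (fl l) (t, phi0 t).
Proof.
transitivity (\sum_(nu <- s1) (- (\sum_(nu' <- s1) (mv nu t * (deriv_coef nu' nu)%:R) *: phi nu' t) +
  \sum_l \sum_(w <- mlist (nl l)) ((mfact w)%:R^-1 * (mv nu t * lpow l t w nu)) *:
     mpartial D w (fl l) (t, phi0 t))).
  apply: eq_big_seq => nu ns; rewrite g_coefE // scalerDr scalerN; congr (- _ + _).
    by rewrite scaler_sumr; apply: eq_bigr => nu' _; rewrite scalerA.
  rewrite scaler_sumr; apply: eq_bigr => l _; rewrite scaler_sumr; apply: eq_bigr => w _.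
  by rewrite scalerA mulrCA.
rewrite big_split /= sumrN; congr (- _ + _).
  rewrite exchange_big /=; apply: eq_bigr => nu' _; rewrite -scaler_suml; congr (_ *: _).
  transitivity (\sum_(nu <- s1) \sum_(x <- nu') if nu == dmono nu' x then mv nu t else 0).
    apply: eq_bigr => nu _; rewrite deriv_coefE natr_sum big_distrr /=.
    by apply: eq_bigr => x _; case: eqP => _; rewrite ?mulr1 ?mulr0.
  rewrite exchange_big /=; apply: eq_bigr => x _.
  case: (boolP (dmono nu' x \in s0)) => h.
    rewrite (bigD1_seq (dmono nu' x)) ?s1_uniq ?mem_s1 ?h ?dmono_neq0 //= eqxx.
    rewrite big1; first exact: addr0.
    by move=> nu nx; rewrite ifN.
  rewrite big_seq big1; first by [].
  move=> nu; rewrite mem_s1 => /andP[_ ns]; rewrite ifN //.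
  by apply: contraNN h => /eqP <-.
rewrite exchange_big /=; apply: eq_bigr => l _.
rewrite exchange_big /=; apply: eq_bigr => w _.
rewrite -scaler_suml -big_distrr /=; congr (_ * _ *: _).
rewrite /s1 big_filter big_mkcond /ev; apply: eq_bigr => nu _.
by case: eqP => //= ->; rewrite lpow_mset0 mulr0.
Qed.

(** The equations of the coefficients cancel everything up to the rank rho_k. Three sources of error
    remain: derivatives of monomials that leave [s0], the truncation of formal products, and the
    Taylor remainders of the f_l. *)
Lemma residualE t : t0 < t -> residual t0 A f phi0 eps fl vr rho k phi t =
  - (\sum_(nu <- s1) (\sum_(x <- nu) if dmono nu x \in s0 then 0 else mv (dmono nu x) t) *: phi nu t)
  - (\sum_l \sum_(w <- mlist (nl l))
      ((mfact w)%:R^-1 * (ev (fun t => lpow l t w) t - eps l t * \prod_j delta t j 0 ^+ w j)) *: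
        mpartial D w (fl l) (t, phi0 t))
  + \sum_l eps l t *: (fl l (t, phi0 t + delta t) -
      \sum_(w <- mlist (nl l)) mcoef (delta t) w *: mpartial D w (fl l) (t, phi0 t)).
Proof.
move=> tt; rewrite /residual asym_deriv_on // /rhs asym_sumE /dasym.
rewrite big_split /=.
under [X in - (_ + (_ + X))]eq_bigr do rewrite scalerDr.
rewrite big_split /= sum_g_coef.
have -> : A *m (phi0 t + delta t) = A *m phi0 t + \sum_(nu <- s1) mv nu t *: (A *m phi nu t).
  by rewrite mulmxDr mulmx_sumr; congr (_ + _); apply: eq_bigr => nu _; rewrite scalemxAr.
set AS := \sum_(nu <- s1) mv nu t *: (A *m phi nu t).
set Df := \sum_(nu <- s1) (\sum_(x <- nu) mv (dmono nu x) t) *: phi nu t.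
set D1 := \sum_(nu' <- s1) (\sum_(x <- nu') if _ then _ else 0) *: _.
set D2 := \sum_(nu <- s1) _.
have -> : Df = D1 + D2.
  rewrite -big_split /=; apply: eq_bigr => nu _; rewrite -scalerDl -big_split /=; congr (_ *: _).
  by apply: eq_bigr => x _; case: ifP => _; rewrite ?addr0 ?add0r.
set E1 := \sum_l \sum_(w <- mlist (nl l)) ((mfact w)%:R^-1 * ev _ t) *: _.
set E2 := \sum_l \sum_(w <- mlist (nl l)) ((mfact w)%:R^-1 * (_ - _)) *: _.
set E3 := \sum_l eps l t *: (_ - _).
set G := \sum_l eps l t *: fl l _.
have -> : G = E1 - E2 + E3.
  rewrite /G /E1 /E2 /E3 -sumrB -big_split /=; apply: eq_bigr => l _.
  rewrite scalerBr -sumrB scaler_sumr.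
  set X := eps l t *: _; rewrite [RHS]addrC -[LHS](subrK X) subrr add0r -addrA -[LHS]addr0.
  congr (_ + _); rewrite -sumrN -big_split /= big1 // => w _.
  rewrite scalerA -scalerBl -scaleNr -scalerDl -[RHS](scale0r (mpartial D w (fl l) (t, phi0 t))).
  by congr (_ *: _); rewrite /mcoef; ring.
by apply/matrixP => i j; rewrite !mxE; ring.
Qed.


Lemma OE_abs c (x : R -> R) : OE c x -> OE c (fun t => `|x t|).
Proof. by apply: OE_ev; apply: nearW => t; rewrite normr_id. Qed.

Lemma OE_norm c (v : R -> vec) : (forall i, OE c (fun t => v t i 0)) -> OE c (fun t => `|v t|).
Proof.
move=> h; apply: (@OE_ev _ _ _ _ (fun t => \sum_i `|v t i 0|)); last first.
  by apply: OE_sumT => i; exact: OE_abs.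
apply: nearW => t.
rewrite normr_id ger0_norm ?sumr_ge0 //; apply/mx_norm_leP => [|i j]; first by rewrite sumr_ge0.
by rewrite ord1 (bigD1 i) //= lerDl sumr_ge0.
Qed.

Lemma phi_OE nu i : nu \in s1 -> OE 0 (fun t => phi nu t i 0).
Proof.
rewrite mem_s1 => /andP[nu0 ns]; have [C hC] := phi_bound nu0 ns.
apply: (@OE_bounded _ _ _ C t0) => t Tt.
by apply: le_trans (mx_norm_coord _ _ _) (hC t Tt).
Qed.

Lemma delta_OE i : OE 1 (fun t => delta t i 0).
Proof.
apply: (@OE_eq _ _ _ _ (fun t => \sum_(nu <- s1) mv nu t * phi nu t i 0)).
  by move=> t; rewrite /delta summxE; apply: eq_bigr => nu _; rewrite mxE.
apply: OE_sum => nu ns; apply: (OE_mul0 e_gt0); last exact: phi_OE.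
move: ns; rewrite mem_s1 => /andP[nu0 ns].
apply: (OE_weak e_gt0 e_to0) (mval_s0_OE vr_gt0 vr_mono e_gt0 lval_OE ns).
by rewrite ler_pdivlMr // mul1r; exact: rank_ge.
Qed.

Lemma delta_norm_OE : OE 1 (fun t => `|delta t|).
Proof. by apply: OE_norm => i; exact: delta_OE. Qed.

Lemma delta_small c : 0 < c -> exists2 T, t0 <= T & forall t, T <= t -> `|delta t| <= c.
Proof.
move=> c0; have /cvg_evP/(_ c c0)[T H] := OE_to0 e_gt0 e_to0 ltr01 delta_norm_OE.
exists (Num.max t0 T); first by rewrite le_max lexx.
move=> t; rewrite ge_max => /andP[_ Tt]; have := H t Tt.
by rewrite sub0r normrN normr_id => /ltW.
Qed.

Lemma approx_delta j : approx t0 eps vr rho k (fun t => fdelta phi t j) (fun t => delta t j 0).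
Proof.
split.
- move=> nu ns; rewrite /fdelta; case: (eqVneq nu mset0) => nu0; first exact: OE0.
  by apply: phi_OE; rewrite mem_s1 nu0.
- by apply: (OE_weak e_gt0 e_to0) (delta_OE j); exact: ler01.
apply: OE_eq (OE0 _ _); move=> t.
rewrite /delta summxE /s1 big_filter [X in _ - X]big_mkcond /ev -sumrB big1 // => nu _.
by rewrite /fdelta; case: eqP => //= _; rewrite ?mulr0 ?subrr // mxE subrr.
Qed.

Lemma approx_lpow l w : approx t0 eps vr rho k (fun t => lpow l t w)
  (fun t => eps l t * \prod_j delta t j 0 ^+ w j).
Proof.
apply: approx_mul => //; first exact: approx_letter.
by apply: approx_prod => // j; apply: approx_exp => //; exact: approx_delta.
Qed.

Lemma mpartial_OE l w i : (mabs w < nl l)%N ->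
  OE 0 (fun t => mpartial D w (fl l) (t, phi0 t) i 0).
Proof.
move=> h; have [|C hC] := H3 (l := l) (w := w).
  by apply: leq_trans (nl_le_y vr rho k l); exact: ltnW.
apply: (@OE_bounded _ _ _ C t0) => t Tt; apply: le_trans (mx_norm_coord _ _ _) _.
apply: hC; split => //=; rewrite subrr normr0; exact: ltW.
Qed.

(** eps_l contributes the exponent vr l / vr_1 and the Taylor remainder the exponent [nl l];
    [nl_kappa] says that together they reach kappa. *)
Lemma taylor_OE l : OE kappa (fun t => `|eps l t *: (fl l (t, phi0 t + delta t) -
      \sum_(w <- mlist (nl l)) mcoef (delta t) w *: mpartial D w (fl l) (t, phi0 t))|).
Proof.
have [C C0 HC] := bounded_sorted (H3 (l := l)).
have BC : forall js, sorted (@ord_leq n) js -> (size js <= nl l)%N ->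
    forall z, D z -> `|partials D js (fl l) z| <= C.
  by move=> js sjs h; apply: HC => //; exact: leq_trans (nl_le_y vr rho k l).
have [T t0T HT] := delta_small a_gt0.
apply: (OE_weak e_gt0 e_to0) (nl_kappa l) _.
pose K : R := (n%:R * (#|{: {ffun 'I_n -> 'I_(nl l).+1}}|%:R) + 1) * C.
apply: (@OE_ev _ _ _ _ (fun t => eps l t * (K * `|delta t| ^+ nl l))); last first.
  apply: (OE_mul e_gt0); first exact: (eps_OE lval_OE).
  apply: (OE_scale e_gt0); rewrite -[(nl l)%:R]mulr1.
  exact: (OE_pow e_gt0 _ delta_norm_OE).
apply/(iffRL (evP _)); exists T => t Tt.
rewrite normr_id normrZ normrM; apply: ler_wpM2l => //.
apply: le_trans (ler_norm _); rewrite /K -mulrA.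
apply: (multi_taylor a_gt0 (H2 l) (nl_le_y vr rho k l) BC C0).
  by split => /=; [exact: le_trans Tt|rewrite subrr normr0 ltW].
by split => /=; [exact: le_trans Tt|rewrite addrC addKr HT].
Qed.

Lemma residual_OE : OE kappa (fun t => `|residual t0 A f phi0 eps fl vr rho k phi t|).
Proof.
apply: OE_norm => i.
apply: OE_ev.
  apply/(iffRL (evP _)); exists (t0 + 1) => t Tt.
  rewrite residualE; last by apply: lt_le_trans Tt; rewrite ltrDl.
  by rewrite !mxE; exact: lexx.
apply: OE_add; [apply: OE_sub; [apply: OE_opp|]|].
- apply: OE_eq; first by move=> t; rewrite summxE; reflexivity.
  apply: OE_sum => nu ns; apply: OE_eq; first by move=> t; rewrite mxE; reflexivity.
  apply: (OE_mul0 e_gt0); last exact: phi_OE.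
  apply: OE_sum => x xn; case: (boolP (dmono nu x \in s0)) => h; first exact: OE0.
  apply: mval_kappa => // y; rewrite /dmono in_msetD => /orP[yn|].
    have yn' : y \in (nu : monomial m) by move: yn; rewrite in_msetB1 => /andP[].
    move: ns; rewrite mem_s1 => /andP[_ ns].
    exact/ltnW/(letter_lt vr_gt0 vr_mono ns yn').
  rewrite in_mset1 => /eqP -> /=; move: ns; rewrite mem_s1 => /andP[_ ns].
  exact: (letter_lt vr_gt0 vr_mono ns xn).
- apply: OE_eq; first by move=> t; rewrite summxE; reflexivity.
  apply: OE_sumT => l; apply: OE_eq; first by move=> t; rewrite summxE; reflexivity.
  apply: OE_sum => w; rewrite mem_mlist => wl.
  apply: OE_eq; first by move=> t; rewrite mxE; reflexivity.
  apply: (OE_mul0 e_gt0); last exact: mpartial_OE.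
  apply: (OE_scale e_gt0).
  by have [_ _] := approx_lpow l w.
- apply: OE_eq; first by move=> t; rewrite summxE; reflexivity.
  apply: OE_sumT => l; apply: OE_ev (taylor_OE l).
  apply: nearW => t; rewrite normr_id; exact: mx_norm_coord.
Qed.

End residual_estimate.

(** * Existence of the coefficients *)

Section distinct_eigenvalues.
Context {C : fieldType} {n : nat}.
Variables (A : 'M[C]_n) (lam : 'I_n -> C).

(** The rows of P are left eigenvectors, one for each lam j; they are independent because
    eigenspaces of distinct eigenvalues form a direct sum. *)
Lemma diagonalize_distinct : char_poly A = \prod_j ('X - (lam j)%:P) -> injective lam ->
  exists2 P : 'M[C]_n, P \in unitmx & P *m A = diag_mx (\row_j lam j) *m P.
Proof.
move=> cA lam_inj.
have /choice[v vP] (j : 'I_n) : exists v : 'rV[C]_n, v *m A = lam j *: v /\ v != 0.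
  have : eigenvalue A (lam j).
    rewrite eigenvalue_root_char cA rootE horner_prod (bigD1 j) //=.
    by rewrite hornerXsubC subrr mul0r.
  by move=> /eigenvalueP[v h1 h2]; exists v.
exists (\matrix_j v j); last first.
  apply/row_matrixP => j; rewrite row_mul rowK (vP j).1 row_mul.
  by rewrite row_diag_mx -scalemxAl -rowE mxE rowK.
rewrite -row_free_unit; apply/row_freeP.
suff : row_free (\matrix_j v j) by move/row_freeP.
rewrite -kermx_eq0; apply/rowV0P => u; rewrite sub_kermx => /eqP uP.
have inj : {in xpredT &, injective lam} by move=> i j _ _; exact: lam_inj.
have /mxdirect_sumsP dx := mxdirect_sum_eigenspace A inj.
have us : \sum_j u 0 j *: v j = 0.
  apply: etrans uP; apply/rowP => i; rewrite summxE [RHS]mxE; apply: eq_bigr => j _.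
  by rewrite !mxE.
apply/rowP => j; rewrite mxE.
have : (u 0 j *: v j <= eigenspace A (lam j) :&: \sum_(i | i != j) eigenspace A (lam i))%MS.
  rewrite sub_capmx; apply/andP; split.
    by apply: scalemx_sub; apply/eigenspaceP; exact: (vP j).1.
  move: us; rewrite (bigD1 j) //= => /eqP; rewrite addr_eq0 => /eqP ->.
  rewrite eqmx_opp; apply: summx_sub => i ij; apply: scalemx_sub.
  apply: (@submx_trans _ _ _ _ _ _ (eigenspace A (lam i))).
    by apply/eigenspaceP; exact: (vP i).1.
  exact: (sumsmx_sup i).
rewrite (dx j isT) submx0 scaler_eq0 => /orP[/eqP //|].
by rewrite (negbTE (vP j).2).
Qed.

End distinct_eigenvalues.

(** * Linear equations with constant coefficients inside the class K *)

Section class_K3.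
Context {R : realType} {n : nat}.
Notation vec := ('cV[R]_n).
Variables (t0 : R) (lam : 'I_n -> R[i]) (K : set (R -> R)).
Hypothesis K3 : is_K3 t0 lam K.
Implicit Types (u v g : R -> R).

Lemma K_eq u v : u =1 v -> K u -> K v.
Proof. by move=> uv; apply: (K3_ext K3) => t _. Qed.

Lemma K_0 : K (fun=> 0).
Proof.
have [g Kg] := K3_nonempty K3.
by apply: K_eq (K3_scale K3 0 Kg) => t; rewrite mul0r.
Qed.

Lemma K_sum (I : eqType) (s : seq I) (F : I -> R -> R) :
  (forall i, i \in s -> K (F i)) -> K (fun t => \sum_(i <- s) F i t).
Proof.
elim: s => [|i s IH] h; first by apply: K_eq K_0 => t; rewrite big_nil.
apply: (@K_eq (fun t => F i t + \sum_(j <- s) F j t)) => [t|]; first by rewrite big_cons.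
apply: (K3_add K3); first by apply: h; rewrite mem_head.
by apply: IH => j js; apply: h; rewrite inE js orbT.
Qed.

(* The unit may fail to belong to K; its multipliers form a unital algebra. *)
Definition Kmul u := forall g, K g -> K (fun t => u t * g t).

Lemma Kmul_cst (c : R) : Kmul (fun=> c).
Proof. by move=> g; exact: (K3_scale K3). Qed.

Lemma Kmul_K u : K u -> Kmul u.
Proof. by move=> Ku g; exact: (K3_mul K3). Qed.

Lemma Kmul_mul u v : Kmul u -> Kmul v -> Kmul (fun t => u t * v t).
Proof.
move=> hu hv g Kg; apply: K_eq (hu _ (hv _ Kg)) => t; exact: mulrA.
Qed.

Lemma Kmul_eq u v : u =1 v -> Kmul u -> Kmul v.
Proof. by move=> uv hu g Kg; apply: K_eq (hu _ Kg) => t; rewrite uv. Qed.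

Lemma Kmul_sum (I : eqType) (s : seq I) (F : I -> R -> R) :
  (forall i, i \in s -> Kmul (F i)) -> Kmul (fun t => \sum_(i <- s) F i t).
Proof.
move=> h g Kg; apply: (@K_eq (fun t => \sum_(i <- s) F i t * g t)) => [t|].
  by rewrite big_distrl.
by apply: K_sum => i si; exact: h.
Qed.

Variable A : 'M[R]_n.
Hypothesis lamA : eigenvalues_of A lam.
Hypothesis H8 : ~ Delta lam 0.

Lemma lam_inj : injective lam.
Proof.
move=> i j ij; apply/eqP; apply: contra_notT H8 => h.
by exists i, j; split => //; rewrite ij subrr.
Qed.

Lemma has_derivD T (u v : R -> R) t x y : has_deriv T u t x -> has_deriv T v t y ->
  has_deriv T (fun s => u s + v s) t (x + y).
Proof.
rewrite /has_deriv => hu hv.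
have -> : diffquot (fun s => u s + v s) t = (fun s => diffquot u t s + diffquot v t s).
  by apply/funext => s; rewrite /diffquot -scalerDr; congr (_ *: _); ring.
exact: cvgD.
Qed.

Lemma has_derivZ T (u : R -> R) t x (c : R) : has_deriv T u t x ->
  has_deriv T (fun s => c * u s) t (c * x).
Proof.
rewrite /has_deriv => hu.
have -> : diffquot (fun s => c * u s) t = (fun s => c * diffquot u t s).
  by apply/funext => s; rewrite /diffquot /GRing.scale /=; ring.
exact: cvgMr.
Qed.

Lemma has_deriv_sum (I : Type) (s : seq I) T (F : I -> R -> R) t (x : I -> R) :
  (forall i, has_deriv T (F i) t (x i)) ->
  has_deriv T (fun r : R => \sum_(i <- s) F i r) t (\sum_(i <- s) x i).
Proof.
move=> h; elim: s => [|i s IH].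
  rewrite big_nil; have -> : (fun r : R => \sum_(i <- [::]) F i r) = cst 0.
    by apply/funext => r; rewrite big_nil.
  by apply: is_derive_has_deriv; exact: is_derive_cst.
rewrite big_cons; have -> : (fun r : R => \sum_(j <- i :: s) F j r) = fun r : R => F i r + \sum_(j <- s) F j r.
  by apply/funext => r; rewrite big_cons.
exact: has_derivD.
Qed.

Lemma complex_ReM (x y : R[i]) : complex.Re (x * y) = complex.Re x * complex.Re y - complex.Im x * complex.Im y.
Proof. by case: x y => a b [c d]. Qed.

Lemma complex_ReD (x y : R[i]) : complex.Re (x + y) = complex.Re x + complex.Re y.
Proof. by case: x y => a b [c d]. Qed.

Lemma complex_ImM (x y : R[i]) : complex.Im (x * y) = complex.Re x * complex.Im y + complex.Im x * complex.Re y.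
Proof. by case: x y => a b [c d]. Qed.

Lemma complex_ImD (x y : R[i]) : complex.Im (x + y) = complex.Im x + complex.Im y.
Proof. by case: x y => a b [c d]. Qed.

Lemma complex_Re_sum (I : Type) (s : seq I) (P : pred I) (F : I -> R[i]) :
  complex.Re (\sum_(i <- s | P i) F i) = \sum_(i <- s | P i) complex.Re (F i).
Proof. by apply: (big_morph (@complex.Re R)) => //; exact: complex_ReD. Qed.

Lemma complex_Im_sum (I : Type) (s : seq I) (P : pred I) (F : I -> R[i]) :
  complex.Im (\sum_(i <- s | P i) F i) = \sum_(i <- s | P i) complex.Im (F i).
Proof. by apply: (big_morph (@complex.Im R)) => //; exact: complex_ImD. Qed.

(** In the coordinates given by P the system splits into scalar equations with the coefficients lam
    j, and each has a solution in K by [K3_solution]. *)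
Lemma linear_solution (h : R -> vec) : K3v K h ->
  exists x : R -> vec, [/\ K3v K x, Cn_on t0 1 x & solves t0 (fun t x => A *m x + h t) x].
Proof.
move=> Kh.
have [P Pu PA] := diagonalize_distinct lamA lam_inj.
pose rc := real_complex R.
pose hh j t : R[i] := \sum_i P j i * (h t i 0)%:C.
have Re_hh j : K (@complex.Re R \o hh j).
  apply: (@K_eq (fun t => \sum_i complex.Re (P j i) * h t i 0)) => [t|].
    by rewrite /= /hh complex_Re_sum; apply: eq_bigr => i _; rewrite complex_ReM /= mulr0 subr0.
  by apply: K_sum => i _; apply: (K3_scale K3); exact: Kh.
have Im_hh j : K (@complex.Im R \o hh j).
  apply: (@K_eq (fun t => \sum_i complex.Im (P j i) * h t i 0)) => [t|].
    by rewrite /= /hh complex_Im_sum; apply: eq_bigr => i _; rewrite complex_ImM /= mulr0 add0r.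
  by apply: K_sum => i _; apply: (K3_scale K3); exact: Kh.
have /choice[y yP] (j : 'I_n) := K3_solution K3 (Re_hh j) (Im_hh j)
  (or_introl (ex_intro2 _ _ j I erefl) : (Lambda lam `|` Delta lam) (lam j)).
pose Pi := invmx P.
(* Returning from the eigencoordinates gives a complex solution of a real equation; its real part is
   again a solution. *)
pose x t : vec := \col_i \sum_j complex.Re (Pi i j * y j t).
have xs : solves t0 (fun t x => A *m x + h t) x.
  move=> t Tt; apply/has_deriv_coord => i k; rewrite ord1.
  have -> : (fun tau => x tau i 0) = fun tau => \sum_j (complex.Re (Pi i j) * complex.Re (y j tau)
     + (- complex.Im (Pi i j)) * complex.Im (y j tau)).
    by apply/funext => tau; rewrite mxE; apply: eq_bigr => j _; rewrite complex_ReM mulNr.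
  have D : has_deriv t0 (fun tau => \sum_j (complex.Re (Pi i j) * complex.Re (y j tau)
     + (- complex.Im (Pi i j)) * complex.Im (y j tau))) t
     (\sum_j (complex.Re (Pi i j) * complex.Re (lam j * y j t + hh j t)
     + (- complex.Im (Pi i j)) * complex.Im (lam j * y j t + hh j t))).
    apply: has_deriv_sum => j; have [hy _ _ _] := yP j; have [h1 h2] := hy t Tt.
    by apply: has_derivD; apply: has_derivZ.
  suff -> : (A *m x t + h t) i 0 = \sum_j (complex.Re (Pi i j) * complex.Re (lam j * y j t + hh j t)
     + (- complex.Im (Pi i j)) * complex.Im (lam j * y j t + hh j t)) by exact: D.
  pose Ac := map_mx rc A.
  pose Y : 'cV[R[i]]_n := \col_j y j t.
  pose H : 'cV[R[i]]_n := \col_j (h t j 0)%:C.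
  have E : Pi *m (diag_mx (\row_j lam j) *m Y + P *m H) = Ac *m (Pi *m Y) + H.
    rewrite mulmxDr [Pi *m (P *m H)]mulmxA mulVmx // mul1mx; congr (_ + _).
    by rewrite -[in LHS](mulKVmx Pu Y) -/Pi (mulmxA _ P) -PA -(mulmxA P) mulKmx.
  transitivity (complex.Re ((Ac *m (Pi *m Y) + H) i 0)).
    rewrite [in RHS]mxE complex_ReD mxE; congr (_ + _); last by rewrite !mxE.
    rewrite !mxE complex_Re_sum; apply: eq_bigr => j _.
    rewrite !mxE complex_ReM /= mul0r subr0 complex_Re_sum; congr (_ * _).
    by apply: eq_bigr => l _; rewrite mxE.
  rewrite -E mxE complex_Re_sum; apply: eq_bigr => j _.
  rewrite mulNr -complex_ReM; congr (complex.Re (_ * _)).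
  rewrite mul_diag_mx !mxE; congr (_ + _).
  by apply: eq_bigr => l _; rewrite !mxE.
exists x; split => //.
  move=> i; apply: (@K_eq (fun tau => \sum_j (complex.Re (Pi i j) * complex.Re (y j tau)
     + (- complex.Im (Pi i j)) * complex.Im (y j tau)))) => [tau|].
    by rewrite mxE; apply: eq_bigr => j _; rewrite complex_ReM mulNr.
  apply: K_sum => j _; have [_ [k1 k2] _ _] := yP j.
  by apply: (K3_add K3); apply: (K3_scale K3).
have cx : continuous_on t0 x by exact: (has_deriv_continuous_on xs).
split=> [r|r].
  by rewrite ltnS leqn0 => /eqP -> t Tt; eexists; exact: xs.
case: r => [|[|//]] _ //=.
have : continuous_on t0 (fun t => A *m x t + h t).
  apply: continuous_on_mx => i k; rewrite ord1.
  have -> : (fun t => (A *m x t + h t) i 0) = fun t => \sum_j A i j * x t j 0 + h t i 0.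
    by apply/funext => t; rewrite !mxE.
  apply: continuous_onD; last exact: (K3_cont K3 (Kh i)).
  apply: continuous_on_sum => j _; apply: continuous_onM; first exact: continuous_on_cst.
  exact: continuous_on_coord.
move=> /within_cont_eps c; apply/within_cont_eps => t Tt e e0.
have [d d0 Hd] := c t Tt e e0; exists d => // tau Tu tu.
by rewrite (has_deriv_unique Tt (xs t Tt)) (has_deriv_unique Tu (xs tau Tu)); exact: Hd.
Qed.

End class_K3.

(** * Recursion on the rank for the coefficients *)

Section coefficients_exist.
Context {R : realType} {n m : nat}.
Notation vec := ('cV[R]_n).
Variables (t0 : R) (A : 'M[R]_n) (phi0 : R -> vec) (a : R).
Variables (fl : 'I_m.+1 -> R * vec -> vec).
Variables (vr : 'I_m.+1 -> R) (rho : nat -> R) (k : nat).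
Variables (lam : 'I_n -> R[i]) (K : set (R -> R)).
Hypothesis lamA : eigenvalues_of A lam.
Hypothesis K3 : is_K3 t0 lam K.
Hypothesis H8 : ~ Delta lam 0.
Hypothesis vr_gt0 : forall l, 0 < vr l.
Hypothesis vr_mono : forall l l' : 'I_m.+1, (l <= l')%N -> vr l <= vr l'.
Hypothesis rhoP : rank_enum vr rho.
Hypothesis H4 : forall l, vr l <= rho k ->
     forall w : mindex n, (mabs w)%:Z <= q_ord vr rho k l ->
     K3v K (fun t => mpartial (tube t0 a phi0) w (fl l) (t, phi0 t)).
Notation s0 := (s0 vr rho k).
Notation s1 := (s1 vr rho k).
Implicit Types (nu : monomial m) (w : mindex n) (t : R) (F G : fseries (R := R) (m := m)).
Implicit Types (phi psi : monomial m -> R -> vec).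

Definition agree (c : R) F G := forall nu, rank vr nu < c -> F nu = G nu.

Lemma agree_mul c F F' G G' : agree c F F' -> agree c G G' ->
  agree c (fmul F G) (fmul F' G').
Proof.
move=> hF hG nu nc; rewrite /fmul; apply: eq_fsbigr => -[b d] /[!inE] /= E.
have := rankD vr b d; rewrite E => Er.
have := rank_ge0 vr_gt0 vr_mono b; have := rank_ge0 vr_gt0 vr_mono d => hd hb.
by rewrite hF ?hG //; lra.
Qed.

Lemma agree_exp c F G d : agree c F G -> agree c (fexp F d) (fexp G d).
Proof. by move=> h; elim: d => // d IH; exact: agree_mul. Qed.

Lemma agree_prod c (I : Type) (s : seq I) (F G : I -> fseries (R := R) (m := m)) :
  (forall i, agree c (F i) (G i)) ->
  agree c (\big[@fmul R m/@fone R m]_(i <- s) F i) (\big[@fmul R m/@fone R m]_(i <- s) G i).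
Proof.
by move=> h; elim: s => [|i s IH]; rewrite ?big_nil // !big_cons; exact: agree_mul.
Qed.

Section locality.
Variables (phi psi : monomial m -> R -> vec) (nu : monomial m).
Hypothesis same : forall nu', nu' != mset0 -> rank vr nu' < rank vr nu -> phi nu' = psi nu'.

(** The letter eps_l takes away the positive rank vr l, so the factor coming from delta~ has rank
    below that of nu and sees only coefficients on which phi and psi agree. *)
Lemma lpow_local l t w : lpow phi l t w nu = lpow psi l t w nu.
Proof.
rewrite /lpow /fmul; apply: eq_fsbigr => -[b d] /[!inE] /= E.
rewrite /fletter; case: (eqVneq b [mset (l, 0%N)]%mset) => [bl|_]; last by rewrite !mul0r.
congr (_ * _).
have := rankD vr b d; rewrite E bl rank1 /lrank addr0 /= => Er.
have : rank vr d < rank vr nu by rewrite Er ltrDr.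
rewrite /fdelta_pow; apply: agree_prod => j; apply: agree_exp => c cn.
by rewrite /fdelta; case: (eqVneq c mset0) => // c0; rewrite same.
Qed.

(** This makes the recursion possible: the right-hand side of the equation for nu is known as soon
    as all coefficients of smaller rank are. *)
Lemma g_coef_local t : g_coef t0 phi0 a fl phi nu t = g_coef t0 phi0 a fl psi nu t.
Proof.
rewrite /g_coef; congr (- _ + _).
  apply: eq_fsbigr => nu' /[!inE] /= nu'0.
  have [->|/deriv_coef_rank E] := eqVneq (deriv_coef nu' nu) 0%N; first by rewrite !scale0r.
  by rewrite same // (E R vr) ltrDl.
apply: eq_bigr => l _; apply: eq_fsbigr => w _.
by rewrite -/(lpow phi l t w) -/(lpow psi l t w) lpow_local.
Qed.

End locality.

(** Coefficients are required to be multipliers of K rather than members because the unit series has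
    the coefficient 1. *)
Definition Kser (F : R -> fseries (R := R) (m := m)) :=
  forall nu, nu \in s0 -> Kmul K (fun t => F t nu).

Lemma Kser_mul (F G : R -> fseries (R := R) (m := m)) : Kser F -> Kser G -> Kser (fun t => fmul (F t) (G t)).
Proof.
move=> hF hG nu ns.
apply: (Kmul_eq K3 (u := fun t => \sum_(b <- s0) \sum_(d <- s0)
   (if (b `+` d)%mset == nu then F t b * G t d else 0))) => [t|].
  by rewrite (fmulE vr_gt0 vr_mono _ _ ns).
apply: (Kmul_sum K3) => b sb; apply: (Kmul_sum K3) => d sd.
case: ((b `+` d)%mset == nu); last exact: (Kmul_cst K3).
by apply: (Kmul_mul K3); [exact: hF|exact: hG].
Qed.

Lemma Kser_cst F : Kser (fun=> F).
Proof. by move=> nu _; exact: (Kmul_cst K3). Qed.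

Lemma Kser_exp (F : R -> fseries (R := R) (m := m)) d : Kser F -> Kser (fun t => fexp (F t) d).
Proof. by move=> h; elim: d => [|d IH]; [exact: Kser_cst|exact: Kser_mul]. Qed.

Lemma Kser_prod (I : Type) (s : seq I) (F : I -> R -> fseries (R := R) (m := m)) :
  (forall i, Kser (F i)) -> Kser (fun t => \big[@fmul R m/@fone R m]_(i <- s) F i t).
Proof.
move=> h; elim: s => [|i s IH].
  have -> : (fun t => \big[@fmul R m/@fone R m]_(i <- [::]) F i t) = fun=> @fone R m.
    by apply/funext => t; rewrite big_nil.
  exact: Kser_cst.
have -> : (fun t => \big[@fmul R m/@fone R m]_(j <- i :: s) F j t) =
   fun t => fmul (F i t) (\big[@fmul R m/@fone R m]_(j <- s) F j t).
  by apply/funext => t; rewrite big_cons.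
exact: Kser_mul.
Qed.

(** Every term ends with a factor in K, either a coefficient phi_nu' or, by hypothesis 4, a
    derivative of f_l along phi0, so multipliers suffice for the rest. *)
Lemma g_coef_K phi nu : (forall nu, nu != mset0 -> nu \in s0 -> K3v K (phi nu)) ->
  nu \in s1 -> K3v K (g_coef t0 phi0 a fl phi nu).
Proof.
move=> hphi ns i.
have ns0 : nu \in s0 by move: ns; rewrite mem_s1 => /andP[].
have Kl l w : Kser (fun t => lpow phi l t w).
  apply: Kser_mul; first exact: Kser_cst.
  apply: Kser_prod => j; apply: Kser_exp => nu' ns'; rewrite /fdelta.
  case: (eqVneq nu' mset0) => h; first exact: (Kmul_cst K3).
  by apply: (Kmul_K K3); exact: hphi.
apply: (K_eq K3 (u := fun t => - (\sum_(nu' <- s1) (deriv_coef nu' nu)%:R * phi nu' t i 0) +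
  \sum_l \sum_(w <- mlist (nl vr rho k l)) ((mfact w)%:R^-1 * lpow phi l t w nu) *
     mpartial (tube t0 a phi0) w (fl l) (t, phi0 t) i 0)) => [t|].
  rewrite (g_coefE t0 phi0 a fl phi vr_gt0 vr_mono t ns) !mxE !summxE; congr (- _ + _).
    by apply: eq_bigr => nu' _; rewrite mxE.
  apply: eq_bigr => l _; rewrite summxE; apply: eq_bigr => w _; by rewrite mxE.
apply: (K3_add K3).
  apply: (K_eq K3 (u := fun t => -1 * (\sum_(nu' <- s1) (deriv_coef nu' nu)%:R * phi nu' t i 0))) => [t|].
    by rewrite mulN1r.
  apply: (K3_scale K3); apply: (K_sum K3) => nu'; rewrite mem_s1 => /andP[h1 h2].
  by apply: (K3_scale K3); exact: hphi.
apply: (K_sum K3) => l _; apply: (K_sum K3) => w; rewrite mem_mlist lt_nl => wq.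
apply: (Kmul_mul K3); [exact: (Kmul_cst K3)|exact: Kl|].
apply: H4 => //.
have q0 : 0 <= q_ord vr rho k l by apply: le_trans wq.
by move: q0; rewrite /q_ord floor_ge0 pmulr_lge0 ?invr_gt0 // subr_ge0.
Qed.

Lemma coefficients_exist : exists phi, is_coefficients t0 A phi0 a fl vr rho k phi K.
Proof.
(* The induction also keeps the coefficients not yet constructed inside K (they start as 0), so that
   [g_coef_K] applies at every stage. *)
suff [phi [_ h]] : exists phi, (forall nu, nu != mset0 -> nu \in s0 -> K3v K (phi nu)) /\
    is_coefficients t0 A phi0 a fl vr rho k phi K by exists phi.
pose part j phi := forall s, (1 <= s <= j)%N -> forall nu, products vr (rho s) nu ->
  [/\ K3v K (phi nu), Cn_on t0 1 (phi nu) &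
      solves t0 (fun t x => A *m x + g_coef t0 phi0 a fl phi nu t) (phi nu)].
suff H j : (j <= k)%N -> exists phi, (forall nu, nu != mset0 -> nu \in s0 -> K3v K (phi nu)) /\
    part j phi by exact: H.
elim: j => [_|j IH jk].
  exists (fun _ _ => 0); split; last by move=> s /andP[s1]; rewrite leqn0 => /eqP s0'; rewrite s0' in s1.
  by move=> nu _ _ i; apply: (K_eq K3) (K_0 K3) => t; rewrite mxE.
have [phi [Kphi hphi]] := IH (ltnW jk).
have /choice[x xP] nu : exists x : R -> vec, products vr (rho j.+1) nu ->
   [/\ K3v K x, Cn_on t0 1 x &
       solves t0 (fun t x => A *m x + g_coef t0 phi0 a fl phi nu t) x].
  have [[nu0 nr]|h] := pselect (products vr (rho j.+1) nu); last by exists (fun=> 0).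
  have [|x hx] := @linear_solution _ _ _ _ _ K3 _ lamA H8 (g_coef t0 phi0 a fl phi nu).
    apply: g_coef_K => //; rewrite mem_s1 nu0 mem_s0 // nr.
    move: jk; rewrite leq_eqVlt => /predU1P[E|jk]; first by rewrite E lexx.
    exact: ltW (rho_lt rhoP (ltn0Sn j) jk).
  by exists x.
pose psi nu := if rank vr nu == rho j.+1 then x nu else phi nu.
(* Overwriting the coefficients of rank rho_{j+1} does not disturb the equations of rank up to
   rho_{j+1}, whose right-hand sides involve strictly smaller ranks. *)
have loc s nu : (1 <= s <= j.+1)%N -> rank vr nu = rho s ->
  g_coef t0 phi0 a fl psi nu = g_coef t0 phi0 a fl phi nu.
  move=> /andP[sg1 sj] E; apply/funext => t; apply: g_coef_local => nu' nu'0; rewrite E => h.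
  rewrite /psi ifN //; apply: contraTN h => /eqP ->; rewrite -leNgt.
  move: sj; rewrite leq_eqVlt => /predU1P[E'|sj]; first by rewrite E' lexx.
  exact: ltW (rho_lt rhoP sg1 sj).
exists psi; split.
  move=> nu nu0 ns; rewrite /psi; case: eqP => E; last exact: Kphi.
  by have [] := xP nu (conj nu0 E).
move=> s sj nu [nu0 nr]; rewrite (loc s) //.
case/andP: (sj) => sg1; rewrite leq_eqVlt => /predU1P[E|sj'].
  rewrite /psi nr E eqxx; apply: xP; split => //; by rewrite nr E.
rewrite /psi nr lt_eqF; last exact: (rho_lt rhoP).
by apply: (hphi s); [rewrite sg1|split].
Qed.

End coefficients_exist.

(** * Reduction to a diagonal system *)

Section matrix_analysis.
Context {R : realType}.
Implicit Types (T t : R).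

Lemma mulmx_norm_le p q r (M : 'M[R]_(p, q)) (N : 'M[R]_(q, r)) :
  `|M *m N| <= q%:R * (`|M| * `|N|).
Proof.
apply/mx_norm_leP => [|i j]; first by rewrite !mulr_ge0.
rewrite mxE; apply: le_trans (ler_norm_sum _ _ _) _.
rewrite -[X in X%:R * _]card_ord mulr_natl -sumr_const; apply: ler_sum => l _.
by rewrite normrM; apply: ler_pM => //; exact: mx_norm_coord.
Qed.

Lemma det_norm_le n (M : 'M[R]_n) (C : R) : (forall i j, `|M i j| <= C) ->
  `|\det M| <= #|{: {perm 'I_n}}|%:R * C ^+ n.
Proof.
move=> MC; rewrite /determinant; apply: le_trans (ler_norm_sum _ _ _) _.
rewrite mulr_natl -sumr_const; apply: ler_sum => s _.
rewrite normrM normrX normrN1 expr1n mul1r normr_prod.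
rewrite -[X in C ^+ X]card_ord -prodr_const; apply: ler_prod => i _.
by rewrite normr_ge0 MC.
Qed.

(** By Cramer's rule: the entries of the adjugate are minors of M up to sign, hence bounded, and
    |det M| is bounded below. The constant B is uniform in M. *)
Lemma invmx_bounded n (C c : R) : 0 < c -> exists B, forall M : 'M[R]_n,
  `|M| <= C -> c <= `|\det M| -> `|invmx M| <= B.
Proof.
move=> c0; exists (c^-1 * (#|{: {perm 'I_n.-1}}|%:R * `|C| ^+ n.-1)) => M MC cM.
have C0 : 0 <= C by apply: le_trans MC.
have uM : M \in unitmx.
  by rewrite unitmxE unitfE -normr_gt0; exact: lt_le_trans cM.
have adjM i j : `|(\adj M) i j| <= #|{: {perm 'I_n.-1}}|%:R * C ^+ n.-1.
  rewrite mxE /cofactor normrM normrX normrN1 expr1n mul1r.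
  apply: det_norm_le => k l; rewrite !mxE.
  by apply: le_trans MC; exact: mx_norm_coord.
rewrite (ger0_norm C0); apply/mx_norm_leP => [|i j].
  by rewrite !mulr_ge0 ?invr_ge0 ?exprn_ge0 // ltW.
rewrite /invmx uM mxE normrM; apply: ler_pM => //.
rewrite normfV lef_pV2 // posrE; exact: lt_le_trans cM.
Qed.

Lemma continuous_on_eq {V : normedModType R} T (f g : R -> V) :
  (forall t, T <= t -> f t = g t) -> continuous_on T g -> continuous_on T f.
Proof.
move=> fg /within_cont_eps c; apply/within_cont_eps => t Tt e e0.
have [d d0 H] := c t Tt e e0; exists d => // u Tu tu.
by rewrite !fg //; exact: H.
Qed.

Lemma continuous_on_addv {V : normedModType R} T (f g : R -> V) :
  continuous_on T f -> continuous_on T g -> continuous_on T (fun t => f t + g t).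
Proof. by move=> cf cg x; apply: cvgD; [exact: cf|exact: cg]. Qed.

Lemma continuous_on_oppv {V : normedModType R} T (f : R -> V) :
  continuous_on T f -> continuous_on T (fun t => - f t).
Proof. by move=> cf x; apply: cvgN; exact: cf. Qed.

Lemma continuous_on_scalev {V : normedModType R} T (k : R -> R) (f : R -> V) :
  continuous_on T k -> continuous_on T f -> continuous_on T (fun t => k t *: f t).
Proof. by move=> ck cf x; apply: cvgZ; [exact: ck|exact: cf]. Qed.

Lemma continuous_on_sumv {V : normedModType R} (I : eqType) (r : seq I) T (f : I -> R -> V) :
  (forall i, i \in r -> continuous_on T (f i)) ->
  continuous_on T (fun t => \sum_(i <- r) f i t).
Proof.
elim: r => [|i r IH] h.
  apply: (@continuous_on_eq _ _ _ (fun=> 0)) => [t _|x]; [exact: big_nil|exact: cvg_cst].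
apply: (@continuous_on_eq _ _ _ (fun t => f i t + \sum_(j <- r) f j t)).
  by move=> t _; rewrite big_cons.
apply: continuous_on_addv; first by apply: h; rewrite mem_head.
by apply: IH => j jr; apply: h; rewrite inE jr orbT.
Qed.

Lemma continuous_on_prod (I : eqType) (r : seq I) T (f : I -> R -> R) :
  (forall i, i \in r -> continuous_on T (f i)) ->
  continuous_on T (fun t => \prod_(i <- r) f i t).
Proof.
elim: r => [|i r IH] h.
  apply: (@continuous_on_eq R T _ (fun=> 1)) => [t _|x]; [exact: big_nil|exact: cvg_cst].
apply: (@continuous_on_eq R T _ (fun t => f i t * \prod_(j <- r) f j t)).
  by move=> t _; rewrite big_cons.
apply: continuous_onM; first by apply: h; rewrite mem_head.
by apply: IH => j jr; apply: h; rewrite inE jr orbT.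
Qed.

Lemma continuous_on_mulmx p q r T (M : R -> 'M[R]_(p, q)) (N : R -> 'M[R]_(q, r)) :
  continuous_on T M -> continuous_on T N -> continuous_on T (fun t => M t *m N t).
Proof.
move=> cM cN; apply: continuous_on_mx => i j.
apply: (@continuous_on_eq R T _ (fun t => \sum_k M t i k * N t k j)).
  by move=> t _; rewrite mxE.
apply: continuous_on_sum => k _; apply: continuous_onM.
  exact: continuous_on_coord.
exact: continuous_on_coord.
Qed.

Lemma continuous_on_det n T (M : R -> 'M[R]_n) :
  (forall i j, continuous_on T (fun t => M t i j)) -> continuous_on T (fun t => \det (M t)).
Proof.
move=> cM; rewrite /determinant; apply: continuous_on_sum => s _.
apply: continuous_onM; first exact: continuous_on_cst.
by apply: continuous_on_prod => i _; exact: cM.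
Qed.

Lemma continuous_on_invmx n T (M : R -> 'M[R]_n) :
  (forall t, T <= t -> \det (M t) != 0) ->
  continuous_on T M -> continuous_on T (fun t => invmx (M t)).
Proof.
move=> d0 cM; apply: (@continuous_on_eq _ _ _ (fun t => (\det (M t))^-1 *: \adj (M t))).
  by move=> t Tt; rewrite /invmx unitmxE unitfE d0.
apply: continuous_on_scalev.
  apply: continuous_onV => //; apply: continuous_on_det => i j.
  exact: continuous_on_coord.
apply: continuous_on_mx => i j.
apply: (@continuous_on_eq R T _ (fun t => cofactor (M t) j i)) => [t _|]; first by rewrite mxE.
apply: continuous_onM; first exact: continuous_on_cst.
apply: continuous_on_det => k l.
apply: (@continuous_on_eq R T _ (fun t => M t (lift j k) (lift i l))) => [t _|].
  by rewrite !mxE.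
exact: continuous_on_coord.
Qed.

Lemma continuous_on_graph n T (D : set (R * 'cV[R]_n)) (F : R * 'cV[R]_n -> 'cV[R]_n)
  (y : R -> 'cV[R]_n) : {within D, continuous F} -> continuous_on T y ->
  (forall t, T <= t -> D (t, y t)) -> continuous_on T (fun t => F (t, y t)).
Proof.
move=> /within_cont_eps cF /within_cont_eps cy Dy; apply/within_cont_eps => t Tt e e0.
have [d d0 Hd] := cF _ (Dy t Tt) e e0.
have [d' d'0 Hd'] := cy t Tt d d0.
exists (Num.min d d'); first by rewrite lt_min d0.
move=> u Tu; rewrite lt_min => /andP[tu tu']; apply: Hd; first exact: Dy.
by rewrite prod_normE /= gt_max tu Hd'.
Qed.

Lemma is_derive_powR (f : R -> R) (c : R) t a : 0 < f t -> is_derive t (1:R) f a ->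
  is_derive t (1:R) (fun u => f u `^ c) (c * f t `^ (c - 1) * a).
Proof.
move=> ft df.
have dp := is_derive1_powR c ft.
exact: (@is_derive1_comp R (fun x => x `^ c) f t _ _ dp df).
Qed.

Lemma continuous_on_powR T (f : R -> R) (c : R) : (forall t, T <= t -> 0 < f t) ->
  continuous_on T f -> continuous_on T (fun t => f t `^ c).
Proof.
move=> f0 /subspace_continuousP cf; apply/subspace_continuousP => x Tx.
have cp : {for f x, continuous (fun u : R => u `^ c)}.
  by apply: is_derive_continuous; exact: is_derive1_powR (f0 x Tx).
exact: (@cvg_comp _ _ _ f (fun u : R => u `^ c) _ _ _ (cf x Tx) cp).
Qed.

Lemma powR_add (x c d : R) : 0 < x -> x `^ (c + d) = x `^ c * x `^ d.
Proof. by move=> x0; rewrite powRD //; apply/implyP => _; rewrite gt_eqF. Qed.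

Lemma powR_sub1 (x c : R) : 0 < x -> x `^ (c - 1) = x `^ c * x^-1.
Proof. by move=> x0; rewrite powR_add // powR_inv1 // ltW. Qed.

Lemma antiderivative_diff T (f g h : R -> R) :
  (forall t, T < t -> is_derive t (1:R) f (h t)) ->
  (forall t, T < t -> is_derive t (1:R) g (h t)) ->
  forall s t, T < s -> T < t -> f t - f s = g t - g s.
Proof.
move=> df dg.
have key s t : T < s -> s <= t -> f t - f s = g t - g s.
  move=> Ts st; apply/eqP; rewrite -subr_eq0 -normr_le0.
  have d x : s <= x -> is_derive x (1:R) (fun u => f u - g u) (h x - h x).
    by move=> sx; apply: dB; [apply: df|apply: dg]; exact: lt_le_trans sx.
  have := @MVT_bound R (fun u => f u - g u) (fun x => h x - h x) s t 0 st.
  rewrite mul0r; have -> : f t - f s - (g t - g s) = f t - g t - (f s - g s) by ring.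
  apply.
  - by move=> x /andP[/ltW sx _]; exact: d.
  - apply: derivable_within_continuous => x; rewrite in_itv /= => /andP[sx _].
    by have [] := d x sx.
  - by move=> x _; rewrite subrr normr0.
move=> s t Ts Tt; have [st|/ltW ts] := leP s t; first exact: key.
by rewrite -opprB (key t s) // opprB.
Qed.

Lemma derive_le (f df : R -> R) T s t : (forall x, T < x -> is_derive x (1:R) f (df x)) ->
  (forall x, T < x -> 0 <= df x) -> T < s -> s <= t -> f s <= f t.
Proof.
move=> hf h0 Ts; apply: (@derive_ge0_le R s f df) => // [|x|x].
- by apply: (@is_derive_continuous_on R s f df) => x sx; apply: hf; exact: lt_le_trans sx.
- by move/(lt_trans Ts); exact: hf.
- by move/(lt_trans Ts); exact: h0.
Qed.

End matrix_analysis.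

(** * The nonlinear equation for the error r = y - s *)

Section remainder.
Context {R : realType} {n m : nat}.
Notation vec := ('cV[R]_n).
Variables (t0 : R) (A : 'M[R]_n) (f phi0 : R -> vec) (a : R).
Variables (eps : 'I_m.+1 -> R -> R) (fl : 'I_m.+1 -> R * vec -> vec).
Variables (vr : 'I_m.+1 -> R) (rho : nat -> R) (k : nat).
Variable phi : monomial m -> R -> vec.
Notation D := (tube t0 a phi0).
Notation e := (eps ord0).
Notation OE := (OE e).
Notation s0 := (s0 vr rho k).
Notation s1 := (s1 vr rho k).
Notation kappa := (kappa vr rho k).
Notation s := (asym_sum t0 phi0 eps vr rho k phi).
Notation delta := (delta t0 eps vr rho k phi).
Notation dasym := (dasym t0 A f phi0 a eps fl vr rho k phi).
Notation Ah := (Ahat t0 A phi0 a eps fl vr rho k phi).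
Notation rhs := (rhs A f eps fl).
Hypothesis a_gt0 : 0 < a.
Hypothesis vr_gt0 : forall l, 0 < vr l.
Hypothesis vr_mono : forall l l' : 'I_m.+1, (l <= l')%N -> vr l <= vr l'.
Hypothesis rhoP : rank_enum vr rho.
Hypothesis k_ge1 : (1 <= k)%N.
Hypothesis e_gt0 : forall t, t0 <= t -> 0 < e t.
Hypothesis e_to0 : e t @[t --> +oo] --> (0 : R).
Hypothesis lval_OE : forall l r, (r <= p_ord vr rho k l)%N ->
  OE ((vr l + r%:R) / vr ord0) (lval t0 eps (l, r)).
Hypothesis phi0_sol : solves t0 (fun t x => A *m x + f t) phi0.
Hypothesis H1_C : forall l, Cn_on t0 (p_ord vr rho k l) (eps l).
Hypothesis H2 : forall l, C0q D (y_ord vr rho k l) (fl l).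
Hypothesis H3 : forall l (w : mindex n), (mabs w <= y_ord vr rho k l)%N ->
     bounded_on D (mpartial D w (fl l)).
Hypothesis phi_bound : forall nu : monomial m, nu != mset0 -> nu \in s0 ->
  exists C, forall t, t0 <= t -> `|phi nu t| <= C.
Hypothesis phi_sol : forall nu : monomial m, nu != mset0 -> nu \in s0 ->
  solves t0 (fun t x => A *m x + g_coef t0 phi0 a fl phi nu t) (phi nu).
Hypothesis phi_C1 : forall nu : monomial m, nu != mset0 -> nu \in s0 -> Cn_on t0 1 (phi nu).
Hypothesis f_cont : continuous_on t0 f.
Implicit Types (t T M : R) (r : vec) (nu : monomial m).

(* The equation for r = y - s reads r' = Ahat r + G(t, r). *)
Definition Gfun t r : vec := rhs t (s t + r) - dasym t - Ah t *m r.

Lemma sE t : s t = phi0 t + delta t.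
Proof. exact: asym_sumE. Qed.

Lemma y_ord_ge2 l : (2 <= y_ord vr rho k l)%N.
Proof.
rewrite /y_ord; case: (q_ord vr rho k l) => q; last by lia.
by rewrite -PoszD; case: (leP 2 (Posz (q + 1))) => h; lia.
Qed.

Lemma tube_sr t r : t0 <= t -> `|delta t| <= a / 2 -> `|r| <= a / 2 -> D (t, s t + r).
Proof.
move=> Tt hd hr; split => //=; rewrite sE.
have -> : phi0 t + delta t + r - phi0 t = delta t + r by apply/matrixP => i j; rewrite !mxE; ring.
by apply: le_trans (ler_normD _ _) _; lra.
Qed.

Lemma G0E t : t0 < t -> Gfun t 0 = residual t0 A f phi0 eps fl vr rho k phi t.
Proof.
move=> tt; rewrite /Gfun mulmx0 subr0 addr0 /residual.
have dE : deriv_on t0 s t = dasym t by exact: asym_deriv_on.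
by rewrite dE addrC.
Qed.

Lemma G_diff t r r' : Gfun t r - Gfun t r' = \sum_l eps l t *:
  (fl l (t, s t + r) - fl l (t, s t + r') - Defs.jacobian D (fl l) (t, s t) *m (r - r')).
Proof.
rewrite /Gfun /Defs.rhs /Ahat.
have -> : \sum_l eps l t *: (fl l (t, s t + r) - fl l (t, s t + r') -
    Defs.jacobian D (fl l) (t, s t) *m (r - r')) =
  \sum_l eps l t *: fl l (t, s t + r) - \sum_l eps l t *: fl l (t, s t + r') -
   (\sum_l eps l t *: Defs.jacobian D (fl l) (t, s t)) *m (r - r').
  rewrite mulmx_suml -!sumrB; apply: eq_bigr => l _.
  by rewrite !scalerBr -scalemxAl.
rewrite !mulmxDl !mulmxDr !mulmxN.
by apply/matrixP => i j; rewrite !mxE; ring.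
Qed.

Lemma eps_OE1 l : OE 1 (eps l).
Proof.
apply: (OE_weak e_gt0 e_to0) (eps_OE lval_OE l).
by rewrite ler_pdivlMr // mul1r; exact: vr_mono.
Qed.

(** [Ahat] contains the linearization of each f_l at s(t), so the difference is a sum of terms
    estimated by [quadratic_remainder] with base point s(t). The factor e t comes from eps_l =
    O(eps_1); the bounds a / 2 on delta and on r keep s + r in the tube. *)
Lemma G_lipschitz : exists C T, [/\ 0 <= C, t0 < T & forall t, T <= t ->
  `|delta t| <= a / 2 /\ forall r r' M, M <= a / 2 -> `|r| <= M -> `|r'| <= M ->
    `|Gfun t r - Gfun t r'| <= C * e t * M * `|r - r'|].
Proof.
(* The triple consists of the constant in eps_l = O(eps_1), the bound for the derivatives of f_l,
   and the time from which the first estimate holds. *)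
have /choice[c cP] (l : 'I_m.+1) : exists c : R * R * R, [/\ 0 <= c.1.1, 0 <= c.1.2,
    forall t, c.2 <= t -> `|eps l t| <= c.1.1 * e t &
    forall js, sorted (@ord_leq n) js -> (size js <= 2)%N ->
      forall z, D z -> `|partials D js (fl l) z| <= c.1.2].
  have /(OEP t0)[c1 [T1 [c10 [t0T1 hT1]]]] := eps_OE1 l.
  have [|c2 c20 hc2] := @bounded_sorted R n t0 a phi0 (fl l) 2.
    by move=> w w2; apply: H3; apply: leq_trans (y_ord_ge2 l).
  exists (c1, c2, T1); split => // t Tt; apply: le_trans (hT1 t Tt) _.
  by rewrite powRr1 // ltW // e_gt0 // (le_trans t0T1).
have a20 : 0 < a / 2 by rewrite divr_gt0.
have [T0 t0T0 hT0] := delta_small vr_gt0 vr_mono e_gt0 e_to0 lval_OE phi_bound a20.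
pose C := \sum_l (c l).1.1 * (n%:R * (n%:R * (c l).1.2)).
exists C, (\big[Order.max/Num.max T0 (t0 + 1)]_l (c l).2); split.
- by apply: sumr_ge0 => l _; have [h1 h2 _ _] := cP l; rewrite !mulr_ge0.
- apply: (@lt_le_trans _ _ (t0 + 1)); first by rewrite ltrDl.
  by apply: (@le_trans _ _ (Num.max T0 (t0 + 1))); [rewrite le_max lexx orbT|exact: bigmax_ge_id].
move=> t /bigmax_leP[]; rewrite ge_max => /andP[T0t t01] hct.
have t0t : t0 <= t by apply: le_trans t01; rewrite lerDl.
split; first exact: hT0.
move=> r r' M Ma hr hr'.
have hd := hT0 t T0t.
have M0 : 0 <= M by apply: le_trans hr.
have et := e_gt0 t0t.
rewrite G_diff; apply: le_trans (ler_norm_sum _ _ _) _.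
rewrite /C !big_distrl /=; apply: ler_sum => l _.
have [c1 c2 he hb] := cP l.
rewrite normrZ.
have -> : (c l).1.1 * (n%:R * (n%:R * (c l).1.2)) * e t * M * `|r - r'| =
   ((c l).1.1 * e t) * (n%:R * (n%:R * (c l).1.2 * M) * `|r - r'|) by ring.
apply: ler_pM => //; first by apply: he; exact: hct.
have Ds : D (t, s t) by rewrite -[s t]addr0; apply: tube_sr; rewrite ?normr0 // ltW.
have Dr : D (t, s t + r) by apply: tube_sr => //; exact: le_trans hr Ma.
have Dr' : D (t, s t + r') by apply: tube_sr => //; exact: le_trans hr' Ma.
have E (x y z : vec) : (x + y) - (x + z) = y - z by apply/matrixP => i j; rewrite !mxE; ring.
have E' (x y : vec) : x + y - x = y by rewrite addrC addKr.
have := quadratic_remainder a_gt0 (H2 l) (y_ord_ge2 l) hb Ds Dr' Dr (m := M).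
by rewrite E !E'; apply.
Qed.

Lemma G_zero : exists C T, [/\ 0 <= C, t0 < T & forall t, T <= t ->
  `|Gfun t 0| <= C * e t `^ kappa].
Proof.
have := residual_OE a_gt0 vr_gt0 vr_mono rhoP k_ge1 e_gt0 e_to0 lval_OE phi0_sol H1_C H2 H3
  phi_bound phi_sol.
move=> /(OEP t0)[C [T [C0 [t0T hT]]]]; exists C, (Num.max T (t0 + 1)); split => //.
  by rewrite lt_max ltrDl ltr01 orbT.
move=> t; rewrite ge_max => /andP[Tt t01].
have tt : t0 < t by apply: lt_le_trans t01; rewrite ltrDl.
by rewrite G0E //; have := hT t Tt; rewrite normr_id.
Qed.

Lemma lval_cont l (r : nat) : (r <= p_ord vr rho k l)%N -> continuous_on t0 (lval t0 eps (l, r)).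
Proof. by move=> h; exact: (H1_C l).2. Qed.

Lemma mval_cont nu : (forall x, x \in nu -> (x.2 <= p_ord vr rho k x.1)%N) ->
  continuous_on t0 (mval t0 eps nu).
Proof.
by move=> h; apply: continuous_on_prod => -[l r] xn; exact: lval_cont (h _ xn).
Qed.

Lemma phi_cont nu : nu \in s1 -> continuous_on t0 (phi nu).
Proof. by rewrite mem_s1 => /andP[nu0 ns]; exact: (phi_C1 nu0 ns).2 0%N isT. Qed.

Lemma s_cont : continuous_on t0 s.
Proof.
apply: (@continuous_on_eq _ _ _ _ (fun t => phi0 t + delta t)) => [t _|]; first exact: sE.
apply: continuous_on_addv; first exact: (has_deriv_continuous_on phi0_sol).
apply: continuous_on_sumv => nu ns; apply: continuous_on_scalev; last exact: phi_cont.
apply: mval_cont => x xn; move: ns; rewrite mem_s1 => /andP[_ ns].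
exact/ltnW/(letter_lt vr_gt0 vr_mono ns xn).
Qed.

Lemma dasym_cont : continuous_on t0 dasym.
Proof.
have cst_cont p q (M : 'M[R]_(p, q)) : continuous_on t0 (fun=> M) by move=> x; exact: cvg_cst.
have cphi0 := has_deriv_continuous_on phi0_sol.
apply: continuous_on_addv; first by apply: continuous_on_addv => //; exact: continuous_on_mulmx.
apply: continuous_on_sumv => nu ns1; have := ns1; rewrite mem_s1 => /andP[nu0 ns].
apply: continuous_on_addv; apply: continuous_on_scalev.
- apply: continuous_on_sumv => x xn; apply: mval_cont => y; rewrite /dmono in_msetD => /orP[yn|].
    have yn' : y \in (nu : monomial m) by move: yn; rewrite in_msetB1 => /andP[].
    exact/ltnW/(letter_lt vr_gt0 vr_mono ns yn').
  by rewrite in_mset1 => /eqP -> /=; exact: (letter_lt vr_gt0 vr_mono ns xn).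
- exact: phi_cont.
- by apply: mval_cont => x xn; exact/ltnW/(letter_lt vr_gt0 vr_mono ns xn).
(* The remaining factor is the derivative of phi nu by its equation, so its continuity comes from
   phi nu being C^1. *)
apply: (@continuous_on_eq _ _ _ _ (deriv_on t0 (phi nu))).
  by move=> t Tt; rewrite (has_deriv_unique Tt (phi_sol nu0 ns Tt)).
exact: (phi_C1 nu0 ns).2 1%N isT.
Qed.

Lemma eps_cont l : continuous_on t0 (eps l).
Proof. exact: (H1_C l).2 0%N isT. Qed.

Lemma rhs_cont T y : t0 <= T -> continuous_on T y -> (forall t, T <= t -> D (t, y t)) ->
  continuous_on T (fun t => rhs t (y t)).
Proof.
move=> t0T cy Dy; apply: continuous_on_addv.
  apply: continuous_on_addv; last exact: continuous_on_sub t0T f_cont.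
  by apply: continuous_on_mulmx => // x; exact: cvg_cst.
apply: continuous_on_sumv => l _; apply: continuous_on_scalev.
  exact: continuous_on_sub t0T (@eps_cont l).
by apply: continuous_on_graph Dy => //; exact: (H2 l).2 [::] isT.
Qed.

Lemma Ahat_cont T : t0 <= T -> (forall t, T <= t -> D (t, s t)) -> continuous_on T Ah.
Proof.
move=> t0T Ds; apply: continuous_on_addv; first by move=> x; exact: cvg_cst.
apply: continuous_on_sumv => l _; apply: continuous_on_scalev.
  exact: continuous_on_sub t0T (@eps_cont l).
apply: continuous_on_mx => i j.
apply: (@continuous_on_eq _ R T _ (fun t => partial D j (fl l) (t, s t) i 0)) => [t _|].
  by rewrite mxE.
apply: (@continuous_on_coord _ _ _ _ (fun t => partial D j (fl l) (t, s t))).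
apply: continuous_on_graph Ds; last exact: continuous_on_sub t0T s_cont.
by apply: (H2 l).2 [:: j] _; apply: leq_trans (y_ord_ge2 l).
Qed.

Lemma G_cont T z : t0 <= T -> continuous_on T z ->
  (forall t, T <= t -> `|delta t| <= a / 2) -> (forall t, T <= t -> `|z t| <= a / 2) ->
  continuous_on T (fun t => Gfun t (z t)).
Proof.
move=> t0T cz hd hz.
have a20 : 0 < a / 2 by rewrite divr_gt0.
have Ds t : T <= t -> D (t, s t).
  move=> Tt; rewrite -[s t]addr0; apply: tube_sr; rewrite ?normr0 ?(ltW a20) //.
    exact: le_trans Tt.
  exact: hd.
apply: continuous_on_addv; first apply: continuous_on_addv.
- apply: rhs_cont => //.
    by apply: continuous_on_addv => //; exact: continuous_on_sub t0T s_cont.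
  by move=> t Tt; apply: tube_sr; [exact: le_trans Tt|exact: hd|exact: hz].
- by apply: continuous_on_oppv; exact: continuous_on_sub t0T dasym_cont.
- apply: continuous_on_oppv; apply: continuous_on_mulmx => //; exact: Ahat_cont.
Qed.

(** Serves the uniqueness statement, which compares two solutions in the tube; bounds for the first
    derivatives of f_l and for eps_l are enough. *)
Lemma rhs_lipschitz : exists L T, [/\ 0 <= L, t0 < T & forall t y y', T <= t ->
  D (t, y) -> D (t, y') -> `|rhs t y - rhs t y'| <= L * `|y - y'|].
Proof.
have /choice[c cP] (l : 'I_m.+1) : exists c : R * R * R, [/\ 0 <= c.1.1, 0 <= c.1.2,
    forall t, c.2 <= t -> `|eps l t| <= c.1.1 &
    forall js, sorted (@ord_leq n) js -> (size js <= 1)%N ->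
      forall z, D z -> `|partials D js (fl l) z| <= c.1.2].
  have /(OEP t0)[c1 [T1 [c10 [t0T1 hT1]]]] := eps_OE0 vr_gt0 e_gt0 e_to0 lval_OE l.
  have [|c2 c20 hc2] := @bounded_sorted R n t0 a phi0 (fl l) 1.
    by move=> w w2; apply: H3; apply: leq_trans (y_ord_ge2 l); exact: leqW.
  exists (c1, c2, T1); split => // t Tt; apply: le_trans (hT1 t Tt) _.
  by rewrite powRr0 mulr1.
pose L := n%:R * `|A| + \sum_l (c l).1.1 * (n%:R * (c l).1.2).
exists L, (\big[Order.max/t0 + 1]_l (c l).2); split.
- apply: addr_ge0; first by rewrite mulr_ge0.
  by apply: sumr_ge0 => l _; have [h1 h2 _ _] := cP l; rewrite !mulr_ge0.
- by apply: (@lt_le_trans _ _ (t0 + 1)); [rewrite ltrDl|exact: bigmax_ge_id].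
move=> t y y' /bigmax_leP[t01 hct] Dy Dy'.
have -> : rhs t y - rhs t y' = A *m (y - y') + \sum_l eps l t *: (fl l (t, y) - fl l (t, y')).
  rewrite /Defs.rhs; under [in RHS]eq_bigr do rewrite scalerBr.
  by rewrite sumrB mulmxBr; apply/matrixP => i j; rewrite !mxE; ring.
apply: le_trans (ler_normD _ _) _; rewrite mulrDl; apply: lerD.
  by rewrite -mulrA; exact: mulmx_norm_le.
apply: le_trans (ler_norm_sum _ _ _) _; rewrite big_distrl /=; apply: ler_sum => l _.
have [c1 c2 he hb] := cP l; rewrite normrZ -mulrA; apply: ler_pM => //.
  by apply: he; exact: hct.
apply: (partials_lip a_gt0 (H2 l) (js := [::])) => //.
  exact: leq_trans (y_ord_ge2 l).
by move=> j z Dz; exact: hb.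
Qed.

End remainder.

(** * Growth and decay of the kernels exp(int p_jj) *)

Section kernels.
Context {R : realType} {n m : nat}.
Variables (t0 : R) (eps : 'I_m.+1 -> R -> R).
Variables (vr : 'I_m.+1 -> R) (rho : nat -> R) (k : nat).
Variables (lam : 'I_n -> R[i]) (varpi : R).
Variables (gamma : 'I_n -> mindex m.+1 -> R[i]) (vsig : 'I_n -> R -> R[i]).
Notation e := (eps ord0).
Notation OE := (OE e).
Notation kappa := (kappa vr rho k).
Notation mu := (mu_indices t0 varpi eps).
Hypothesis vr_gt0 : forall l, 0 < vr l.
Hypothesis vr_mono : forall l l' : 'I_m.+1, (l <= l')%N -> vr l <= vr l'.
Hypothesis rhoP : rank_enum vr rho.
Hypothesis k_ge1 : (1 <= k)%N.
Hypothesis e_gt0 : forall t, t0 <= t -> 0 < e t.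
Hypothesis e_to0 : e t @[t --> +oo] --> (0 : R).
Hypothesis lval_OE : forall l r, (r <= p_ord vr rho k l)%N ->
  OE ((vr l + r%:R) / vr ord0) (lval t0 eps (l, r)).
Hypothesis H1_C : forall l, Cn_on t0 (p_ord vr rho k l) (eps l).
Hypothesis H10 : forall (g1 : R) (gw : mindex m.+1 -> R),
     let h := fun t => g1 * (e t)^-1 * deriv_on t0 e t
       + \sum_(w \in mu) gw w * mu_eps eps w t in
     (\forall t \near +oo, 0 <= h t) \/ (\forall t \near +oo, h t <= 0).
Variable tQ : R.
Hypothesis t0Q : t0 <= tQ.
Hypothesis vsigP : forall j, [/\ conv_int_C tQ (vsig j),
                   continuous_on tQ (@complex.Re R \o vsig j) &
                   continuous_on tQ (@complex.Im R \o vsig j)].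
Implicit Types (t T : R).

Lemma mu_finite : finite_set mu.
Proof.
apply: (@sub_finite_set _ _ [set` mlist (n := m.+1) (Num.truncn varpi).+1]); last exact: finite_seq.
move=> w [_ h _] /=; rewrite mem_mlist ltnS truncn_ge_nat ?ltW //.
by apply: le_lt_trans h; rewrite ler0n.
Qed.

Definition W : seq (mindex m.+1) := fset_set mu.

Lemma W_mabs w : w \in W -> (1 <= mabs w)%N.
Proof. by rewrite in_fset_set ?inE; [move=> [] | exact: mu_finite]. Qed.

Lemma sum_mu (V : nmodType) (F : mindex m.+1 -> V) : \sum_(w \in mu) F w = \sum_(w <- W) F w.
Proof. exact/fsbig_finite/mu_finite. Qed.

Lemma dfun_Re j t : complex.Re (dfun t0 varpi eps lam gamma vsig j t) =
  complex.Re (lam j) + \sum_(w <- W) complex.Re (gamma j w) * mu_eps eps w t + complex.Re (vsig j t).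
Proof.
rewrite /dfun sum_mu !complex_ReD complex_Re_sum; congr (_ + _ + _).
by apply: eq_bigr => w _; rewrite complex_ReM /= mulr0 subr0.
Qed.

Definition hfun j t : R := pjj t0 varpi kappa eps lam gamma vsig j t - complex.Re (vsig j t).

(** The part of [hfun] that tends to 0; it has the form whose sign is controlled by hypothesis
    10. *)
Definition rest j t : R := (varpi - kappa) * (e t)^-1 * deriv_on t0 e t
       + \sum_(w \in mu) complex.Re (gamma j w) * mu_eps eps w t.

Lemma hfunE j t : hfun j t = complex.Re (lam j) + rest j t.
Proof. by rewrite /hfun /pjj dfun_Re /rest sum_mu; ring. Qed.

(** eps_1 has the smallest rank of all monomials, hence rank at most rho_k; so hypothesis 1 covers
    its first derivative. *)
Lemma p_ord0_gt0 : (0 < p_ord vr rho k ord0)%N.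
Proof.
have ns : [mset (ord0, 0%N)]%mset \in s0 vr rho k.
  rewrite mem_s0 // rank1 /lrank addr0 leNgt; apply/negP => h.
  have [nu nu0 E] := rho_rank rhoP k_ge1.
  by have := rank_ge vr_gt0 vr_mono nu0; rewrite E leNgt h.
by apply: (letter_lt vr_gt0 vr_mono ns (x := (ord0, 0%N))); rewrite in_mset1.
Qed.

Lemma mu_eps_OE w : (1 <= mabs w)%N -> OE 1 (mu_eps eps w).
Proof.
move=> w1; apply: (OE_weak e_gt0 e_to0) (_ : OE (mabs w)%:R _); first by rewrite ler1n.
rewrite /mu_eps /mabs; elim: (index_enum _) => [|l s IH].
  by apply: (@OE_eq _ _ _ _ (fun=> 1)); [move=> t; rewrite big_nil|rewrite big_nil; exact: OE_cst].
apply: (@OE_eq _ _ _ _ (fun t => eps l t ^+ w l * \prod_(i <- s) eps i t ^+ w i)).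
  by move=> t; rewrite big_cons.
rewrite big_cons natrD; apply: (OE_mul e_gt0) => //.
by rewrite -[(w l)%:R]mulr1; apply: (OE_pow e_gt0); exact: (eps_OE1 vr_gt0 vr_mono e_gt0 e_to0 lval_OE).
Qed.

Lemma rest_to0 j : rest j t @[t --> +oo] --> (0 : R).
Proof.
rewrite -[X in _ --> X]addr0; apply: cvgD.
  have i0 : 0 < (vr ord0)^-1 by rewrite invr_gt0.
  apply: (OE_to0 e_gt0 e_to0 i0).
  apply: (@OE_eq _ _ _ _ (fun t => (varpi - kappa) * ((e t)^-1 * deriv_on t0 e t))).
    by move=> t; ring.
  apply: (OE_scale e_gt0).
  (* The derivative of eps_1 is O(eps_1^(1 + 1 / vr_1)), so its logarithmic derivative is O(eps_1^(1
     / vr_1)). *)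
  have -> : (vr ord0)^-1 = -1 + (vr ord0 + 1%:R) / vr ord0 by field; rewrite gt_eqF.
  apply: (OE_mul e_gt0); last exact: (lval_OE p_ord0_gt0).
  exists 1; apply/(iffRL (evP _)); exists t0 => t Tt.
  by rewrite mul1r powR_inv1 ?(ltW (e_gt0 Tt)) // gtr0_norm // invr_gt0 e_gt0.
apply: (OE_to0 e_gt0 e_to0 ltr01).
apply: (@OE_eq _ _ _ _ (fun t => \sum_(w <- W) complex.Re (gamma j w) * mu_eps eps w t)).
  by move=> t; rewrite sum_mu.
by apply: OE_sum => w /W_mabs w1; apply: (OE_scale e_gt0); exact: mu_eps_OE.
Qed.

Lemma mu_eps_cont w : continuous_on t0 (mu_eps eps w).
Proof.
apply: continuous_on_prod => l _; elim: (w l) => [|q IH].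
  by apply: (@continuous_on_eq _ R t0 _ (fun=> 1)) => [t _|x]; [exact: expr0|exact: cvg_cst].
apply: (@continuous_on_eq _ R t0 _ (fun t => eps l t * eps l t ^+ q)) => [t _|].
  exact: exprS.
by apply: continuous_onM => //; exact: (eps_cont H1_C).
Qed.

Lemma de_cont : continuous_on t0 (deriv_on t0 e).
Proof. exact: (H1_C ord0).2 1%N p_ord0_gt0. Qed.

Lemma hfun_cont j : continuous_on t0 (hfun j).
Proof.
apply: (@continuous_on_eq _ R t0 _ (fun t => complex.Re (lam j) +
  ((varpi - kappa) * (e t)^-1 * deriv_on t0 e t
       + \sum_(w <- W) complex.Re (gamma j w) * mu_eps eps w t))) => [t _|].
  by rewrite hfunE /rest sum_mu.
apply: continuous_onD; first exact: continuous_on_cst.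
apply: continuous_onD.
  apply: continuous_onM; last exact: de_cont.
  apply: continuous_onM; first exact: continuous_on_cst.
  apply: continuous_onV; last exact: (eps_cont H1_C).
  by move=> t Tt; rewrite gt_eqF // e_gt0.
apply: continuous_on_sum => w _; apply: continuous_onM; first exact: continuous_on_cst.
exact: mu_eps_cont.
Qed.

Lemma diverges_le (g : R -> R) : diverges_to_ninfty tQ g ->
  forall B : R, exists T, forall t, T <= t -> integral_to tQ g t <= B.
Proof. by move=> /cvgrNyPle h B; apply/(iffLR (evP _)); exact: (h B). Qed.

Lemma hfun_contQ j : continuous_on tQ (hfun j).
Proof. exact: continuous_on_sub t0Q (@hfun_cont j). Qed.

Lemma integral_hfun j t : tQ < t -> is_derive t (1:R) (integral_to tQ (hfun j)) (hfun j t).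
Proof. by move=> tt; apply: integral_to_derive => //; exact: hfun_contQ. Qed.

Lemma diverges_not_ge0 j T : diverges_to_ninfty tQ (hfun j) ->
  ~ (forall t, T <= t -> 0 <= hfun j t).
Proof.
move=> /diverges_le hd h0.
pose T1 := Num.max T (tQ + 1).
have [T2 H2] := hd (integral_to tQ (hfun j) T1 - 1).
pose t := Num.max T1 T2.
have T1Q : tQ < T1 by rewrite lt_max ltrDl ltr01 orbT.
have T1t : T1 <= t by rewrite le_max lexx.
have := H2 t; rewrite le_max lexx orbT => /(_ isT).
have : integral_to tQ (hfun j) T1 <= integral_to tQ (hfun j) t; last by lra.
have dI u : T1 <= u -> is_derive u (1:R) (integral_to tQ (hfun j)) (hfun j u).
  by move=> T1u; apply: integral_hfun; exact: lt_le_trans T1u.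
apply: (@derive_ge0_le R T1 _ (hfun j)) => // [|u /ltW|u /ltW T1u].
- exact: is_derive_continuous_on dI.
- exact: dI.
- by apply: h0; apply: le_trans T1u; rewrite le_max lexx.
Qed.

(** A nonzero real part of lam j decides the sign because [rest] tends to 0, and a positive one
    would contradict the divergence. If the real part is 0, the sign hypothesis takes over. *)
Lemma hfun_sign j : diverges_to_ninfty tQ (hfun j) ->
  exists T, forall t, T <= t -> hfun j t <= 0.
Proof.
move=> hd; have r0 := @rest_to0 j.
have [l0|l0|l0] := ltgtP (complex.Re (lam j)) 0.
- have x0 : 0 < - complex.Re (lam j) by rewrite oppr_gt0.
  have /cvg_evP/(_ _ x0)[T H] := r0; exists T => t Tt; rewrite hfunE.
  have := H t Tt; rewrite sub0r normrN => h.
  by have := ler_norm (rest j t); lra.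
- exfalso; have /cvg_evP/(_ _ l0)[T H] := r0.
  apply: (@diverges_not_ge0 j T hd) => t Tt; rewrite hfunE.
  have := H t Tt; rewrite sub0r normrN => h.
  by have := ler_norm (- rest j t); rewrite normrN; lra.
- have := H10 (varpi - kappa) (fun w => complex.Re (gamma j w)) => /= -[/evP[T H]|/evP[T H]].
    exfalso; apply: (@diverges_not_ge0 j T hd) => t Tt.
    by rewrite hfunE l0 add0r; exact: H.
  by exists T => t Tt; rewrite hfunE l0 add0r; exact: H.
Qed.

Lemma Revsig_cont j : continuous_on tQ (fun t => complex.Re (vsig j t)).
Proof. by have [] := vsigP j. Qed.

(** An antiderivative differs by a constant from the integral from tQ, which converges, so it is
    bounded from some time on. *)
Lemma vsig_antiderivative j : exists Vs B, (forall t, tQ <= t ->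
    is_derive t (1:R) Vs (complex.Re (vsig j t))) /\
  exists2 T, tQ < T & forall t, T <= t -> `|Vs t| <= B.
Proof.
have [Vs dVs] := antiderivative_exists (@Revsig_cont j).
have [[[_ cI] _] _ _] := vsigP j.
have [l hl] : exists l : R, integral_to tQ (@complex.Re R \o vsig j) t @[t --> +oo] --> l.
  by move: cI => /cvg_ex.
have /cvg_evP/(_ 1 ltr01)[T HT] := hl.
pose T1 := Num.max T (tQ + 1).
have T1Q : tQ < T1 by rewrite lt_max ltrDl ltr01 orbT.
exists Vs, (`|Vs T1| + 2); split => //; exists T1 => // t Tt.
have dI u : tQ < u -> is_derive u (1:R) (integral_to tQ (@complex.Re R \o vsig j)) (complex.Re (vsig j u)).
  by move=> uu; apply: (@integral_to_derive R tQ (@complex.Re R \o vsig j)) => //; exact: Revsig_cont.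
have E := antiderivative_diff (fun u (hu : tQ < u) => dVs u (ltW hu)) dI T1Q (lt_le_trans T1Q Tt).
have h1 : `|l - integral_to tQ (@complex.Re R \o vsig j) t| < 1.
  by apply: HT; apply: le_trans Tt; rewrite le_max lexx.
have h2 : `|l - integral_to tQ (@complex.Re R \o vsig j) T1| < 1.
  by apply: HT; rewrite le_max lexx.
have -> : Vs t = Vs T1 + ((l - integral_to tQ (@complex.Re R \o vsig j) T1) -
   (l - integral_to tQ (@complex.Re R \o vsig j) t)).
  have -> : (l - integral_to tQ (@complex.Re R \o vsig j) T1) -
   (l - integral_to tQ (@complex.Re R \o vsig j) t) = integral_to tQ (@complex.Re R \o vsig j) t -
    integral_to tQ (@complex.Re R \o vsig j) T1 by ring.
  by rewrite -E; ring.
apply: le_trans (ler_normD _ _) _; rewrite lerD2l.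
by apply: le_trans (ler_normB _ _) _; lra.
Qed.

Notation div j := (diverges_to_ninfty tQ (hfun j)).
Notation p := (pjj t0 varpi kappa eps lam gamma vsig).

(** The kernel is expR (H + Vs) with H an antiderivative of [hfun], eventually monotone, and |Vs| <=
    B. Exchanging the value of Vs at one time for that at another costs at most expR (2 * B), which
    is M. *)
Lemma kernel_exists j : (forall t, tQ <= t -> 0 <= hfun j t) \/ div j ->
  exists (E : R -> R) (M T : R), [/\ 0 < M, tQ < T,
    forall t, T <= t -> 0 < E t,
    forall t, T <= t -> is_derive t (1:R) E (p j t * E t) &
    [/\ div j -> forall s t, T <= s -> s <= t -> E t <= M * E s,
        ~ div j -> forall s t, T <= s -> s <= t -> E s <= M * E t &
        div j -> E t @[t --> +oo] --> (0 : R)]].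
Proof.
move=> hyp.
have [H dH] := antiderivative_exists (@hfun_contQ j).
have [Vs [B [dV [T1 QT1 HB]]]] := vsig_antiderivative j.
have B0 : 0 <= B by apply: le_trans (HB T1 (lexx _)).
have dE t : tQ <= t -> is_derive t (1:R) (fun u => expR (H u + Vs u)) (p j t * expR (H t + Vs t)).
  move=> tt; have := dexp (dD (dH t tt) (dV t tt)).
  by rewrite mulrC /hfun subrK.
have monoP (g dg : R -> R) T : tQ < T -> (forall t, tQ <= t -> is_derive t (1:R) g (dg t)) ->
   (forall t, T <= t -> 0 <= dg t) -> forall s t, T <= s -> s <= t -> g s <= g t.
  move=> /ltW QT hg h0; apply: (@derive_ge0_le R T g dg) => [|x /ltW|x /ltW]; [|by move/(le_trans QT)/hg|exact: h0].
  by apply: (@is_derive_continuous_on R T g dg) => x /(le_trans QT)/hg.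
have expB (x y u v : R) : x <= y -> `|u| <= B -> `|v| <= B -> expR (x + u) <= expR (2 * B) * expR (y + v).
  move=> xy; rewrite !ler_norml => /andP[u1 u2] /andP[v1 v2].
  by rewrite -expRD ler_expR; lra.
have [hd|hd] := pselect (div j).
  have [T2 H2] := hfun_sign hd.
  pose T := Num.max T1 T2.
  have QT : tQ < T by rewrite lt_max QT1.
  have T1T : T1 <= T by rewrite le_max lexx.
  exists (fun u => expR (H u + Vs u)), (expR (2 * B)), T; split => //.
  - exact: expR_gt0.
  - by move=> t _; exact: expR_gt0.
  - by move=> t Tt; apply: dE; rewrite (le_trans (ltW QT)).
  split => // [_ s t Ts st|_].
    apply: expB; last 2 first.
    - by apply: HB; rewrite (le_trans T1T) // (le_trans Ts).
    - by apply: HB; rewrite (le_trans T1T).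
    have := monoP (fun u => - H u) (fun u => - hfun j u) T QT (fun t tt => dN (dH t tt)).
    move=> /(_ _ s t Ts st); rewrite lerN2; apply => u Tu; rewrite oppr_ge0 H2 //.
    by apply: le_trans Tu; rewrite le_max lexx orbT.
  apply/cvg_evP => x x0.
  have dI := @integral_hfun j.
  (* The threshold is solved from H t + Vs t < ln x, using that H t - H T is the increment of the
     integral of [hfun] and that Vs t <= B. *)
  have [T3 H3] := diverges_le hd (integral_to tQ (hfun j) T - H T - B + ln x - 1).
  exists (Num.max T T3) => t; rewrite ge_max => /andP[Tt T3t].
  rewrite sub0r normrN gtr0_norm ?expR_gt0 //.
  rewrite -[X in _ < X](lnK x0) ltr_expR.
  have E := antiderivative_diff (fun u (hu : tQ < u) => dH u (ltW hu)) dI QT (lt_le_trans QT Tt).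
  have := H3 t T3t; have := HB t (le_trans T1T Tt); have := ler_norm (Vs t).
  by move: E; lra.
case: hyp => // h0.
exists (fun u => expR (H u + Vs u)), (expR (2 * B)), T1; split => //.
- exact: expR_gt0.
- by move=> t _; exact: expR_gt0.
- by move=> t Tt; apply: dE; rewrite (le_trans (ltW QT1)).
split => // _ s t Ts st; apply: expB; last 2 first.
- exact: HB.
- by apply: HB; exact: le_trans st.
apply: (monoP H (hfun j) T1 QT1 dH) => // u Tu.
by apply: h0; exact: le_trans (ltW QT1) Tu.
Qed.

End kernels.

(** * The equation of Q and the estimates for the reduced nonlinearity *)

Section transformation.
Context {R : realType} {n : nat}.
Notation vec := ('cV[R]_n).

(** [transforms] speaks of solutions only. Tested on the fundamental solutions exp(int Re d_j) e_j
    of the diagonal system it yields the columns of Q times a scalar exponential; dividing by that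
    factor leaves Q' = B Q - Q Re D. *)
Lemma transforms_derive (tQ : R) (B Q : R -> 'M[R]_n) (d : 'I_n -> R -> R[i]) :
  (forall j, continuous_on tQ (fun t => complex.Re (d j t))) ->
  transforms tQ Q B (ReD d) ->
  forall t i j, tQ < t -> is_derive t (1:R) (fun u => Q u i j) ((B t *m Q t - Q t *m ReD d t) i j).
Proof.
move=> cd tr t i j tt.
have [X dX] := antiderivative_exists (cd j).
pose E u := expR (X u).
have dE u : tQ <= u -> is_derive u (1:R) E (E u * complex.Re (d j u)).
  by move=> uu; apply: dexp; exact: dX.
pose x u : vec := E u *: delta_mx j 0.
have xs : solves tQ (fun t x => ReD d t *m x) x.
  move=> u uu; apply/has_deriv_coord => l l'; rewrite ord1.
  have -> : (fun v => x v l 0) = fun v => (l == j)%:R * E v.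
    by apply/funext => v; rewrite !mxE eqxx andbT mulrC.
  apply: is_derive_has_deriv.
  have -> : (ReD d u *m x u) l 0 = (l == j)%:R * (E u * complex.Re (d j u)).
    rewrite /ReD mul_diag_mx !mxE eqxx andbT; case: eqP => [->|_] /=; ring.
  exact/dZ/dE.
have Qx u : (Q u *m x u) = E u *: col j (Q u).
  by rewrite /x -scalemxAr colE.
have /(tr x) xs' := xs; have := xs' t (ltW tt).
move=> /has_deriv_coord/(_ i 0)/(has_deriv_is_derive tt).
have -> : (fun u => (Q u *m x u) i 0) = fun u => E u * Q u i j.
  by apply/funext => u; rewrite Qx !mxE.
have -> : (B t *m (Q t *m x t)) i 0 = E t * (B t *m Q t) i j.
  rewrite Qx -scalemxAr mxE; congr (_ * _); rewrite !mxE; apply: eq_bigr => l _.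
  by rewrite !mxE.
move=> dQE.
have -> : (fun u => Q u i j) = fun u => expR (- X u) * (E u * Q u i j).
  by apply/funext => u; rewrite mulrA -expRD addrC subrr expR0 mul1r.
have H := dM (dexp (dN (dX t (ltW tt)))) dQE.
apply: (eq_ind _ (is_derive t (1:R) _) H).
have EE : expR (- X t) * E t = 1 by rewrite -expRD addrC subrr expR0.
rewrite [RHS]mxE [X in _ = _ + X]mxE /ReD mul_mx_diag [X in _ = _ - X]mxE [X in _ = _ - _ * X]mxE.
set u := (B t *m Q t) i j; set v := complex.Re (d j t); set q := Q t i j.
have -> : expR (- X t) * - v * (E t * q) + expR (- X t) * (E t * u) =
   (expR (- X t) * E t) * (u - q * v) by ring.
by rewrite EE mul1r.
Qed.

Variables (e : R -> R) (T1 sigma varpi kappa a C : R) (G : R -> vec -> vec) (Q : R -> 'M[R]_n).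
Variables (CQ c : R).
Hypothesis a_gt0 : 0 < a.
Hypothesis e_gt0 : forall t, T1 <= t -> 0 < e t.
Hypothesis e_to0 : e t @[t --> +oo] --> (0 : R).
Hypothesis e_cont : continuous_on T1 e.
Hypothesis sigma_gt0 : 0 < sigma.
Hypothesis kappaE : kappa = sigma + varpi.
Hypothesis varpi_le : varpi <= 1 + sigma.
Hypothesis C0 : 0 <= C.
Hypothesis G0 : forall t, T1 <= t -> `|G t 0| <= C * e t `^ kappa.
Hypothesis GL : forall t r r' M, T1 <= t -> M <= a -> `|r| <= M -> `|r'| <= M ->
  `|G t r - G t r'| <= C * e t * M * `|r - r'|.
Hypothesis Gc : forall T (z : R -> vec), T1 <= T -> continuous_on T z ->
  (forall t, T <= t -> `|z t| <= a) -> continuous_on T (fun t => G t (z t)).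
Hypothesis c0 : 0 < c.
Hypothesis QC : forall t, T1 <= t -> `|Q t| <= CQ.
Hypothesis Qdet : forall t, T1 <= t -> c <= `|\det (Q t)|.
Hypothesis Qcont : continuous_on T1 Q.

(* The nonlinearity in terms of z, where r = e^sigma Q z. *)
Definition reduced (t : R) (z : vec) : vec :=
  e t `^ (- sigma) *: (invmx (Q t) *m G t (e t `^ sigma *: (Q t *m z))).

Lemma reduced_estimates : exists C4 T2, [/\ 0 <= C4, T1 <= T2,
  forall t (z : vec), T2 <= t -> `|z| <= 1 -> `|e t `^ sigma *: (Q t *m z)| <= a,
  forall t, T2 <= t -> `|reduced t 0| <= C4 * e t `^ varpi &
  (forall t z z', T2 <= t -> `|z| <= 1 -> `|z'| <= 1 ->
    `|reduced t z - reduced t z'| <= C4 * e t `^ varpi * `|z - z'|) /\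
  (forall T (z : R -> vec), T2 <= T -> continuous_on T z -> (forall t, T <= t -> `|z t| <= 1) ->
     continuous_on T (fun t => reduced t (z t)))].
Proof.
have [B hB] := @invmx_bounded R n CQ c c0.
have B0 : 0 <= B by apply: le_trans (hB (Q T1) (QC (lexx _)) (Qdet (lexx _))).
have CQ0 : 0 <= CQ by apply: le_trans (QC (lexx T1)).
pose N : R := n%:R.
have N0 : 0 <= N by rewrite ler0n.
have [T2' hT2'] : exists T, forall t, T <= t -> e t `^ sigma * (N * CQ) <= a.
  have /cvg_evP H : e t `^ sigma @[t --> +oo] --> (0 : R).
    apply: (OE_to0 e_gt0 e_to0 sigma_gt0); exists 1; apply: nearW => t.
    by rewrite mul1r ger0_norm // powR_ge0.
  have x0 : 0 < a / (N * CQ + 1) by rewrite divr_gt0 // ltr_wpDl // mulr_ge0.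
  have [T HT] := H _ x0; exists T => t Tt; have := HT t Tt.
  rewrite sub0r normrN ger0_norm ?powR_ge0 // ltr_pdivlMr; last by rewrite ltr_wpDl // mulr_ge0.
  move=> /ltW h; apply: le_trans h; apply: ler_wpM2l; first exact: powR_ge0.
  by rewrite lerDl.
have [T3 T13 hT3] := e_le1 T1 e_to0.
pose T2 := Num.max T3 T2'.
have T12 : T1 <= T2 by rewrite le_max T13.
(* The first summand serves the value at z = 0, the second the Lipschitz constant. *)
pose C4 := N * B * C + N * B * C * (N * CQ) * (N * CQ).
have C40 : 0 <= C4 by rewrite addr_ge0 // !mulr_ge0.
have small t (z : vec) : T2 <= t -> `|z| <= 1 -> `|e t `^ sigma *: (Q t *m z)| <= e t `^ sigma * (N * CQ).
  move=> Tt z1; have T1t := le_trans T12 Tt.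
  rewrite normrZ (ger0_norm (powR_ge0 _ _)); apply: ler_wpM2l; first exact: powR_ge0.
  apply: le_trans (mulmx_norm_le _ _) _; apply: ler_wpM2l => //.
  by rewrite -[leRHS]mulr1; apply: ler_pM => //; exact: QC.
have smalla t : T2 <= t -> e t `^ sigma * (N * CQ) <= a.
  by move=> Tt; apply: hT2'; apply: le_trans Tt; rewrite le_max lexx orbT.
have cQ T : T2 <= T -> continuous_on T Q by move=> TT; exact: continuous_on_sub (le_trans T12 TT) Qcont.
have ce T (x : R) : T2 <= T -> continuous_on T (fun t => e t `^ x).
  move=> TT; apply: continuous_on_powR; last exact: continuous_on_sub (le_trans T12 TT) e_cont.
  by move=> t Tt; apply: e_gt0; rewrite (le_trans T12) // (le_trans TT).
have inner T (z : R -> vec) : T2 <= T -> continuous_on T z ->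
    continuous_on T (fun t => e t `^ sigma *: (Q t *m z t)).
  move=> TT cz; apply: continuous_on_scalev; first exact: ce.
  by apply: continuous_on_mulmx => //; exact: cQ.
exists C4, T2; split => //.
- by move=> t z Tt z1; exact: le_trans (small t z Tt z1) (smalla t Tt).
- move=> t Tt; have T1t := le_trans T12 Tt; have et := e_gt0 T1t.
  rewrite /reduced mulmx0 scaler0 normrZ (ger0_norm (powR_ge0 _ _)).
  have h1 : `|invmx (Q t) *m G t 0| <= N * (B * (C * e t `^ kappa)).
    apply: le_trans (mulmx_norm_le _ _) _; apply: ler_wpM2l => //.
    by apply: ler_pM => //; [apply: hB; [exact: QC|exact: Qdet]|exact: G0].
  apply: le_trans (ler_wpM2l (powR_ge0 _ _) h1) _.
  have -> : e t `^ kappa = e t `^ sigma * e t `^ varpi by rewrite kappaE powR_add.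
  have E1 : e t `^ (- sigma) * e t `^ sigma = 1.
    by rewrite -powR_add // addNr powRr0.
  have -> : e t `^ (- sigma) * (N * (B * (C * (e t `^ sigma * e t `^ varpi)))) =
     (e t `^ (- sigma) * e t `^ sigma) * (N * B * C * e t `^ varpi) by ring.
  rewrite E1 mul1r; apply: ler_wpM2r; first exact: powR_ge0.
  by rewrite /C4 lerDl !mulr_ge0.
split.
  move=> t z z' Tt z1 z1'; have T1t := le_trans T12 Tt; have et := e_gt0 T1t.
  rewrite /reduced -scalerBr -mulmxBr normrZ (ger0_norm (powR_ge0 _ _)).
  (* The radius M is the shrinking bound e [^ sigma N CQ for r; with a fixed radius one factor e]^
     sigma would be lost. *)
  have hG := GL T1t (smalla t Tt) (small t z Tt z1) (small t z' Tt z1').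
  have hd : `|e t `^ sigma *: (Q t *m z) - e t `^ sigma *: (Q t *m z')| <= e t `^ sigma * (N * CQ * `|z - z'|).
    rewrite -scalerBr -mulmxBr normrZ (ger0_norm (powR_ge0 _ _)); apply: ler_wpM2l; first exact: powR_ge0.
    apply: le_trans (mulmx_norm_le _ _) _; rewrite -mulrA; apply: ler_wpM2l => //.
    by apply: ler_wpM2r => //; exact: QC.
  have K0 : 0 <= C * e t * (e t `^ sigma * (N * CQ)).
    by rewrite !mulr_ge0 ?powR_ge0 // ltW.
  have {}hG := le_trans hG (ler_wpM2l K0 hd).
  set GG := G t _ - G t _ in hG *.
  have h1 : `|invmx (Q t) *m GG| <= N * (B * (C * e t * (e t `^ sigma * (N * CQ)) * (e t `^ sigma * (N * CQ * `|z - z'|)))).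
    apply: le_trans (mulmx_norm_le _ _) _; apply: ler_wpM2l => //.
    by apply: ler_pM => //; apply: hB; [exact: QC|exact: Qdet].
  apply: le_trans (ler_wpM2l (powR_ge0 _ _) h1) _.
  have E1 : e t `^ (- sigma) * e t `^ sigma = 1.
    by rewrite -powR_add // addNr powRr0.
  have E2 : e t * e t `^ sigma = e t `^ (1 + sigma) by rewrite powR_add // powRr1 // ltW.
  have -> : e t `^ (- sigma) * (N * (B * (C * e t * (e t `^ sigma * (N * CQ)) * (e t `^ sigma * (N * CQ * `|z - z'|))))) =
    (e t `^ (- sigma) * e t `^ sigma) * (e t * e t `^ sigma) * (N * B * C * (N * CQ) * (N * CQ)) * `|z - z'| by ring.
  rewrite E1 mul1r E2; apply: ler_wpM2r => //.
  rewrite mulrC; apply: ler_pM; rewrite ?powR_ge0 ?mulr_ge0 //.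
    by rewrite /C4 lerDr !mulr_ge0.
  apply: ger_powR => //; rewrite et hT3 //.
  by apply: le_trans Tt; rewrite le_max lexx.
move=> T z TT cz z1; apply: continuous_on_scalev; first exact: ce.
apply: continuous_on_mulmx.
  apply: continuous_on_invmx; last exact: cQ.
  move=> t Tt; rewrite -normr_gt0; apply: lt_le_trans c0 (Qdet _).
  by rewrite (le_trans T12) // (le_trans TT).
apply: Gc; [exact: le_trans TT|exact: inner|].
move=> t Tt; have T2t := le_trans TT Tt.
exact: le_trans (small t _ T2t (z1 t Tt)) (smalla t T2t).
Qed.

End transformation.

(** * Uniqueness, parameters and the family of solutions *)

Section uniqueness.
Context {R : realType} {n : nat}.
Notation vec := ('cV[R]_n).

(** The maximum norm is not differentiable, so the squared Euclidean distance u is used. From |u'|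
    <= K u it follows that u expR (K t) is nondecreasing and u expR (- K t) nonincreasing; hence u
    vanishes before as well as after t'. *)
Lemma ode_unique T (L : R) (F : R -> vec -> vec) (y1 y2 : R -> vec) : 0 <= L ->
  solves T F y1 -> solves T F y2 ->
  (forall t, T <= t -> `|F t (y1 t) - F t (y2 t)| <= L * `|y1 t - y2 t|) ->
  forall t', T <= t' -> y1 t' = y2 t' -> forall t, T <= t -> y1 t = y2 t.
Proof.
move=> L0 s1 s2 hL t' Tt' E'.
pose d t (i : 'I_n) := y1 t i 0 - y2 t i 0.
pose u t := \sum_i d t i ^+ 2.
pose du t := \sum_i (2 * d t i * (F t (y1 t) i 0 - F t (y2 t) i 0)).
have u0 t : 0 <= u t by apply: sumr_ge0 => i _; exact: sqr_ge0.
have nd t : `|y1 t - y2 t| <= Num.sqrt (u t).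
  apply/mx_norm_leP => [|i j]; first exact: sqrtr_ge0.
  rewrite ord1 !mxE -sqrtr_sqr ler_wsqrtr // /u (bigD1 i) //= lerDl.
  by apply: sumr_ge0 => l _; exact: sqr_ge0.
have u_eq t : u t <= 0 -> y1 t = y2 t.
  move=> ut; apply/eqP; rewrite -subr_eq0 -normr_le0; apply: le_trans (nd t) _.
  by have -> : u t = 0; [apply/eqP; rewrite eq_le ut u0|rewrite sqrtr0].
have cd i : continuous_on T (fun t => d t i).
  apply: continuous_onD; last apply: continuous_onN.
    by apply: (@continuous_on_coord _ _ _ T y1); exact: (has_deriv_continuous_on s1).
  by apply: (@continuous_on_coord _ _ _ T y2); exact: (has_deriv_continuous_on s2).
have cu : continuous_on T u by apply: continuous_on_sum => i _; apply: continuous_onM; exact: cd.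
have dd t i : T < t -> is_derive t (1:R) (fun t => d t i) (F t (y1 t) i 0 - F t (y2 t) i 0).
  move=> Tt; apply: dB.
    by have /has_deriv_coord/(_ i 0)/(has_deriv_is_derive Tt) := s1 t (ltW Tt).
  by have /has_deriv_coord/(_ i 0)/(has_deriv_is_derive Tt) := s2 t (ltW Tt).
have dut t : T < t -> is_derive t (1:R) u (du t).
  by move=> Tt; apply: dsum => i _; have := dX 2 (dd t i Tt).
pose K := n%:R * (2 * L).
have duK t : T < t -> `|du t| <= K * u t.
  move=> Tt; apply: le_trans (ler_norm_sum _ _ _) _.
  rewrite /K -mulrA -[X in X%:R * _]card_ord mulr_natl -sumr_const; apply: ler_sum => i _.
  have a1 : `|d t i| <= `|y1 t - y2 t| by have := mx_norm_coord (y1 t - y2 t) i 0; rewrite !mxE.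
  have a2 : `|F t (y1 t) i 0 - F t (y2 t) i 0| <= L * `|y1 t - y2 t|.
    by apply: le_trans (hL t (ltW Tt)); have := mx_norm_coord (F t (y1 t) - F t (y2 t)) i 0; rewrite !mxE.
  rewrite !normrM (ger0_norm (ler0n _ 2)).
  have h := ler_pM (normr_ge0 _) (normr_ge0 _) a1 a2.
  have h2 : `|y1 t - y2 t| * `|y1 t - y2 t| <= u t.
    rewrite -(sqr_sqrtr (u0 t)) expr2; exact: ler_pM (nd t) (nd t).
  rewrite -!mulrA ler_pM2l //; apply: le_trans h _.
  by rewrite mulrCA; apply: ler_wpM2l.
have dg (c : R) t : T < t -> is_derive t (1:R) (fun t => u t * expR (c * t)) ((du t + c * u t) * expR (c * t)).
  move=> Tt; have di : is_derive t (1:R) (fun x : R => x) 1 by exact: is_derive_id.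
  apply: (eq_ind _ (is_derive t (1:R) _) (dM (dut t Tt) (dexp (dZ c di)))); ring.
have cE (c : R) : continuous_on T (fun t => expR (c * t)).
  by apply: (@is_derive_continuous_on _ T _ (fun t => expR (c * t) * (c * 1))) => t _.
have cg (c : R) : continuous_on T (fun t => u t * expR (c * t)) by apply: continuous_onM.
have ut' : u t' = 0.
  by rewrite /u big1 // => i _; rewrite /d E' subrr expr0n.
move=> t Tt; apply: u_eq; have [tt|/ltW tt] := leP t t'.
  have := @derive_ge0_le R T _ _ (cg K) (dg K) _ t t' Tt tt.
  rewrite ut' mul0r => H; rewrite -(@pmulr_lle0 _ (expR (K * t))) ?expR_gt0 // H // => x Tx.
  rewrite mulr_ge0 ?expR_ge0 //; have := duK x Tx; rewrite ler_norml => /andP[]; lra.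
have := @derive_ge0_le R T _ _ (continuous_onN (cg (- K))) (fun x Tx => dN (dg (- K) x Tx)) _ t' t Tt' tt.
rewrite ut' mul0r lerN2 => H; rewrite -(@pmulr_lle0 _ (expR (- K * t))) ?expR_gt0 // H // => x Tx.
rewrite -mulNr mulr_ge0 ?expR_ge0 //; have := duK x Tx; rewrite ler_norml => /andP[]; lra.
Qed.

End uniqueness.

(** * Differentiation of s + eps_1^sigma Q z *)

Section substitution.
Context {R : realType} {n : nat}.
Notation vec := ('cV[R]_n).

Lemma mulmx_is_derive (Q : R -> 'M[R]_n) (z : R -> vec) t (dQ : 'M[R]_n) (dz : vec) i :
  (forall j, is_derive t (1:R) (fun u => Q u i j) (dQ i j)) ->
  (forall j, is_derive t (1:R) (fun u => z u j 0) (dz j 0)) ->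
  is_derive t (1:R) (fun u => (Q u *m z u) i 0) ((dQ *m z t + Q t *m dz) i 0).
Proof.
move=> hQ hz.
have -> : (fun u => (Q u *m z u) i 0) = fun u => \sum_j Q u i j * z u j 0.
  by apply/funext => u; rewrite mxE.
have H := dsum (index_enum _) (P := xpredT) (fun j _ => dM (hQ j) (hz j)).
apply: (eq_ind _ (is_derive t (1:R) _) H).
by rewrite big_split !mxE.
Qed.

Lemma substitution_derive t (e : R -> R) (de sigma : R) (s z : R -> vec) (ds w : vec)
  (Q : R -> 'M[R]_n) (B D : 'M[R]_n) : 0 < e t -> is_derive t (1:R) e de ->
  (forall i, is_derive t (1:R) (fun u => s u i 0) (ds i 0)) ->
  (forall i j, is_derive t (1:R) (fun u => Q u i j) ((B *m Q t - Q t *m D) i j)) ->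
  (forall j, is_derive t (1:R) (fun u => z u j 0)
     ((D *m z t - (sigma * (e t)^-1 * de) *: z t + w) j 0)) ->
  forall i, is_derive t (1:R) (fun u => (s u + e u `^ sigma *: (Q u *m z u)) i 0)
    ((ds + B *m (e t `^ sigma *: (Q t *m z t)) + e t `^ sigma *: (Q t *m w)) i 0).
Proof.
move=> et de_ ds_ dQ dz i.
have -> : (fun u => (s u + e u `^ sigma *: (Q u *m z u)) i 0) =
    fun u => s u i 0 + e u `^ sigma * (Q u *m z u) i 0.
  by apply/funext => u; rewrite !mxE.
have H := dD (ds_ i) (dM (is_derive_powR sigma et de_) (mulmx_is_derive (dQ i) dz)).
apply: (eq_ind _ (is_derive t (1:R) _) H).
rewrite powR_sub1 // !mulmxDr mulmxDl !mulNmx mulmxN -!scalemxAr !mulmxA.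
set x := Q t *m z t; set x1 := B *m Q t *m z t; set x2 := Q t *m D *m z t.
set x3 := Q t *m w; rewrite !mxE; ring.
Qed.

End substitution.

(** * Parametrization of small initial values by R^N *)

Section parameters.
Context {R : realType} {n : nat}.
Variable S : {set 'I_n}.

(* Maps the parameter space R^N injectively into the bounded set of admissible
   initial values. *)
Definition squash (x : R) : R := x / (1 + `|x|).

Lemma squash_le1 x : `|squash x| <= 1.
Proof.
have p : 0 < 1 + `|x| by rewrite ltr_wpDr.
by rewrite normrM normfV (gtr0_norm p) ler_pdivrMr // mul1r lerDr.
Qed.

Lemma squash_lip x y : `|squash x - squash y| <= 2 * `|x - y|.
Proof.
have px : 0 < 1 + `|x| by rewrite ltr_wpDr.
have py : 0 < 1 + `|y| by rewrite ltr_wpDr.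
have -> : squash x - squash y = (x - y) / (1 + `|x|) + squash y * ((`|y| - `|x|) / (1 + `|x|)).
  by rewrite /squash; field; rewrite !gt_eqF.
have h (u v : R) : `|u| <= v -> `|u / (1 + `|x|)| <= v.
  move=> uv; have v0 : 0 <= v by apply: le_trans uv.
  rewrite normrM normfV (gtr0_norm px) ler_pdivrMr //.
  by apply: le_trans uv _; rewrite ler_peMr // lerDl.
apply: le_trans (ler_normD _ _) _; rewrite mulr_natl mulr2n; apply: lerD; first exact: h.
rewrite normrM -[leRHS]mul1r; apply: ler_pM => //; first exact: squash_le1.
by apply: h; rewrite distrC; exact: ler_dist_dist.
Qed.

Lemma squash_inj : injective squash.
Proof.
move=> x y E.
have px : 0 < 1 + `|x| by rewrite ltr_wpDr.
have py : 0 < 1 + `|y| by rewrite ltr_wpDr.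
have E1 : x * (1 + `|y|) = y * (1 + `|x|).
  by move/eqP: E; rewrite /squash (eqr_div _ _ (lt0r_neq0 px) (lt0r_neq0 py)) => /eqP.
have E2 : `|x| = `|y|.
  have := congr1 Num.norm E1; rewrite !normrM (gtr0_norm px) (gtr0_norm py).
  by rewrite !mulrDr !mulr1 (mulrC `|y| `|x|) => /addIr ->.
by move: E1; rewrite E2; apply: mulIf; rewrite gt_eqF.
Qed.

(** The parameters are placed at the coordinates in S, whose initial values can be prescribed;
    elsewhere [pick] finds no index and the entry is 0. *)
Definition init_data (eta : R) (c : 'rV[R]_#|S|) : 'cV[R]_n :=
  \col_j oapp (fun i => eta * squash (c 0 i)) 0 [pick i : 'I_#|S| | enum_val i == j].

Lemma init_data_le eta c : 0 < eta -> `|init_data eta c| <= eta.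
Proof.
move=> eta0; apply/mx_norm_leP => [|j l]; first exact: ltW.
rewrite mxE; case: pickP => [i _|_] /=; last by rewrite normr0 ltW.
by rewrite normrM gtr0_norm // ler_piMr ?squash_le1 // ltW.
Qed.

Lemma init_data_lip eta c c' : 0 < eta ->
  `|init_data eta c - init_data eta c'| <= 2 * eta * `|c - c'|.
Proof.
move=> eta0; have h0 : 0 <= 2 * eta * `|c - c'| by rewrite !mulr_ge0 // ltW.
apply/mx_norm_leP => // j l; rewrite !mxE; case: pickP => [i _|_] /=; last by rewrite subrr normr0.
rewrite -mulrBr normrM (gtr0_norm eta0) [2 * eta]mulrC -mulrA ler_pM2l //.
apply: le_trans (squash_lip _ _) _; rewrite ler_pM2l //.
by have := mx_norm_coord (c - c') 0 i; rewrite !mxE.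
Qed.

Lemma init_data_inj eta c c' : 0 < eta ->
  (forall j, j \in S -> init_data eta c j 0 = init_data eta c' j 0) -> c = c'.
Proof.
move=> eta0 h; apply/rowP => i; have := h _ (enum_valP i); rewrite !mxE.
case: pickP => [i' /eqP/enum_val_inj -> /=|/(_ i)]; last by rewrite eqxx.
by move/(mulfI (lt0r_neq0 eta0))/squash_inj.
Qed.

End parameters.

(** * Solutions of the original equation obtained from the reduced one *)

Section solution_family.
Context {R : realType} {n m : nat}.
Notation vec := ('cV[R]_n).
Variables (t0 : R) (A : 'M[R]_n) (f phi0 : R -> vec) (a : R).
Variables (eps : 'I_m.+1 -> R -> R) (fl : 'I_m.+1 -> R * vec -> vec).
Variables (vr : 'I_m.+1 -> R) (rho : nat -> R) (k : nat).
Variable phi : monomial m -> R -> vec.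
Variables (lam : 'I_n -> R[i]) (varpi : R).
Variables (gamma : 'I_n -> mindex m.+1 -> R[i]) (vsig : 'I_n -> R -> R[i]).
Notation D := (tube t0 a phi0).
Notation e := (eps ord0).
Notation OE := (OE e).
Notation s0 := (s0 vr rho k).
Notation kappa := (kappa vr rho k).
Notation sigma := (kappa - varpi).
Notation s := (asym_sum t0 phi0 eps vr rho k phi).
Notation delta := (delta t0 eps vr rho k phi).
Notation dasym := (dasym t0 A f phi0 a eps fl vr rho k phi).
Notation Ah := (Ahat t0 A phi0 a eps fl vr rho k phi).
Notation G := (Gfun t0 A f phi0 a eps fl vr rho k phi).
Notation d := (dfun t0 varpi eps lam gamma vsig).
Notation p := (pjj t0 varpi kappa eps lam gamma vsig).
Notation h := (hfun t0 eps vr rho k lam varpi gamma vsig).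
Hypothesis a_gt0 : 0 < a.
Hypothesis vr_gt0 : forall l, 0 < vr l.
Hypothesis vr_mono : forall l l' : 'I_m.+1, (l <= l')%N -> vr l <= vr l'.
Hypothesis rhoP : rank_enum vr rho.
Hypothesis k_ge1 : (1 <= k)%N.
Hypothesis e_gt0 : forall t, t0 <= t -> 0 < e t.
Hypothesis e_to0 : e t @[t --> +oo] --> (0 : R).
Hypothesis lval_OE : forall l r, (r <= p_ord vr rho k l)%N ->
  OE ((vr l + r%:R) / vr ord0) (lval t0 eps (l, r)).
Hypothesis phi0_sol : solves t0 (fun t x => A *m x + f t) phi0.
Hypothesis H1_C : forall l, Cn_on t0 (p_ord vr rho k l) (eps l).
Hypothesis H2 : forall l, C0q D (y_ord vr rho k l) (fl l).
Hypothesis H3 : forall l (w : mindex n), (mabs w <= y_ord vr rho k l)%N ->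
     bounded_on D (mpartial D w (fl l)).
Hypothesis phi_bound : forall nu : monomial m, nu != mset0 -> nu \in s0 ->
  exists C, forall t, t0 <= t -> `|phi nu t| <= C.
Hypothesis phi_sol : forall nu : monomial m, nu != mset0 -> nu \in s0 ->
  solves t0 (fun t x => A *m x + g_coef t0 phi0 a fl phi nu t) (phi nu).
Hypothesis phi_C1 : forall nu : monomial m, nu != mset0 -> nu \in s0 -> Cn_on t0 1 (phi nu).
Hypothesis f_cont : continuous_on t0 f.
Hypothesis H5 : conv_int_p t0 varpi e.
Hypothesis H10 : forall (g1 : R) (gw : mindex m.+1 -> R),
     let h := fun t => g1 * (e t)^-1 * deriv_on t0 e t
       + \sum_(w \in mu_indices t0 varpi eps) gw w * mu_eps eps w t in
     (\forall t \near +oo, 0 <= h t) \/ (\forall t \near +oo, h t <= 0).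
Hypothesis sigma_gt0 : 0 < sigma.
Hypothesis varpi_le : varpi <= 1 + sigma.
Variables (tQ : R) (Q : R -> 'M[R]_n).
Hypothesis t0Q : t0 <= tQ.
Hypothesis Qlyap : lyapunov_matrix tQ Q.
Hypothesis vsigP : forall j, [/\ conv_int_C tQ (vsig j),
                   continuous_on tQ (@complex.Re R \o vsig j) &
                   continuous_on tQ (@complex.Im R \o vsig j)].
Hypothesis tr : transforms tQ Q Ah (ReD d).
Hypothesis h_cases : forall j, (forall t, tQ <= t -> 0 <= h j t) \/
               diverges_to_ninfty tQ (h j).
Implicit Types (t T M : R) (z : R -> vec).

Lemma d_cont j : continuous_on tQ (fun t => complex.Re (d j t)).
Proof.
apply: (@continuous_on_eq _ R tQ _ (fun t => complex.Re (lam j) +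
  \sum_(w <- W t0 eps varpi) complex.Re (gamma j w) * mu_eps eps w t + complex.Re (vsig j t))).
  by move=> t _; exact: dfun_Re.
apply: continuous_onD; last by have [] := vsigP j.
apply: continuous_onD; first exact: continuous_on_cst.
apply: continuous_on_sum => w _; apply: continuous_onM; first exact: continuous_on_cst.
by apply: (continuous_on_sub t0Q); exact: (mu_eps_cont H1_C).
Qed.

Lemma Q_derive t i j : tQ < t ->
  is_derive t (1:R) (fun u => Q u i j) ((Ah t *m Q t - Q t *m ReD d t) i j).
Proof. by move=> tt; exact: (transforms_derive (d:=d) (@d_cont) tr). Qed.

Lemma e_derive t : t0 < t -> is_derive t (1:R) e (deriv_on t0 e t).
Proof.
move=> tt; have [v hv] := (H1_C ord0).1 0%N (p_ord0_gt0 vr_gt0 vr_mono rhoP k_ge1) t (ltW tt).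
rewrite (has_deriv_unique (ltW tt) hv); exact: has_deriv_is_derive tt hv.
Qed.

Definition lift_sol z t : vec := s t + e t `^ sigma *: (Q t *m z t).

Lemma Q_unit t : tQ <= t -> Q t \in unitmx.
Proof.
have [_ _ _ [c [c0 hc]]] := Qlyap.
by move=> tt; rewrite unitmxE unitfE -normr_gt0; exact: lt_le_trans (hc t tt).
Qed.

Lemma lift_sol_solves T z : tQ < T ->
  (forall t, T <= t -> `|delta t| <= a / 2) ->
  (forall t, T <= t -> `|e t `^ sigma *: (Q t *m z t)| <= a / 2) ->
  (forall t j, T <= t -> is_derive t (1:R) (fun u => z u j 0)
     (p j t * z t j 0 + reduced e sigma G Q t (z t) j 0)) ->
  solves_in_tube t0 A f phi0 a eps fl T (lift_sol z).
Proof.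
move=> QT hd hz dz; split => [t Tt|t Tt].
  apply: (tube_sr phi0 vr_gt0 vr_mono rhoP k_ge1) (hd t Tt) (hz t Tt).
  by apply: le_trans t0Q _; apply: le_trans (ltW QT) Tt.
have tt := lt_le_trans QT Tt; have t0t := le_lt_trans t0Q tt.
have et := e_gt0 (ltW t0t).
apply/has_deriv_coord => i j; rewrite ord1; apply: is_derive_has_deriv.
have ds l := asym_is_derive vr_gt0 vr_mono rhoP k_ge1 phi0_sol H1_C phi_sol l t0t.
(* p_jj equals Re d_j minus sigma times the logarithmic derivative of eps_1, which is the form that
   [substitution_derive] expects. *)
have dz' l : is_derive t (1:R) (fun u => z u l 0) ((ReD d t *m z t -
    (sigma * (e t)^-1 * deriv_on t0 e t) *: z t + reduced e sigma G Q t (z t)) l 0).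
  apply: (eq_ind _ (is_derive t (1:R) _) (dz t l Tt)).
  rewrite /ReD mul_diag_mx !mxE /pjj; ring.
have H := substitution_derive (sigma := sigma) et (e_derive t0t) ds (fun i j => Q_derive i j tt) dz' i.
apply: (eq_ind _ (is_derive t (1:R) _) H).
rewrite /reduced -[Q t *m (_ *: _)]scalemxAr [X in _ + X]scalerA -powR_add // subrr powRr0 scale1r.
rewrite mulKVmx ?Q_unit ?ltW // /Gfun; congr (fun_of_matrix _ i 0).
by rewrite addrC -[X in X + _]addrA -opprD subrK.
Qed.

Lemma powR_integral_bound C4 : 0 <= C4 -> exists V Vinf,
  [/\ forall t, tQ < t -> is_derive t (1:R) V (C4 * e t `^ varpi),
      V t @[t --> +oo] --> (Vinf : R) & forall t, tQ < t -> V t <= Vinf].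
Proof.
(* Hypothesis 5 is stated with |e|, which agrees with e only on the half-line. *)
move=> C40; pose g t := `|e t| `^ varpi.
have gE t : t0 <= t -> g t = e t `^ varpi by move=> tt; rewrite /g gtr0_norm // e_gt0.
have cg : continuous_on t0 g.
  apply: (continuous_on_eq gE); apply: continuous_on_powR => //.
  exact: (H1_C ord0).2 0%N isT.
have [_ cI] := H5.
have [l hl] : exists l : R, integral_to t0 g t @[t --> +oo] --> l by move: cI => /cvg_ex.
have dV t : tQ < t -> is_derive t (1:R) (fun t => C4 * integral_to t0 g t) (C4 * e t `^ varpi).
  move=> tt; have t0t := le_lt_trans t0Q tt.
  rewrite -gE ?ltW //; apply: dZ; exact: integral_to_derive.
have cV : C4 * integral_to t0 g t @[t --> +oo] --> C4 * l by apply: cvgM => //; exact: cvg_cst.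
exists (fun t => C4 * integral_to t0 g t), (C4 * l); split => // t tt.
rewrite -lerN2; apply: (@cvg_ev_le R (fun t => - (C4 * integral_to t0 g t)) _ _ t).
  exact: cvgN.
move=> u tu; rewrite lerN2; apply: (derive_le dV) => // x tx.
by rewrite mulr_ge0 // powR_ge0.
Qed.

Lemma kernels_exist : exists (E : 'I_n -> R -> R) M T, [/\ 0 < M, tQ < T,
  forall j t, T <= t -> 0 < E j t /\ is_derive t (1:R) (E j) (p j t * E j t),
  forall j, diverges_to_ninfty tQ (h j) ->
    (forall s t, T <= s -> s <= t -> E j t <= M * E j s) /\ E j t @[t --> +oo] --> (0 : R) &
  forall j, ~ diverges_to_ninfty tQ (h j) ->
    forall s t, T <= s -> s <= t -> E j s <= M * E j t].
Proof.
have /choice[X XP] (j : 'I_n) : exists X : (R -> R) * R * R,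
  [/\ 0 < X.1.2, tQ < X.2,
    forall t, X.2 <= t -> 0 < X.1.1 t,
    forall t, X.2 <= t -> is_derive t (1:R) X.1.1 (p j t * X.1.1 t) &
    [/\ diverges_to_ninfty tQ (h j) -> forall s t, X.2 <= s -> s <= t -> X.1.1 t <= X.1.2 * X.1.1 s,
        ~ diverges_to_ninfty tQ (h j) -> forall s t, X.2 <= s -> s <= t -> X.1.1 s <= X.1.2 * X.1.1 t &
        diverges_to_ninfty tQ (h j) -> X.1.1 t @[t --> +oo] --> (0 : R)]].
  have [E [M [T H]]] := kernel_exists vr_gt0 vr_mono rhoP k_ge1 e_gt0 e_to0 lval_OE H1_C H10 t0Q vsigP (h_cases j).
  by exists (E, M, T).
pose M := 1 + \sum_j (X j).1.2.
pose T := \big[Order.max/tQ + 1]_j (X j).2.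
have XM j : (X j).1.2 <= M.
  rewrite /M (bigD1 j) //= addrCA lerDl addr_ge0 // sumr_ge0 // => i _.
  by have [/ltW] := XP i.
have XT j : (X j).2 <= T by apply: le_bigmax.
exists (fun j => (X j).1.1), M, T; split.
- by rewrite ltr_pwDl // sumr_ge0 // => i _; have [/ltW] := XP i.
- by apply: (@lt_le_trans _ _ (tQ + 1)); [rewrite ltrDl|exact: bigmax_ge_id].
- move=> j t Tt; have [_ _ E0 dE _] := XP j.
  by split; [apply: E0|apply: dE]; exact: le_trans (XT j) Tt.
- move=> j hj; have [_ _ E0 _ [H _ cE]] := XP j; split; last exact: cE.
  move=> u t Tu ut; apply: le_trans (H hj u t (le_trans (XT j) Tu) ut) _.
  by rewrite ler_wpM2r // ltW // E0 // (le_trans (XT j)).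
- move=> j hj u t Tu ut; have [_ _ E0 _ [_ H _]] := XP j.
  apply: le_trans (H hj u t (le_trans (XT j) Tu) ut) _.
  by rewrite ler_wpM2r // ltW // E0 // (le_trans (XT j)) // (le_trans Tu).
Qed.

Lemma lift_sol_approx T z CQ : tQ < T -> (forall t, tQ <= t -> `|Q t| <= CQ) ->
  z t @[t --> +oo] --> (0 : vec) ->
  (fun t => lift_sol z t - s t) =o_ (pinfty_nbhs R) (fun t => e t `^ sigma).
Proof.
move=> QT hQ cz; apply/eqoP => x x0.
have CQ0 : 0 <= CQ by apply: le_trans (hQ tQ (lexx _)).
have c0 : 0 < n%:R * CQ + 1 by rewrite ltr_wpDl // mulr_ge0.
have /cvg_evP/(_ _ (divr_gt0 x0 c0))[T1 H1] := cz.
apply/(iffRL (evP _)); exists (Num.max T T1) => t; rewrite ge_max => /andP[Tt T1t].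
have -> : lift_sol z t - s t = e t `^ sigma *: (Q t *m z t) by rewrite /lift_sol addrC addKr.
rewrite normrZ mulrC; apply: ler_wpM2r => //.
apply: le_trans (mulmx_norm_le _ _) _.
have := H1 t T1t; rewrite sub0r normrN ltr_pdivlMr // => /ltW hz; apply: le_trans hz.
rewrite mulrA mulrC; apply: ler_wpM2l => //.
apply: (@le_trans _ _ (n%:R * CQ)); last by rewrite lerDl.
by apply: ler_wpM2l => //; apply: hQ; rewrite (le_trans (ltW QT)).
Qed.

Lemma solution_family : exists T1, forall T, T1 <= T -> tQ < T /\
  exists (eta : R) (y : vec -> R -> vec), 0 < eta /\
  forall theta : vec, `|theta| <= eta ->
  [/\ approx_solution t0 A f phi0 a eps fl vr rho k phi sigma T (y theta),
      forall theta' : vec, `|theta'| <= eta -> y theta T = y theta' T ->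
        forall j, diverges_to_ninfty tQ (h j) -> theta j 0 = theta' j 0 &
      forall t, T <= t -> exists C, forall theta' : vec, `|theta'| <= eta ->
        `|y theta t - y theta' t| <= C * `|theta - theta'|].
Proof.
have a20 : 0 < a / 2 by rewrite divr_gt0.
have [C1 [T1 [C10 t0T1 hL]]] := G_lipschitz A f a_gt0 vr_gt0 vr_mono rhoP k_ge1 e_gt0 e_to0
  lval_OE H2 H3 phi_bound.
have [C2 [T2 [C20 t0T2 hZ]]] := G_zero a_gt0 vr_gt0 vr_mono rhoP k_ge1 e_gt0 e_to0
  lval_OE phi0_sol H1_C H2 H3 phi_bound phi_sol.
have [E [M [T3 [M0 QT3 EP Ediv Endiv]]]] := kernels_exist.
have [Q1 [CQ hQ] _ [c [c0 hc]]] := Qlyap.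
pose Ts := Num.max T3 (Num.max T1 T2).
have QTs : tQ < Ts by rewrite lt_max QT3.
have t0Ts := le_trans t0Q (ltW QTs).
have T1s : T1 <= Ts by rewrite !le_max lexx orbT.
have T2s : T2 <= Ts by rewrite !le_max lexx !orbT.
have cQ : continuous_on Ts Q by exact: continuous_on_sub (ltW QTs) (Q1.2 0%N isT).
have e_gt0' t : Ts <= t -> 0 < e t by move=> tt; apply: e_gt0; exact: le_trans tt.
have ce : continuous_on Ts e by apply: (continuous_on_sub t0Ts); exact: (H1_C ord0).2 0%N isT.
have kE : kappa = sigma + varpi by rewrite subrK.
have [] := @reduced_estimates R n e Ts sigma varpi kappa (a / 2) (C1 + C2) G Q CQ c a20 e_gt0' e_to0
  ce sigma_gt0 kE varpi_le (addr_ge0 C10 C20).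
- move=> t tt; apply: le_trans (hZ t (le_trans T2s tt)) _.
  by rewrite ler_wpM2r ?powR_ge0 // lerDr.
- move=> t r r' M' tt Ma hr hr'; apply: le_trans ((hL t (le_trans T1s tt)).2 r r' M' Ma hr hr') _.
  have M'0 : 0 <= M' by apply: le_trans hr.
  by rewrite ler_wpM2r // ler_wpM2r // ler_wpM2r ?lerDl // ltW // e_gt0'.
- move=> T z TT cz hz.
  apply: (@G_cont R n m t0 A f phi0 a eps fl vr rho k phi) => //.
    exact: le_trans TT.
  by move=> t tt; apply: (hL t _).1; rewrite (le_trans T1s) // (le_trans TT).
- exact: c0.
- by move=> t tt; apply: hQ; exact: le_trans (ltW QTs) tt.
- by move=> t tt; apply: hc; exact: le_trans (ltW QTs) tt.
- exact: cQ.
move=> C4 [T4 [C40 T4s small r0 [rL rc]]].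
have QT4 := lt_le_trans QTs T4s.
have [V [Vinf [dV cV Vle]]] := powR_integral_bound C40.
pose S : pred 'I_n := fun j => `[< diverges_to_ninfty tQ (h j) >].
have T34 t : T4 <= t -> T3 <= t.
  by move=> tt; apply: le_trans tt; apply: le_trans T4s; rewrite le_max lexx.
have [] := @perturbation_family R n T4 M Vinf S E p (fun t => C4 * e t `^ varpi) V
  (reduced e sigma G Q) M0.
- by move=> j t /T34 tt; exact: (EP j t tt).1.
- by move=> j t /T34 tt; exact: (EP j t tt).2.
- by move=> j /asboolP/Ediv[hj _] u t /T34 uu; exact: hj.
- by move=> j /asboolPn/Endiv hj u t /T34 uu; exact: hj.
- by move=> j /asboolP/Ediv[].
- by move=> t _; rewrite mulr_ge0 // powR_ge0.
- by move=> t tt; apply: dV; exact: lt_le_trans tt.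
- exact: cV.
- by move=> t tt; apply: Vle; exact: lt_le_trans tt.
- exact: r0.
- exact: rL.
- exact: rc.
move=> T5 H5'; exists (Num.max T4 T5) => T; rewrite ge_max => /andP[T4T T5T].
have QT := lt_le_trans QT4 T4T.
split => //; have [eta [eta0 [z zP]]] := H5' T T5T.
exists eta, (fun theta => lift_sol (z theta)); split => // theta th.
have [z1 dz cz zT zL] := zP theta th; split.
- split; last exact: lift_sol_approx QT hQ cz.
  apply: lift_sol_solves => //.
    move=> t Tt; apply: (hL t _).1; apply: le_trans T1s _; apply: le_trans T4s _; exact: le_trans Tt.
  by move=> t Tt; apply: small; [exact: le_trans Tt|exact: z1].
- move=> theta' th' E' j hj.
  have [_ _ _ zT' _] := zP theta' th'.
  have Sj : S j by apply/asboolP.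
  (* For the decaying kernels the parameter is the value of z at T, and y determines that value
     because Q T is invertible and e T is positive. *)
  rewrite -zT // -zT' //; congr (fun_of_matrix _ j 0).
  have eT : 0 < e T by apply: e_gt0; rewrite (le_trans t0Q) // ltW.
  move: E' => /addrI/(scalerI (lt0r_neq0 (powR_gt0 sigma eT))).
  by move/(congr1 (mulmx (invmx (Q T)))); rewrite !mulKmx // Q_unit // ltW.
move=> t Tt; exists (e t `^ sigma * (n%:R * (CQ * (2 * M)))) => theta' th'.
rewrite /lift_sol.
have -> : s t + e t `^ sigma *: (Q t *m z theta t) - (s t + e t `^ sigma *: (Q t *m z theta' t)) =
   e t `^ sigma *: (Q t *m (z theta t - z theta' t)).
  by rewrite mulmxBr scalerBr; apply/matrixP => i j; rewrite !mxE; ring.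
rewrite normrZ (ger0_norm (powR_ge0 _ _)) -!mulrA; apply: ler_wpM2l; first exact: powR_ge0.
apply: le_trans (mulmx_norm_le _ _) _; apply: ler_wpM2l => //.
apply: ler_pM => //; first by apply: hQ; rewrite (le_trans (ltW QT)).
by rewrite mulrA; exact: zL.
Qed.

End solution_family.

Theorem mainTheorem4 (R : realType) (n m : nat) (n_ge2 : (2 <= n)%N) (t0 : R)
  (A : 'M[R]_n) (lam : 'I_n -> R[i]) (lamA : eigenvalues_of A lam)
  (K : set (R -> R)) (K3 : is_K3 t0 lam K)
  (f : R -> 'cV[R]_n) (fK : K3v K f)
  (phi0 : R -> 'cV[R]_n) (phi0K : K3v K phi0) (phi0C1 : Cn_on t0 1 phi0)
  (phi0_sol : solves t0 (fun t x => A *m x + f t) phi0)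
  (a : R) (a_gt0 : 0 < a)
  (eps : 'I_m.+1 -> R -> R) (fl : 'I_m.+1 -> R * 'cV[R]_n -> 'cV[R]_n)
  (vr : 'I_m.+1 -> R) (vr_gt0 : forall l, 0 < vr l)
  (vr_mono : forall l l' : 'I_m.+1, (l <= l')%N -> vr l <= vr l')
  (rho : nat -> R) (rhoP : rank_enum vr rho)
  (k : nat) (k_ge1 : (1 <= k)%N)
  (H1_C : forall l, Cn_on t0 (p_ord vr rho k l) (eps l))
  (H1_O : forall l r, (r <= p_ord vr rho k l)%N ->
     iter r (deriv_on t0) (eps l)
       =O_ (pinfty_nbhs R) (fun t => eps ord0 t `^ ((vr l + r%:R) / vr ord0)))
  (H1_ge0 : forall t, t0 <= t -> 0 <= eps ord0 t)
  (H1_o : eps ord0 =o_ (pinfty_nbhs R) (fun=> 1 : R))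
  (H2 : forall l, C0q (tube t0 a phi0) (y_ord vr rho k l) (fl l))
  (H3 : forall l (w : mindex n), (mabs w <= y_ord vr rho k l)%N ->
     bounded_on (tube t0 a phi0) (mpartial (tube t0 a phi0) w (fl l)))
  (H4 : forall l, vr l <= rho k ->
     forall w : mindex n, (mabs w)%:Z <= q_ord vr rho k l ->
     K3v K (fun t => mpartial (tube t0 a phi0) w (fl l) (t, phi0 t)))
  (varpi : R) (varpi_gt0 : 0 < varpi)
  (H5 : conv_int_p t0 varpi (eps ord0))
  (H6 : forall l, 1 <= rho k - vr l ->
     forall r, (1 <= r)%N -> r%:Z <= Num.floor (rho k - vr l) ->
     conv_int_p t0 1 (iter r (deriv_on t0) (eps l)))
  (H7 : forall l, vr l <= varpi * vr ord0 ->
     let s_l := Num.truncn (varpi - vr l / vr ord0) in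
     [/\ C0q (tube t0 a phi0) s_l.+2 (fl l),
         forall w : mindex n, (3 <= mabs w <= s_l.+2)%N ->
           bounded_on (tube t0 a phi0) (mpartial (tube t0 a phi0) w (fl l)) &
         forall w : mindex n, (1 <= mabs w <= s_l.+1)%N ->
           K3v K (fun t => mpartial (tube t0 a phi0) w (fl l) (t, phi0 t))])
  (H8 : ~ Delta lam 0)
  (H9 : forall l, ~ conv_int_p t0 1 (eps l) ->
     [/\ (forall t t', t0 <= t -> t <= t' -> eps l t <= eps l t') \/
         (forall t t', t0 <= t -> t <= t' -> eps l t' <= eps l t),
         eps l t @[t --> +oo] --> (0 : R),
         Cn_on t0 1 (eps l) &
         conv_int_p t0 1 (deriv_on t0 (eps l))])
  (H9_gt0 : forall t, t0 <= t -> 0 < eps ord0 t)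
  (H10 : forall (g1 : R) (gw : mindex m.+1 -> R),
     let h := fun t => g1 * (eps ord0 t)^-1 * deriv_on t0 (eps ord0) t
       + \sum_(w \in mu_indices t0 varpi eps) gw w * mu_eps eps w t in
     (\forall t \near +oo, 0 <= h t) \/ (\forall t \near +oo, h t <= 0))
  (H11_gt : vr ord0 * varpi < rho k.+1)
  (H11_ge : vr ord0 * (2 * varpi - 1) <= rho k.+1) :
  let sigma := rho k.+1 / vr ord0 - varpi in
  (exists phi : monomial m -> R -> 'cV[R]_n,
     is_coefficients t0 A phi0 a fl vr rho k phi K) /\
  forall phi : monomial m -> R -> 'cV[R]_n,
    is_coefficients t0 A phi0 a fl vr rho k phi K ->
    let s := asym_sum t0 phi0 eps vr rho k phi in
    let solution := approx_solution t0 A f phi0 a eps fl vr rho k phi sigma in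
    (* the enlarged t0 from which the reduction by Q is available *)
    forall (tQ : R), t0 <= tQ ->
    (forall t, tQ <= t -> tube t0 a phi0 (t, s t)) ->
    (exists2 t, tQ <= t &
       residual t0 A f phi0 eps fl vr rho k phi t != 0) ->
    forall (Q : R -> 'M[R]_n) (gamma : 'I_n -> mindex m.+1 -> R[i])
      (vsig : 'I_n -> R -> R[i]),
    lyapunov_matrix tQ Q ->
    (exists2 d : R, d != 0 & \det (Q t) @[t --> +oo] --> d) ->
    (forall j, [/\ conv_int_C tQ (vsig j),
                   continuous_on tQ (@complex.Re R \o vsig j) &
                   continuous_on tQ (@complex.Im R \o vsig j)]) ->
    transforms tQ Q (Ahat t0 A phi0 a eps fl vr rho k phi)
      (ReD (dfun t0 varpi eps lam gamma vsig)) ->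
    let h := fun j t =>
      pjj t0 varpi (rho k.+1 / vr ord0) eps lam gamma vsig j t
      - complex.Re (vsig j t) in
    (forall j, (forall t, tQ <= t -> 0 <= h j t) \/
               diverges_to_ninfty tQ (h j)) ->
    let N := #|[set j : 'I_n | `[< diverges_to_ninfty tQ (h j) >]]%SET| in
    \forall T \near +oo,
      [/\ tQ <= T,
          exists y, solution T y,
          exists (tc : 'rV[R]_N -> R) (y : 'rV[R]_N -> R -> 'cV[R]_n),
            (forall c, T <= tc c /\ solution (tc c) (y c)) /\
            param_family tc y &
          (* at most n independent parameters: a solution is determined by
             the n entries of its value at one time *)
          (N <= n)%N /\
          forall y1 y2,
            solves_in_tube t0 A f phi0 a eps fl T y1 ->
            solves_in_tube t0 A f phi0 a eps fl T y2 ->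
            forall t', T <= t' -> y1 t' = y2 t' ->
            forall t, T <= t -> y1 t = y2 t].
Proof.
split; first exact: coefficients_exist lamA K3 H8 vr_gt0 vr_mono rhoP H4.
move=> phi phiP s solution tQ t0Q _ _ Q gamma vsig Qlyap _ vsigP tr h h_cases N.
have e_to0 : eps ord0 t @[t --> +oo] --> (0 : R).
  apply/cvg_evP => x x0; move/eqoP: H1_o => /(_ (x / 2)) H; have x20 : 0 < x / 2 by rewrite divr_gt0.
  have [T HT] := iffLR (evP _) (H x20); exists T => t Tt.
  rewrite sub0r normrN; apply: le_lt_trans (HT t Tt) _.
  by rewrite normr1 mulr1; lra.
have lval_OE l (r : nat) : (r <= p_ord vr rho k l)%N ->
    OE (eps ord0) ((vr l + r%:R) / vr ord0) (lval t0 eps (l, r)).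
  by move=> lr; apply: eqO_OE; exact: H1_O.
(* A nonempty monomial of rank at most rho_k has rank rho_s for some s <= k, so [phiP] applies to
   it. *)
have phiQ (nu : monomial m) : nu != mset0 -> nu \in s0 vr rho k ->
    [/\ K3v K (phi nu), Cn_on t0 1 (phi nu) &
        solves t0 (fun t x => A *m x + g_coef t0 phi0 a fl phi nu t) (phi nu)].
  move=> nu0; rewrite mem_s0 // => nuk.
  by have [r rk E] := rank_index rhoP k_ge1 nu0 nuk; apply: (phiP r).
have phi_bound (nu : monomial m) : nu != mset0 -> nu \in s0 vr rho k ->
    exists C, forall t, t0 <= t -> `|phi nu t| <= C.
  move=> nu0 ns; have [Kp _ _] := phiQ nu nu0 ns.
  have /choice[C HC] i := K3_bounded K3 (Kp i).
  have C0 i : 0 <= C i by apply: le_trans (HC i t0 (lexx _)).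
  exists (\sum_i C i) => t tt; apply/mx_norm_leP => [|i j]; first exact: sumr_ge0.
  rewrite ord1; apply: le_trans (HC i t tt) _.
  by rewrite (bigD1 i) //= lerDl sumr_ge0.
have phi_C1 (nu : monomial m) : nu != mset0 -> nu \in s0 vr rho k -> Cn_on t0 1 (phi nu).
  by move=> nu0 ns; have [] := phiQ nu nu0 ns.
have phi_sol (nu : monomial m) : nu != mset0 -> nu \in s0 vr rho k ->
    solves t0 (fun t x => A *m x + g_coef t0 phi0 a fl phi nu t) (phi nu).
  by move=> nu0 ns; have [] := phiQ nu nu0 ns.
have f_cont : continuous_on t0 f.
  by apply: continuous_on_mx => i j; rewrite ord1; exact: (@K3_cont _ _ _ _ _ K3 _ (fK i)).
have sigma_gt0 : 0 < rho k.+1 / vr ord0 - varpi.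
  by rewrite subr_gt0 ltr_pdivlMr // mulrC.
have varpi_le : varpi <= 1 + (rho k.+1 / vr ord0 - varpi).
  have : 2 * varpi - 1 <= rho k.+1 / vr ord0 by rewrite ler_pdivlMr // mulrC.
  by lra.
have [T1 H1] := solution_family a_gt0 vr_gt0 vr_mono rhoP k_ge1 H9_gt0 e_to0 lval_OE phi0_sol H1_C
  H2 H3 phi_bound phi_sol phi_C1 f_cont H5 H10 sigma_gt0 varpi_le t0Q Qlyap vsigP tr h_cases.
have [L [T2 [L0 _ hL]]] := rhs_lipschitz A f a_gt0 vr_gt0 k_ge1 H9_gt0 e_to0 lval_OE H2 H3.
apply/(iffRL (evP _)); exists (Num.max T1 T2) => T; rewrite ge_max => /andP[T1T T2T].
have [QT [eta [y [eta0 yP]]]] := H1 T T1T.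
split; first exact: ltW.
- exists (y 0); have [] := yP 0; first by rewrite normr0 ltW.
  by [].
(* All members of the family live on the same half-line [T, +oo); distinct constants are already
   separated at the time T. *)
- exists (fun=> T), (fun c => y (init_data eta c)); split.
    move=> c; split => //.
    by have [] := yP _ (init_data_le c eta0).
  split=> [c c' cc'|c0].
    exists T; split => //; apply: contra_neq cc' => E.
    have [_ inj _] := yP _ (init_data_le c eta0).
    apply: (init_data_inj eta0) => j; rewrite inE => /asboolP hj.
    exact: inj (init_data_le c' eta0) E j hj.
  exists T; split; first exact: (@filterE _ (nbhs c0) (@nbhs_filter _ c0) _ (fun=> lexx T)).
  move=> t Tt; have [_ _ /(_ t Tt)[C HC]] := yP _ (init_data_le c0 eta0).
  apply/(@cvgrPdist_lt _ _ _ _ (@nbhs_filter _ c0)) => x x0.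
  have C0 : 0 < `|C| * (2 * eta) + 1 by rewrite ltr_wpDl // !mulr_ge0 // ltW.
  apply/nbhs_ballP; exists (x / (`|C| * (2 * eta) + 1)) => /=; first by rewrite divr_gt0.
  move=> c; rewrite -ball_normE /= ltr_pdivlMr // => hc; apply: le_lt_trans hc.
  apply: le_trans (HC _ (init_data_le c eta0)) _.
  apply: le_trans (ler_wpM2r (normr_ge0 _) (ler_norm C)) _.
  apply: le_trans (ler_wpM2l (normr_ge0 C) (init_data_lip c0 c eta0)) _.
  by rewrite mulrDr mulr1 [X in _ <= X + _]mulrC mulrA lerDl.
- split; first by rewrite -[X in (_ <= X)%N]card_ord; exact: max_card.
move=> y1 y2 [D1 s1] [D2 s2] t' Tt' E t Tt; apply: (ode_unique L0 s1 s2) E t Tt => // u Tu.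
by apply: hL; [exact: le_trans Tu|exact: D1|exact: D2].
Qed.
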